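(* The beta prime process is a conjugate Bayesian nonparametric prior for the odds Bernoulli process. That is: let $\Theta=\sum_{k=1}^\infty\theta_k\delta_{\psi_k}$ be a beta prime process on $\Psi$ and, conditional on $\Theta$, let $X=\sum_{k=1}^\infty x_k\delta_{\psi_k}$ be an odds Bernoulli process. Then the distribution of $\Theta\mid X$ is again that of a beta prime process (with possibly different fixed-location atoms and hyperparameters).
   Context: $\Psi$ is a measurable space whose $\sigma$-algebra contains all singletons. A completely random measure (CRM) on $\Psi$ is a random measure taking independent values on disjoint measurable sets. The CRMs here have no deterministic component: each is the independent sum of a fixed-location component $\sum_k\theta_{fix,k}\delta_{\psi_{fix,k}}$ (deterministic distinct locations, independent random weights) and an ordinary component $\sum_k\theta_{ord,k}\delta_{\psi_{ord,k}}$, where $\{(\theta_{ord,k},\psi_{ord,k})\}$ are the points of a Poisson point process on $\mathbb{R}_+\times\Psi$ with rate measure $\nu(d\theta)G(d\psi)$; $\nu$ is the weight rate measure and $G$ a diffuse probability distribution on $\Psi$. $\Theta=\sum_k\theta_k\delta_{\psi_k}$ lists all atoms (fixed-location and ordinary). Beta prime process: a CRM with finitely many fixed-location atoms, $K_{prior,fix}<\infty$, whose weights $\theta_{fix,k}$ have the beta prime density with shape parameters $\xi_{fix,k}+1$ and $\lambda_{fix,k}-\xi_{fix,k}-1$, i.e. $$\frac{\Gamma(\lambda_{fix,k})}{\Gamma(\xi_{fix,k}+1)\Gamma(\lambda_{fix,k}-\xi_{fix,k}-1)}\,\theta^{\xi_{fix,k}}(1+\theta)^{-\lambda_{fix,k}},\qquad\theta>0,$$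 with $\xi_{fix,k}>-1$ and $\lambda_{fix,k}>\xi_{fix,k}+1$, and with an ordinary component having weight rate measure $\nu(d\theta)=\gamma\,\theta^{\xi}(1+\theta)^{-\lambda}\,d\theta$ on $\mathbb{R}_+$ with $\gamma>0$, $\xi\in(-2,-1]$, $\lambda>\xi+1$. Odds Bernoulli process: conditional on $\Theta=\sum_k\theta_k\delta_{\psi_k}$, $X=\sum_k x_k\delta_{\psi_k}$ where the $x_k\in\{0,1\}$ are independent with probability mass function $h(x\mid\theta_k)=\theta_k^{x}(1+\theta_k)^{-1}$. A prior family is conjugate to a likelihood if the posterior of $\Theta$ given $X$ is in the same family as the prior. *)

(* Defs.v *)
From HB Require Import structures.
From mathcomp Require Import all_boot all_order all_algebra.
From mathcomp Require Import all_classical all_reals all_analysis.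
From mathcomp Require Import measurable_realfun.
Set Implicit Arguments.
Unset Strict Implicit.
Unset Printing Implicit Defensive.
Import Order.TTheory GRing.Theory Num.Theory.
Import numFieldNormedType.Exports.
Local Open Scope classical_set_scope.
Local Open Scope ring_scope.
Local Open Scope ereal_scope.

(* The measures on [Psi], with the sigma-algebra generated by the evaluation
   maps [mu |-> mu A], [A] measurable: the space where random measures live. *)
Section measure_space.
Context (R : realType) d (Psi : measurableType d).

Definition all_measures : Type := {measure set Psi -> \bar R}.

HB.instance Definition _ := gen_eqMixin all_measures.
HB.instance Definition _ := gen_choiceMixin all_measures.
HB.instance Definition _ := isPointed.Build all_measures mzero.

Definition measure_eval (A : set Psi) (mu : all_measures) : \bar R :=
  (mu : {measure set Psi -> \bar R}) A.

Definition eval_preimages : set (set all_measures) :=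
  \bigcup_(A in measurable)
    preimage_set_system [set: all_measures] (measure_eval A) measurable.

Definition measure_space := g_sigma_algebraType eval_preimages.

End measure_space.

Definition sigma_of (Omega : Type) d (T : measurableType d) (I : Type)
    (D : set I) (f : I -> Omega -> T) : set (set Omega) :=
  <<s \bigcup_(i in D) preimage_set_system [set: Omega] (f i) measurable >>.

Section independence.
Context (R : realType) d (Omega : measurableType d) (P : probability Omega R).

Definition mutually_independent (I : choiceType) (F : I -> set (set Omega)) :=
  forall (J : seq I) (E : I -> set Omega), uniq J ->
    (forall i, i \in J -> F i (E i)) ->
    P (\bigcap_(i in [set` J]) E i) = (\prod_(i <- J) fine (P (E i)))%R%:E.

Definition independent2 (F G : set (set Omega)) :=
  forall A B, F A -> G B -> P (A `&` B) = P A * P B.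

End independence.

Definition point_count (R : realType) d (S : measurableType d) (z : nat -> S)
    (A : set S) : \bar R :=
  \esum_(k in [set: nat]) \d_(z k) A.

(* The random points [z 0, z 1, ...] (counted with multiplicity) form a Poisson
   point process.  Enumerating the points by all of [nat] forces infinitely many
   points, so this is meant for rate measures of infinite total mass.  The
   Poisson weights are written out because the library's [poisson_pmf] takes the
   value 1 everywhere at rate 0. *)
Record poisson_point_process (R : realType) d (Omega : measurableType d)
    (P : probability Omega R) dS (S : measurableType dS)
    (rate : set S -> \bar R) (z : nat -> Omega -> S) : Prop :=
{ ppp_finite : forall (A : set S) (r : R) (n : nat), measurable A ->
    rate A = r%:E ->
    P [set w | point_count R (z ^~ w) A = n%:R%:E]
      = (r ^+ n / n`!%:R * expR (- r))%R%:E ;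
  ppp_infinite : forall A : set S, measurable A -> rate A = +oo ->
    P [set w | point_count R (z ^~ w) A = +oo] = 1 ;
  ppp_independent : forall (n : nat) (A : 'I_n -> set S),
    (forall i, measurable (A i)) -> trivIset [set: 'I_n] A ->
    mutually_independent P (fun i => preimage_set_system [set: Omega]
      (fun w => point_count R (z ^~ w) (A i)) measurable) }.

(* The random measure [sum_k w_k delta_(psi_k)]. *)
Definition is_atomic_sum (R : realType) d (Omega : Type)
    (Psi : measurableType d) (I : choiceType) (w : I -> Omega -> R)
    (psi : I -> Omega -> Psi) (M : Omega -> measure_space R Psi) : Prop :=
  forall (omega : Omega) (A : set Psi), measurable A ->
    measure_eval A (M omega)
      = \esum_(k in [set: I]) (w k omega)%:E * \d_(psi k omega) A.

(* Atoms of a completely random measure without deterministic component: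
   [inl k] is the k-th fixed-location atom, [inr k] the k-th ordinary atom.
   [psi_fix] are the fixed locations, [nu] is the weight rate measure, [G] the
   location distribution.  The last field says that the [psi_k] are the actual,
   pairwise distinct, atoms; when the diagonal of [Psi * Psi] is measurable it
   follows from the diffuseness of [G]. *)
Record crm_atoms (R : realType) d (Omega : measurableType d)
    (P : probability Omega R) dPsi (Psi : measurableType dPsi) (K : nat)
    (psi_fix : 'I_K -> Psi) (nu : set R -> \bar R) (G : probability Psi R)
    (theta : 'I_K + nat -> {RV P >-> R})
    (psi : 'I_K + nat -> {RV P >-> Psi}) : Prop :=
{ crm_weight_gt0 : forall k omega, (0 < theta k omega)%R ;
  crm_fix_loc : forall k omega, psi (inl k) omega = psi_fix k ;
  crm_fix_independent : mutually_independent P (fun k : 'I_K =>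
    preimage_set_system [set: Omega] (theta (inl k)) measurable) ;
  crm_ord_poisson : poisson_point_process P (nu \x G)
    (fun k omega => (theta (inr k) omega, psi (inr k) omega)) ;
  crm_fix_ord_independent : independent2 P
    (sigma_of [set: 'I_K] (fun k => theta (inl k)))
    (sigma_of measurable (fun (A : set (R * Psi)) omega =>
      point_count R
        (fun k => (theta (inr k) omega, psi (inr k) omega)) A)) ;
  crm_distinct : {ae P, forall omega, injective (fun k => psi k omega)} }.

Section beta_prime.
Context (R : realType).

Definition Gamma (a : R) : R :=
  \int[lebesgue_measure]_(t in `]0%R, +oo[%classic)
    (t `^ (a - 1) * expR (- t))%R.

Definition beta_prime_shape (xi lambda t : R) : R :=
  (t `^ xi * (1 + t) `^ (- lambda))%R.

Definition beta_prime_density (xi lambda t : R) : R :=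
  (Gamma lambda / (Gamma (xi + 1) * Gamma (lambda - xi - 1))
   * beta_prime_shape xi lambda t)%R.

Record beta_prime_param d (Psi : measurableType d) := BetaPrimeParam {
  bp_K : nat ;
  bp_loc : 'I_bp_K -> Psi ;
  bp_loc_inj : injective bp_loc ;
  bp_xi_fix : 'I_bp_K -> R ;
  bp_lambda_fix : 'I_bp_K -> R ;
  bp_xi_fix_gt : forall k, (-1 < bp_xi_fix k)%R ;
  bp_lambda_fix_gt : forall k, (bp_xi_fix k + 1 < bp_lambda_fix k)%R ;
  bp_gamma : R ;
  bp_xi : R ;
  bp_lambda : R ;
  bp_gamma_gt0 : (0 < bp_gamma)%R ;
  bp_xi_gt : (-2 < bp_xi)%R ;
  bp_xi_le : (bp_xi <= -1)%R ;
  bp_lambda_gt : (bp_xi + 1 < bp_lambda)%R ;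
  bp_G : probability Psi R ;
  bp_G_diffuse : forall p : Psi, bp_G [set p] = 0 }.

Definition weight_rate d (Psi : measurableType d) (h : beta_prime_param Psi)
    (A : set R) : \bar R :=
  \int[lebesgue_measure]_(t in A `&` `]0%R, +oo[%classic)
    (bp_gamma h * beta_prime_shape (bp_xi h) (bp_lambda h) t)%R%:E.

Section weight_rate_measure.
Context d (Psi : measurableType d) (h : beta_prime_param Psi).

Let weight_rate0 : weight_rate h set0 = 0.
Proof. by rewrite /weight_rate set0I integral_set0. Qed.

Let density_ge0 (t : R) :
  0 <= (bp_gamma h * beta_prime_shape (bp_xi h) (bp_lambda h) t)%R%:E.
Proof.
by rewrite lee_fin /beta_prime_shape !mulr_ge0// ?powR_ge0// ltW ?bp_gamma_gt0.
Qed.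

Let weight_rate_ge0 A : 0 <= weight_rate h A.
Proof. exact: integral_ge0. Qed.

Let weight_rate_sigma_additive : semi_sigma_additive (weight_rate h).
Proof.
move=> F mF tF mUF; rewrite /weight_rate; apply: cvg_toP.
  apply: ereal_nondecreasing_is_cvgn => m n mn.
  by apply: lee_sum_nneg_natr => // k _ _; exact: integral_ge0.
rewrite setI_bigcupl ge0_integral_bigcup//=.
- by move=> k; apply: measurableI; [exact: mF|exact: measurable_itv].
- apply/measurable_funTS/measurable_EFinP.
  apply: measurable_funM => //; apply: measurable_funM => //.
  apply: (@measurableT_comp _ _ _ _ _ _ (@powR R ^~ (- bp_lambda h)%R) _
    (fun t : R => 1 + t)%R) => //.
  exact: measurable_funD.
- exact: trivIset_setIr.
Qed.

HB.instance Definition _ := isMeasure.Build _ _ _ (weight_rate h)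
  weight_rate0 weight_rate_ge0 weight_rate_sigma_additive.

End weight_rate_measure.

Record beta_prime_atoms d (Omega : measurableType d) (P : probability Omega R)
    dPsi (Psi : measurableType dPsi) (h : beta_prime_param Psi)
    (theta : 'I_(bp_K h) + nat -> {RV P >-> R})
    (psi : 'I_(bp_K h) + nat -> {RV P >-> Psi}) : Prop :=
{ bp_crm : crm_atoms (@bp_loc _ _ h) (weight_rate h) (bp_G h) theta psi ;
  bp_fix_law : forall (k : 'I_(bp_K h)) (A : set R), measurable A ->
    distribution P (theta (inl k)) A
      = \int[lebesgue_measure]_(t in A `&` `]0%R, +oo[%classic)
          (beta_prime_density (bp_xi_fix k) (bp_lambda_fix k) t)%:E }.

Definition beta_prime_process d (Omega : measurableType d)
    (P : probability Omega R) dPsi (Psi : measurableType dPsi)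
    (Theta : Omega -> measure_space R Psi) : Prop :=
  exists (h : beta_prime_param Psi)
    (theta : 'I_(bp_K h) + nat -> {RV P >-> R})
    (psi : 'I_(bp_K h) + nat -> {RV P >-> Psi}),
    beta_prime_atoms theta psi /\ is_atomic_sum theta psi Theta.

(* [Q] is the distribution of some beta prime process, on some probability
   space. *)
Definition beta_prime_law dPsi (Psi : measurableType dPsi)
    (Q : probability (measure_space R Psi) R) : Prop :=
  exists (d : measure_display) (Omega : measurableType d)
    (P : probability Omega R) (Theta : Omega -> measure_space R Psi),
    beta_prime_process P Theta /\
    forall B, measurable B -> Q B = P (Theta @^-1` B).

(* Conditionally on the atoms [(theta_k, psi_k)_k], the marks [x_k] are
   independent with probability mass function [h (. | theta_k)]. *)
Definition odds_bernoulli_pmf (x : bool) (t : R) : R := (t ^+ x / (1 + t))%R.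

Definition odds_bernoulli_marks d (Omega : measurableType d)
    (P : probability Omega R) dPsi (Psi : measurableType dPsi) (I : choiceType)
    (theta : I -> {RV P >-> R}) (psi : I -> {RV P >-> Psi})
    (x : I -> {RV P >-> bool}) : Prop :=
  forall (J : seq I) (e : I -> bool) (E : set Omega), uniq J ->
    sigma_of [set: I] (fun k omega => (theta k omega, psi k omega)) E ->
    P (E `&` [set omega | forall k, k \in J -> x k omega = e k])
      = \int[P]_(omega in E)
          (\prod_(k <- J) odds_bernoulli_pmf (e k) (theta k omega))%R%:E.

End beta_prime.

(* [kappa] is a regular conditional distribution of [Y] given (the sigma-algebra
   generated by) [X]. *)
Definition conditional_distribution (R : realType) d (Omega : measurableType d)
    (P : probability Omega R) dX (TX : measurableType dX)
    dY (TY : measurableType dY) (X : Omega -> TX) (Y : Omega -> TY)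
    (kappa : Omega -> probability TY R) : Prop :=
  let sigma_X := preimage_set_system [set: Omega] X measurable in
  forall B : set TY, measurable B ->
    (forall V : set (\bar R), measurable V ->
      sigma_X [set omega | V (kappa omega B)]) /\
    (forall A, sigma_X A ->
      P (A `&` Y @^-1` B) = \int[P]_(omega in A) kappa omega B).

(* Main.v *)
Require Import Defs.
From HB Require Import structures.
From mathcomp Require Import all_boot all_order all_algebra.
From mathcomp Require Import all_classical all_reals all_analysis.
From mathcomp Require Import measurable_realfun.
From mathcomp Require Import ring lra.
Set Implicit Arguments.
Unset Strict Implicit.
Unset Printing Implicit Defensive.
Import Order.TTheory GRing.Theory Num.Theory.
Import numFieldNormedType.Exports.
Local Open Scope classical_set_scope.
Local Open Scope ring_scope.

(** The law of a random measure [M] is determined by its Laplace functional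
    [a |-> E exp (- \int a dM)], [a >= 0] measurable, because the exponentials are
    closed under products ([multiplicative_system]).  The theorem is proved by
    comparing joint Laplace functionals of the observation [X] and of [Theta].

    They are explicit.  For a completely random measure the fixed atoms contribute
    one factor each, and the ordinary component contributes the exponential of an
    integral against its rate ([crm_laplace]).  Given the atoms, a mark can be
    averaged out: an exponential that depends on it is replaced by the mean of its
    two values with weights [t / (1 + t)] and [1 / (1 + t)] ([marks_laplace]).

    Conjugacy comes from the identities
      [t / (1 + t) * (t ^ xi * (1 + t) ^ - lam) = t ^ (xi+1) * (1 + t) ^ - (lam+1)],
      [1 / (1 + t) * (t ^ xi * (1 + t) ^ - lam) = t ^ xi * (1 + t) ^ - (lam+1)].
    For a fixed atom they say that, given its mark [x], its weight has a beta prime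
    law of parameters [xi + x] and [lam + 1] ([fixed_factor]).  For the ordinary
    component they split the weight rate into the rate of the unobserved atoms,
    with [lam + 1] in place of [lam], and the rate of the observed ones.  The latter
    is integrable since [xi > - 2], so almost surely finitely many ordinary atoms
    are observed ([observed_finite]), and it is proportional to the beta prime
    density of parameters [xi + 1] and [lam + 1], which becomes the law of the
    weight at an observed location ([ordinary_factor]).  The beta integral
    ([beta_integral]) ensures that these densities have mass 1.

    The posterior process is built from the prior one: the unobserved ordinary
    atoms, renumbered, are its ordinary component, which is a Poisson process by
    its Laplace functional ([laplace_ppp]), and independent weights are added at
    the fixed and observed locations ([posterior_construction]).  The kernel [kappa]
    takes these locations and the marks of the fixed atoms from the value of [X].
    Its Laplace functional is a measurable function of [X] ([post_laplace]), so
    [kappa] is measurable with respect to [X], and the joint Laplace functional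
    computed with [kappa] in place of [Theta] is the original one
    ([joint_laplace], [joint_post_laplace]), which is the disintegration
    ([laplace_disintegration]). *)

(** * The exponential of minus an extended real *)

Section expN.
Context (R : realType).

(** [exp (- y)], continued by 0 at [+oo], so that Laplace functionals make sense
    for random measures of infinite mass. *)
Definition eN (y : \bar R) : R := fine (er_map (fun r => expR (- r)) y).

Lemma measurable_eN : measurable_fun setT eN.
Proof.
apply: (@measurableT_comp _ _ _ _ _ _ fine) => //.
apply: (measurable_er_map (measurableTypeR R)).
apply: (measurableT_comp (@measurable_expR R)); exact: oppr_measurable.
Qed.

Lemma eN_ge0 y : 0 <= eN y.
Proof. by case: y => [r||] //=; rewrite /eN /= expR_ge0. Qed.

Lemma eN0 : eN 0%E = 1. Proof. by rewrite /eN/= oppr0 expR0. Qed.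

Lemma eN_le1 y : (0 <= y)%E -> eN y <= 1.
Proof.
case: y => [r||] //=; rewrite /eN /= ?ler01 // lee_fin => r0.
by rewrite -expR0 ler_expR; lra.
Qed.

Lemma eN_ubound y : (0 <= y)%E -> `|eN y| <= 1.
Proof. by move=> y0; rewrite ger0_norm ?eN_ge0// eN_le1. Qed.

Lemma eND x y : (0 <= x)%E -> (0 <= y)%E -> eN (x + y)%E = eN x * eN y.
Proof.
case: x => [r||] //; case: y => [s||] // _ _; rewrite /eN /= ?mulr0 ?mul0r//.
by rewrite opprD expRD.
Qed.

Lemma eN_sum (I : Type) (s : seq I) (P : pred I) (F : I -> \bar R) :
  (forall i, (0 <= F i)%E) ->
  eN (\sum_(i <- s | P i) F i)%E = \prod_(i <- s | P i) eN (F i).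
Proof.
move=> F0; elim: s => [|i s ih]; first by rewrite !big_nil eN0.
by rewrite !big_cons; case: ifP => // _; rewrite eND ?ih// sume_ge0.
Qed.

Lemma eN_cvg_nd (u : (\bar R)^nat) (l : \bar R) : (forall n, (0 <= u n)%E) ->
  u @ \oo --> l -> (fun n => eN (u n)) @ \oo --> eN l.
Proof.
move=> u0 ul.
have l0 : (0 <= l)%E by rewrite -(cvg_lim _ ul)//; apply: lime_ge;
  [apply/cvg_ex; exists l|exact: nearW].
case: l l0 ul => [r| |] // _ ul.
- have /fine_cvgP[ufin ur] := ul.
  have E : (fun n => expR (- fine (u n))) @ \oo --> eN r%:E.
    apply: (cvg_comp _ expR); last exact: continuous_expR.
    exact: cvgN.
  apply: cvg_trans E; apply: near_eq_cvg; near=> n.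
  have : u n \is a fin_num by near: n.
  by move=> /fineK <-.
- rewrite /eN /=; apply/cvgrPdist_lt => e e0.
  move/cvgeyPge : ul => /(_ (- ln e + 1)) ul.
  near=> n; rewrite sub0r normrN.
  have : (((- ln e + 1)%:E) <= u n)%E by near: n.
  have := u0 n; case: (u n) => [s| |] //=; last by rewrite normr0.
  rewrite !lee_fin => s0 h; rewrite ger0_norm ?expR_ge0//.
  rewrite -[ltRHS]lnK ?posrE// ltr_expR; lra.
Unshelve. all: by end_near. Qed.

(** Left inverse of [eN] on nonnegative numbers: it lets a sigma-algebra that makes
    [eN \o phi] measurable make [phi] measurable too. *)
Definition neglne (s : R) : \bar R := if s <= 0 then +oo%E else (- ln s)%:E.

Lemma measurable_neglne : measurable_fun setT neglne.
Proof.
apply: measurable_fun_ifT => //=.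
- by apply: measurable_fun_ler.
- apply/measurable_EFinP; apply: measurableT_comp => //; exact: measurable_ln.
Qed.

Lemma eNK y : (0 <= y)%E -> neglne (eN y) = y.
Proof.
case: y => [r| |] //; rewrite /neglne/eN/= ?lexx// => _.
by rewrite leNgt expR_gt0 /= expRK opprK.
Qed.

End expN.

(** * A functional form of the monotone class theorem *)

Section bounded_class.
Context (R : realType) (T : Type).

(** The closure properties shared by all sets of test functions on which two
    expectations agree; such a set is in general not closed under products. *)
Record bounded_class (H : set (T -> R)) : Prop := BoundedClass {
  bc_lin : forall c f g, H f -> H g -> H (fun x => c * f x + g x) ;
  bc_lim : forall (f : nat -> T -> R) g M, (forall n, H (f n)) ->
    (forall n x, `|f n x| <= M) -> (forall x, f ^~ x @ \oo --> g x) -> H g }.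

Section theory.
Variable H : set (T -> R).
Hypothesis bcH : bounded_class H.

Lemma bc_ext f g : H f -> f =1 g -> H g.
Proof. by move=> + /funext => /[swap] <-. Qed.

Lemma bc0 f : H f -> H (fun=> 0).
Proof.
move=> Hf; apply: bc_ext (bc_lin bcH (-1) Hf Hf) _ => x.
by rewrite mulN1r addNr.
Qed.

Lemma bcB f g : H f -> H g -> H (fun x => f x - g x).
Proof.
move=> Hf Hg; apply: bc_ext (bc_lin bcH (-1) Hg Hf) _ => x.
by rewrite mulN1r addrC.
Qed.

Lemma bcD f g : H f -> H g -> H (fun x => f x + g x).
Proof.
move=> Hf Hg; apply: bc_ext (bc_lin bcH 1 Hg Hf) _ => x.
by rewrite mul1r addrC.
Qed.

Lemma bcZ c f : H f -> H (fun x => c * f x).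
Proof.
move=> Hf; apply: bc_ext (bc_lin bcH c Hf (bc0 Hf)) _ => x.
by rewrite addr0.
Qed.

Lemma bc_sum (I : Type) (s : seq I) (F : I -> T -> R) : H (fun=> 0) ->
  (forall i, H (F i)) -> H (fun x => \sum_(i <- s) F i x).
Proof.
move=> H0 HF; elim: s => [|i s ih].
  by apply: bc_ext H0 _ => x; rewrite big_nil.
by apply: bc_ext (bcD (HF i) ih) _ => x; rewrite big_cons.
Qed.

End theory.
End bounded_class.

(** With [s = sqrt r], [n * s ^ n] is bounded by the geometric series
    [(1 - s)^-1], and the remaining factor [s ^ n] tends to 0. *)
Lemma cvg_n_expr (R : realType) (r : R) : 0 <= r < 1 ->
  (fun n => n%:R * r ^+ n) @ \oo --> (0 : R).
Proof.
move=> /andP[r0 r1]; set s := Num.sqrt r.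
have s0 : 0 <= s by exact: sqrtr_ge0.
have s1 : s < 1 by rewrite -[ltRHS]sqrtr1 ltr_sqrt.
have rE : r = s * s by rewrite -expr2 sqr_sqrtr.
have bd n : n%:R * s ^+ n <= (1 - s)^-1.
  rewrite -[leRHS]mul1r ler_pdivlMr ?subr_gt0//.
  apply: (@le_trans _ _ ((\sum_(i < n) s ^+ i) * (1 - s))).
    rewrite ler_wpM2r ?subr_ge0 ?(ltW s1)//.
    rewrite mulr_natl -[X in _ *+ X]card_ord -sumr_const ler_sum// => i _.
    by rewrite ler_wiXn2l ?(ltW s1)// ltnW.
  by rewrite mulrC -opprB mulNr -subrX1 opprB lerBlDr lerDl exprn_ge0.
apply: (@squeeze_cvgr _ _ _ _ (fun=> 0) (fun n => (1 - s)^-1 * s ^+ n)).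
- near=> n; rewrite mulr_ge0 ?exprn_ge0//= rE exprMn mulrA.
  by rewrite ler_wpM2r// exprn_ge0.
- exact: cvg_cst.
- by apply: cvg_geometric; rewrite ger0_norm.
Unshelve. all: by end_near. Qed.

Section step_approx.
Context (R : realType).

(** The exponent [m] is about [n.+1 * c ^- n.+1], so [m * u ^ n.+1] is about
    [n.+1 * (u / c) ^ n.+1].  It tends to 0 for [u < c], where the inequality of
    Bernoulli sends the power to 1; it is at least [n.+1] for [u >= c], where
    [1 - v <= exp (- v)] sends the power to 0.  Explicit polynomials replace the
    Weierstrass approximation theorem. *)
Lemma step_approx (c u : R) : 0 < c <= 1 -> 0 <= u <= 1 ->
  (fun n => (1 - u ^+ n.+1) ^+ (Num.truncn (n.+1%:R * c ^- n.+1)).+1) @ \oo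
    --> ((u < c)%R%:R : R).
Proof.
move=> /andP[c0 c1] /andP[u0 u1].
have un01 n : 0 <= u ^+ n <= 1 by rewrite exprn_ge0//= exprn_ile1.
have m_ge n : n.+1%:R * c ^- n.+1 <= (Num.truncn (n.+1%:R * c ^- n.+1)).+1%:R :> R.
  by apply/ltW/truncnS_gt.
have m_le n : (Num.truncn (n.+1%:R * c ^- n.+1)).+1%:R <= n.+1%:R * c ^- n.+1 + 1 :> R.
  rewrite -natr1 lerD2r truncn_le// mulr_ge0// invr_ge0 exprn_ge0//; exact: ltW.
case: ltP => uc /=.
- have rb : 0 <= u / c < 1 by rewrite divr_ge0 ?(ltW c0)//= ltr_pdivrMr// mul1r.
  have H1 : (fun n => n.+1%:R * (u / c) ^+ n.+1) @ \oo --> (0 : R).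
    by move: (cvg_n_expr rb); rewrite -(cvg_shiftS (fun n => n%:R * (u / c) ^+ n)).
  have H2 : (fun n => u ^+ n.+1) @ \oo --> (0 : R).
    have : (fun n => u ^+ n) @ \oo --> (0 : R).
      apply: cvg_expr; rewrite ger0_norm//; exact: (lt_le_trans uc).
    by rewrite -(cvg_shiftS (fun n => u ^+ n)).
  apply: (@squeeze_cvgr _ _ _ _
    (fun n => 1 - (n.+1%:R * (u / c) ^+ n.+1 + u ^+ n.+1)) (fun=> 1)).
  + near=> n; apply/andP; split; last first.
      by rewrite exprn_ile1// ?subr_ge0 ?lerBlDr ?lerDl; case/andP: (un01 n.+1).
    set m := (Num.truncn _).+1.
    apply: (@le_trans _ _ (1 - m%:R * u ^+ n.+1)).
      rewrite lerD2l lerN2.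
      apply: (@le_trans _ _ ((n.+1%:R * c ^- n.+1 + 1) * u ^+ n.+1)).
        by rewrite ler_wpM2r ?m_le//; case/andP: (un01 n.+1).
      by rewrite mulrDl mul1r lerD2r expr_div_n -mulrA (mulrC (c ^- _)).
    have := un01 n.+1; move: (u ^+ n.+1) => v /andP[v0 v1].
    elim: m => [|m ih]; first by rewrite mul0r subr0 expr0.
    rewrite exprS -natr1 mulrDl mul1r.
    have : (1 - v) * (1 - m%:R * v) <= (1 - v) * (1 - v) ^+ m.
      by rewrite ler_wpM2l// subr_ge0.
    apply: le_trans; have : 0 <= m%:R * v ^+ 2 by rewrite mulr_ge0// sqr_ge0.
    nra.
  + rewrite -[X in _ --> X]subr0 -[X in _ - X]addr0.
    apply: cvgB; [exact: cvg_cst|exact: cvgD].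
  + exact: cvg_cst.
- apply: (@squeeze_cvgr _ _ _ _ (fun=> 0) (fun n => n.+1%:R^-1)).
  + near=> n; have := un01 n.+1.
    set m := (Num.truncn _).+1 => /andP[v0 v1].
    apply/andP; split; first by rewrite exprn_ge0// subr_ge0.
    have mv : n.+1%:R <= m%:R * u ^+ n.+1.
      apply: (@le_trans _ _ (n.+1%:R * c ^- n.+1 * u ^+ n.+1)).
        rewrite -mulrA ler_peMr// mulrC -expr_div_n exprn_ege1//.
        by rewrite ler_pdivlMr// mul1r.
      by rewrite ler_wpM2r// m_ge.
    apply: (@le_trans _ _ (expR (- u ^+ n.+1) ^+ m)).
      apply: lerXn2r; rewrite ?nnegrE ?expR_ge0 ?subr_ge0//.
      exact: expR_ge1Dx.
    rewrite -expRM_natl mulrN expRN lef_pV2 ?posrE ?expR_gt0//.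
    apply: le_trans (expR_ge1Dx _).
    by rewrite (le_trans mv)// lerDr.
  + exact: cvg_cst.
  + by move: (@cvg_harmonic R).
Unshelve. all: by end_near. Qed.

End step_approx.

Section multiplicative_system.
Context (R : realType) (T : pointedType).
Variables (Phi : set (T -> \bar R)) (H : set (T -> R)).
Hypothesis bcH : bounded_class H.
Hypothesis Phi_ge0 : forall phi, Phi phi -> forall x, (0 <= phi x)%E.
Hypothesis Phi0 : Phi (cst 0%E).
Hypothesis PhiD : forall phi psi, Phi phi -> Phi psi ->
  Phi (fun x => phi x + psi x)%E.
Hypothesis PhiH : forall phi, Phi phi -> H (fun x => eN (phi x)).

Let Mc : set (T -> R) := [set f | (exists B, forall x, `|f x| <= B) /\
  forall phi, Phi phi -> H (fun x => f x * eN (phi x))].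

Let Mc_lin c f g : Mc f -> Mc g -> Mc (fun x => c * f x + g x).
Proof.
move=> [[B fB] Hf] [[C gC] Hg]; split.
  exists (`|c| * B + C) => x; rewrite (le_trans (ler_normD _ _))// lerD//.
  by rewrite normrM ler_wpM2l.
move=> phi Pphi; apply: bc_ext (bc_lin bcH c (Hf _ Pphi) (Hg _ Pphi)) _ => x.
by rewrite mulrDl mulrA.
Qed.

Let Mc_lim (f : nat -> T -> R) g M : (forall n, Mc (f n)) ->
  (forall n x, `|f n x| <= M) -> (forall x, f ^~ x @ \oo --> g x) -> Mc g.
Proof.
move=> Mf fM fg; split.
  exists M => x; have /cvg_norm h := fg x; rewrite -(cvg_lim _ h)//.
  apply: limr_le; first by apply/cvg_ex; exists `|g x|.
  exact: nearW.
move=> phi Pphi; apply: (bc_lim bcH (M := M)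
  (f := fun n x => f n x * eN (phi x))).
- by move=> n; exact: (Mf n).2.
- move=> n x; rewrite normrM -[leRHS]mulr1 ler_pM// eN_ubound//.
  exact: Phi_ge0.
- by move=> x; apply: cvgMl; exact: fg.
Qed.

Let bcMc : bounded_class Mc.
Proof. by split; [exact: Mc_lin|exact: Mc_lim]. Qed.

Let Mc1 : Mc (fun=> 1).
Proof.
split; first by exists 1 => x; rewrite normr1.
by move=> phi /PhiH h; apply: bc_ext h _ => x; rewrite mul1r.
Qed.

Let McM f phi : Mc f -> Phi phi -> Mc (fun x => f x * eN (phi x)).
Proof.
move=> [[B fB] Hf] Pphi; split.
  exists B => x; rewrite normrM -[leRHS]mulr1 ler_pM// eN_ubound//.
  exact: Phi_ge0.
move=> psi Ppsi; apply: bc_ext (Hf _ (PhiD Pphi Ppsi)) _ => x.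
by rewrite eND ?mulrA//; exact: Phi_ge0.
Qed.

Let PhiX phi n : Phi phi -> exists2 psi, Phi psi &
  forall x, eN (phi x) ^+ n = eN (psi x).
Proof.
move=> Pphi; elim: n => [|n [psi Ppsi E]].
  by exists (cst 0%E) => // x; rewrite expr0 eN0.
exists (fun x => phi x + psi x)%E; first exact: PhiD.
by move=> x; rewrite exprS E eND//; exact: Phi_ge0.
Qed.

Let McStep f phi c : 0 < c <= 1 -> Mc f -> Phi phi ->
  Mc (fun x => f x * (eN (phi x) < c)%R%:R).
Proof.
move=> c01 Mf Pphi.
have [[B fB] _] := Mf.
apply: (Mc_lim (M := B) (f := fun n x => f x *
  (1 - eN (phi x) ^+ n.+1) ^+ (Num.truncn (n.+1%:R * c ^- n.+1)).+1)).
- move=> n; have [psi Ppsi E] := PhiX n.+1 Pphi.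
  elim: (Num.truncn _).+1 => [|m ih].
    by apply: bc_ext Mf _ => x; rewrite expr0 mulr1.
  apply: bc_ext (bcB bcMc ih (McM ih Ppsi)) _ => x.
  by rewrite -E [in RHS]exprSr; ring.
- move=> n x; rewrite normrM -[leRHS]mulr1 ler_pM//.
  have p0 := Phi_ge0 Pphi x.
  have h1 : 0 <= eN (phi x) ^+ n.+1 <= 1.
    by rewrite exprn_ge0 ?eN_ge0//= exprn_ile1// ?eN_ge0// eN_le1.
  rewrite ger0_norm ?exprn_ge0 ?exprn_ile1//; lra.
- move=> x; apply: cvgMr; apply: step_approx => //.
  by rewrite eN_ge0 eN_le1//; exact: Phi_ge0.
Qed.

Let G : set (set T) := [set E | forall f, Mc f -> Mc (fun x => f x * \1_E x)].

Let G_lambda : lambda_system setT G.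
Proof.
split => //.
- by move=> f Mf; apply: bc_ext Mf _ => x; rewrite indicT mulr1.
- move=> A B BA GA GB f Mf.
  apply: bc_ext (bcB bcMc (GA _ Mf) (GB _ Mf)) _ => x.
  rewrite -mulrBr; congr (_ * _).
  rewrite !indicE in_setD; case: (boolP (x \in B)) => xB /=.
    by rewrite (_ : x \in A) ?subrr//; move: xB; rewrite !inE => /BA.
  by rewrite andbT subr0.
- move=> F ndF GF f Mf; have [[B fB] _] := Mf.
  apply: (Mc_lim (M := B) (f := fun n x => f x * \1_(F n) x)).
  + by move=> n; exact: GF.
  + move=> n x; rewrite normrM -[leRHS]mulr1 ler_pM//.
    by rewrite indicE; case: (_ \in _); rewrite ?normr1 ?normr0.
  + move=> x; apply: cvgMr; rewrite !indicE.
    case: (boolP (x \in \bigcup_n F n)) => [|]; rewrite ?inE ?notin_setE.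
      move=> [k _ Fk].
      have E : (fun=> 1 : R) @ \oo --> (1 : R) by exact: cvg_cst.
      apply: cvg_trans E; apply: near_eq_cvg; near=> n; rewrite indicE mem_set//.
      have : (k <= n)%N by near: n; exact: nbhs_infty_ge.
      by move=> /ndF /subsetPset; apply.
    move=> nF; rewrite (_ : (fun n => _) = fun=> 0) /=; first exact: cvg_cst.
    by apply/funext => n; rewrite indicE memNset// => Fn; apply: nF; exists n.
Unshelve. all: by end_near. Qed.

Let G_setI : setI_closed G.
Proof.
move=> A B GA GB f Mf; apply: bc_ext (GB _ (GA _ Mf)) _ => x.
by rewrite indicI -mulrA.
Qed.

Let sG : <<s G >> `<=` G.
Proof.
apply: (lambda_system_subset G_setI G_lambda) => // X GX x //.
Qed.

Let GStep phi c : Phi phi -> G [set x | eN (phi x) < c].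
Proof.
move=> Pphi f Mf; have [c0|c0] := leP c 0.
  apply: bc_ext (bc0 bcMc Mf) _ => x; rewrite indicE memNset ?mulr0//=.
  by apply/negP; rewrite -leNgt (le_trans c0)// eN_ge0.
have [c1|c1] := leP c 1.
  have c01 : 0 < c <= 1 by rewrite c0.
  apply: bc_ext (McStep c01 Mf Pphi) _ => x.
  rewrite indicE; case: (boolP (eN (phi x) < c)) => h.
    by rewrite mem_set.
  by rewrite memNset//=; exact/negP.
apply: bc_ext Mf _ => x; rewrite indicE mem_set ?mulr1//=.
by rewrite (le_lt_trans _ c1)// eN_le1//; exact: Phi_ge0.
Qed.

(** As [Phi] is closed under addition, the exponentials [eN \o phi] are closed
    under products.  [Mc] consists of the bounded functions whose product with
    every exponential is in [H], and [G] of the sets whose indicators multiply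
    [Mc] into itself: [G] is a lambda-system closed under intersection, and it
    contains the level sets of the exponentials by [step_approx]. *)
Theorem multiplicative_system E :
  <<s \bigcup_(phi in Phi) preimage_set_system setT phi measurable >> E ->
  H (\1_E).
Proof.
move=> sE; suff /sG GE : <<s G >> E.
  have [_ /(_ _ Phi0)] := GE _ Mc1.
  by move=> h; apply: bc_ext h _ => x; rewrite eN0 mulr1 mul1r.
move: E sE; apply: smallest_sub; first exact: smallest_sigma_algebra.
move=> _ [phi Pphi [V mV <-]].
pose u : g_sigma_algebraType G -> R := fun x => eN (phi x).
have mu : measurable_fun setT u.
  apply: (measurability _ (RGenInftyO.measurableE R)).
  move=> _ [_ [c ->] <-]; apply: sub_sigma_algebra; rewrite setTI.
  rewrite (_ : _ @^-1` _ = [set x | eN (phi x) < c]); first exact: GStep.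
  by apply/seteqP; split => x; rewrite /= in_itv.
have : measurable_fun setT (@neglne R \o u).
  by apply: measurableT_comp => //; exact: measurable_neglne.
have -> : @neglne R \o u = phi by apply/funext => x; rewrite /= eNK//; exact: Phi_ge0.
by move=> /(_ measurableT V mV).
Qed.

End multiplicative_system.

Section bounded_class_measurable.
Context (R : realType) d (T : measurableType d).
Variable H : set (T -> R).
Hypothesis bcH : bounded_class H.
Hypothesis HI : forall E, measurable E -> H (\1_E).

Import HBNNSimple.

Lemma bounded_class_measurable (f : T -> R) M : measurable_fun setT f ->
  (forall x, 0 <= f x <= M) -> H f.
Proof.
move=> mf f0M.
have mEf : measurable_fun setT (EFin \o f) by apply/measurable_EFinP.
have f0 x : (0 <= (EFin \o f) x)%E by rewrite lee_fin; case/andP: (f0M x).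
pose g := nnsfun_approx measurableT mEf.
have gf x : (fun n => g n x) @ \oo --> f x.
  by have /fine_cvgP[] := cvg_nnsfun_approx measurableT mEf (fun x _ => f0 x) (x := x) I.
have gle n x : g n x <= f x.
  rewrite -(cvg_lim _ (gf x))//; apply: nondecreasing_cvgn_le.
    by move=> m k mk; exact/lefP/nd_nnsfun_approx.
  by apply/cvg_ex; exists (f x).
apply: (bc_lim bcH (f := fun n => g n) (M := M)) => //; last first.
  move=> n x; rewrite ger0_norm ?fun_ge0// (le_trans (gle _ _))//.
  by case/andP: (f0M x).
move=> n; have H0 := bc0 bcH (HI measurableT).
have HF y : H (fun x => y * \1_(g n @^-1` [set y]) x).
  by apply: bcZ => //; exact: HI.
have HS := bc_sum bcH (finmap.enum_fset (fset_set (range (g n)))) H0 HF.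
apply: (bc_ext HS).
by move=> x; rewrite (fimfunE (g n)) fsbig_finite//.
Qed.

End bounded_class_measurable.

(** * Expectations of bounded measurable functions *)

Section bmeas.
Context (R : realType) d (T : measurableType d).
Implicit Types f g : T -> R.

Definition bmeas (f : T -> R) :=
  measurable_fun setT f /\ exists M, forall x, `|f x| <= M.

Lemma bmeas_lin c f g : bmeas f -> bmeas g -> bmeas (fun x => c * f x + g x).
Proof.
move=> [mf [M fM]] [mg [N gN]]; split.
  by apply: measurable_funD => //; exact: measurable_funM.
exists (`|c| * M + N) => x; rewrite (le_trans (ler_normD _ _))// lerD//.
by rewrite normrM ler_wpM2l.
Qed.

Lemma bmeasM f g : bmeas f -> bmeas g -> bmeas (fun x => f x * g x).
Proof.
move=> [mf [M fM]] [mg [N gN]]; split; first exact: measurable_funM.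
by exists (M * N) => x; rewrite normrM ler_pM.
Qed.

Lemma bmeas_lim (f : nat -> T -> R) g M : (forall n, bmeas (f n)) ->
  (forall n x, `|f n x| <= M) -> (forall x, f ^~ x @ \oo --> g x) -> bmeas g.
Proof.
move=> bf fM fg; split.
  by apply: (measurable_fun_cvg (h := f)) => [n|x _]; [exact: (bf n).1|exact: fg].
exists M => x; have /cvg_norm h := fg x; rewrite -(cvg_lim _ h)//.
apply: limr_le; first by apply/cvg_ex; exists `|g x|.
exact: nearW.
Qed.

Lemma bmeas_indic E : measurable E -> bmeas (\1_E).
Proof.
move=> mE; split; first exact: measurable_indic.
by exists 1 => x; rewrite indicE; case: (_ \in _); rewrite ?normr1 ?normr0.
Qed.

Lemma bmeas01 f : measurable_fun setT f -> (forall x, 0 <= f x <= 1) -> bmeas f.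
Proof.
move=> mf f01; split => //; exists 1 => x.
by have /andP[f0 f1] := f01 x; rewrite ger0_norm.
Qed.

Lemma bmeas_cst c : bmeas (fun=> c).
Proof. by split => //; exists `|c|. Qed.

Lemma bmeas_eN (phi : T -> \bar R) : measurable_fun setT phi ->
  (forall x, (0 <= phi x)%E) -> bmeas (fun x => eN (phi x)).
Proof.
move=> mphi phi0; apply: bmeas01 => [|x]; last by rewrite eN_ge0 eN_le1.
apply: (@measurableT_comp _ _ _ _ _ _ (@eN R) _ phi) => //; exact: measurable_eN.
Qed.

Lemma bmeas_prod (I : Type) (s : seq I) (F : I -> T -> R) :
  (forall i, bmeas (F i)) -> bmeas (fun x => \prod_(i <- s) F i x).
Proof.
move=> bF; elim: s => [|i s ih].
  by under eq_fun do rewrite big_nil; exact: bmeas_cst.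
by under eq_fun do rewrite big_cons; exact: bmeasM.
Qed.

End bmeas.

Lemma bmeas_compT (R : realType) d (T : measurableType d) d' (S : measurableType d')
   (Y : S -> T) (f : T -> R) :
  measurable_fun setT Y -> bmeas f -> bmeas (fun x => f (Y x)).
Proof.
move=> mY [mf [M fM]]; split; first exact: measurableT_comp.
by exists M => x; exact: fM.
Qed.

Section expectation.
Context (R : realType) d (T : measurableType d) (P : probability T R).
Implicit Types f g : T -> R.

Lemma bmeas_integrable f : bmeas f -> P.-integrable setT (EFin \o f).
Proof.
move=> [mf [M fM]]; apply: (@le_integrable _ _ _ _ _ _ _ (EFin \o cst M)) => //.
- exact/measurable_EFinP.
- move=> x _ /=; rewrite lee_fin (le_trans (fM x))// ler_norm//.
- exact: finite_measure_integrable_cst.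
Qed.

Lemma E_lin c f g : bmeas f -> bmeas g ->
  \int[P]_x (c * f x + g x) = c * (\int[P]_x f x) + \int[P]_x g x.
Proof.
move=> bf bg; rewrite RintegralD//; last first.
- exact: bmeas_integrable.
- apply: bmeas_integrable; have := bmeas_lin c bf (bmeas_cst _ 0).
  by under eq_fun do rewrite addr0.
- by rewrite RintegralZl//; exact: bmeas_integrable.
Qed.

Lemma E_lim (f : nat -> T -> R) g M : (forall n, bmeas (f n)) ->
  (forall n x, `|f n x| <= M) -> (forall x, f ^~ x @ \oo --> g x) ->
  (fun n => \int[P]_x f n x) @ \oo --> \int[P]_x g x.
Proof.
move=> bf fM fg; have bg := bmeas_lim bf fM fg.
have [| | | | |_ _ h] := @dominated_convergence _ _ _ P setT measurableT
  (fun n x => (f n x)%:E) (fun x => (g x)%:E) (EFin \o cst M); last first.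
  apply: fine_cvg; rewrite fineK//.
  by apply: integrable_fin_num => //; exact: bmeas_integrable.
- by apply: aeW => x n _ /=; rewrite lee_fin.
- exact: finite_measure_integrable_cst.
- by apply: aeW => x _; apply: cvg_EFin; [exact: nearW|exact: fg].
- by apply/measurable_EFinP; exact: bg.1.
- by move=> n; apply/measurable_EFinP; exact: (bf n).1.
Qed.

Lemma E_indic E : measurable E -> \int[P]_x \1_E x = fine (P E).
Proof. by move=> mE; rewrite /Rintegral integral_indic// setIT. Qed.

Lemma E_cst c : \int[P]_x c = c.
Proof.
rewrite /Rintegral integral_cst//. 
transitivity (fine (c%:E * 1)%E); last by rewrite mule1.
by congr (fine (_ * _)%E); exact: probability_setT.
Qed.

Lemma E_ge0 f : (forall x, 0 <= f x) -> 0 <= \int[P]_x f x.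
Proof. by move=> f0; exact: Rintegral_ge0. Qed.

Lemma E_le f g : bmeas f -> bmeas g -> (forall x, f x <= g x) ->
  \int[P]_x f x <= \int[P]_x g x.
Proof.
move=> bf bg fg; apply: le_Rintegral => //; exact: bmeas_integrable.
Qed.

Lemma E_norm_le f (N : R) :
  bmeas f -> (forall y, `|f y| <= N) -> `|\int[P]_y f y| <= N.
Proof.
move=> bf fN; rewrite ler_norml.
have h1 := E_le (bmeas_cst T (- N)) bf.
have h2 := E_le bf (bmeas_cst T N).
rewrite !E_cst in h1 h2; rewrite h1 ?h2// => y; have := fN y; rewrite ler_norml => /andP[]//.
Qed.

Lemma E_EFin f : bmeas f -> (\int[P]_x (f x)%:E)%E = (\int[P]_x f x)%:E.
Proof.
move=> bf; rewrite /Rintegral fineK//.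
by apply: integrable_fin_num => //; exact: bmeas_integrable.
Qed.

Lemma E_ae f g : bmeas f -> bmeas g -> {ae P, forall x, f x = g x} ->
  \int[P]_x f x = \int[P]_x g x.
Proof.
move=> bf bg fg; rewrite /Rintegral; congr fine; apply: ae_eq_integral => //.
- by apply/measurable_EFinP; exact: bf.1.
- by apply/measurable_EFinP; exact: bg.1.
- by apply: filterS fg => x -> _.
Qed.

End expectation.

Lemma E_pushforward (R : realType) d d' (T : measurableType d) (S : measurableType d')
    (P : probability T R) (Q : probability S R) (Y : T -> S) (f : S -> R) :
  measurable_fun setT Y -> (forall B, measurable B -> Q B = P (Y @^-1` B)) ->
  bmeas f -> (forall x, 0 <= f x) -> \int[Q]_y f y = \int[P]_x f (Y x).
Proof.
move=> mY QP [mf _] f0; rewrite /Rintegral; congr fine.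
transitivity (\int[pushforward P Y]_y (f y)%:E)%E.
  by apply: eq_measure_integral => //= A mA _; rewrite QP.
rewrite ge0_integral_pushforward//; first by apply/measurable_EFinP.
by move=> y _; rewrite lee_fin.
Qed.

Section bfun.
Context (R : realType) d (T : measurableType d).

(** What an expectation satisfies on bounded measurable functions.  The arguments
    below compare two such functionals by testing them on exponentials. *)
Record bfun (L : (T -> R) -> R) : Prop := Bfun {
  bfun_lin : forall c f g, bmeas f -> bmeas g ->
    L (fun x => c * f x + g x) = c * L f + L g ;
  bfun_lim : forall (f : nat -> T -> R) g M, (forall n, bmeas (f n)) ->
    (forall n x, `|f n x| <= M) -> (forall x, f ^~ x @ \oo --> g x) ->
    (fun n => L (f n)) @ \oo --> L g }.

Lemma bounded_class_bfun L1 L2 : bfun L1 -> bfun L2 ->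
  bounded_class [set f | bmeas f /\ L1 f = L2 f].
Proof.
move=> b1 b2; split.
- move=> c f g /= [bf Lf] [bg Lg]; split; first exact: bmeas_lin.
  by rewrite (bfun_lin b1)// (bfun_lin b2)// Lf Lg.
- move=> f g M /= H fM fg.
  have bf n : bmeas (f n) by have [] := H n.
  split; first exact: (bmeas_lim bf fM).
  have h1 := bfun_lim b1 bf fM fg; have h2 := bfun_lim b2 bf fM fg.
  rewrite -(cvg_lim _ h1)// -(cvg_lim _ h2)//; congr (lim (_ @ \oo)).
  by apply/funext => n; have [_] := H n.
Qed.

Lemma bfunZ c L : bfun L -> bfun (fun f => c * L f).
Proof.
move=> b; split.
- by move=> e f g bf bg; rewrite (bfun_lin b)//; ring.
- by move=> f g M bf fM fg; apply: cvgMr; exact: (bfun_lim b bf fM fg).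
Qed.

Lemma bfun_E d' (S : measurableType d') (P : probability S R) (Y : S -> T)
    (Z : S -> R) : measurable_fun setT Y -> bmeas Z ->
  bfun (fun f => \int[P]_w (f (Y w) * Z w)).
Proof.
move=> mY bZ; have bY f : bmeas f -> bmeas (fun w => f (Y w)).
  exact: bmeas_compT.
split.
- move=> c f g bf bg.
  rewrite -E_lin; [|by apply: bmeasM => //; exact: bY..].
  by apply: eq_Rintegral => w _; rewrite mulrDl mulrA.
- move=> f g M bf fM fg; have [_ [N ZN]] := bZ.
  apply: (E_lim (M := M * N)).
  + by move=> n; apply: bmeasM => //; exact: bY.
  + by move=> n x; rewrite normrM ler_pM.
  + by move=> x; apply: cvgMl; exact: fg.
Qed.

Lemma bfun_ext_measurable L1 L2 (f : T -> R) (M : R) : bfun L1 -> bfun L2 ->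
  measurable_fun setT f -> (forall x, 0 <= f x <= M) ->
  (forall E, measurable E -> L1 (\1_E) = L2 (\1_E)) -> L1 f = L2 f.
Proof.
move=> b1 b2 mf fM h.
have [|] // := @bounded_class_measurable _ _ _ _ (bounded_class_bfun b1 b2) _ f M mf fM.
by move=> E mE; split; [exact: bmeas_indic|exact: h].
Qed.

(** Functionals that agree on the exponentials of [Phi] agree on all events
    generated by [Phi]: a Laplace transform determines the law. *)
Lemma bfun_ext_laplace L1 L2 (Phi : set (T -> \bar R)) : bfun L1 -> bfun L2 ->
  (forall phi, Phi phi -> measurable_fun setT phi /\ forall x, (0 <= phi x)%E) ->
  Phi (cst 0%E) ->
  (forall phi psi, Phi phi -> Phi psi -> Phi (fun x => phi x + psi x)%E) ->
  (forall phi, Phi phi -> L1 (fun x => eN (phi x)) = L2 (fun x => eN (phi x))) ->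
  forall E,
  <<s \bigcup_(phi in Phi) preimage_set_system setT phi measurable >> E ->
  L1 (\1_E) = L2 (\1_E).
Proof.
move=> b1 b2 Phim Phi0 PhiD PhiL E sE.
have [] // := @multiplicative_system _ _ Phi _ (bounded_class_bfun b1 b2) _ _ _ _ E sE.
- by move=> phi /Phim[].
- by move=> phi Pphi; have [? ?] := Phim _ Pphi; split; [exact: bmeas_eN|exact: PhiL].
Qed.

End bfun.

(** * Independence through expectations of products *)

Section independence_products.
Context (R : realType) d (Omega : measurableType d) (P : probability Omega R).

Lemma prod_indic (I : choiceType) (s : seq I) (A : I -> set Omega) w :
  \prod_(i <- s) \1_(A i) w = \1_(\bigcap_(i in [set` s]) A i) w :> R.
Proof.
elim: s => [|i s ih].
  by rewrite big_nil indicE mem_set//= => i; rewrite inE.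
rewrite big_cons ih !indicE -natrM mulnb -in_setI.
congr (_ \in _)%:R; apply/seteqP; split => x /=.
  move=> [Ai As] j /=; rewrite inE => /predU1P[->//|js].
  exact: As.
move=> h; split; first by apply: h; rewrite /= inE eqxx.
by move=> j /= js; apply: h; rewrite /= inE js orbT.
Qed.

(** Induction on the number of indices at which indicators have been replaced by
    general functions: [s1] lists these indices, [s2] those still carrying
    an event. *)
Lemma indep_prod (I : choiceType) d' (T : measurableType d') (Y : I -> Omega -> T)
    (g : I -> T -> R) (s : seq I) :
  (forall i, measurable_fun setT (Y i)) ->
  mutually_independent P (fun i => preimage_set_system setT (Y i) measurable) ->
  (forall i, measurable_fun setT (g i)) -> (forall i x, 0 <= g i x <= 1) ->
  uniq s ->
  \int[P]_w \prod_(i <- s) g i (Y i w) = \prod_(i <- s) \int[P]_w g i (Y i w).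
Proof.
move=> mY ind mg g01.
have bg i : bmeas (fun w => g i (Y i w)).
  by apply: bmeas_compT => //; exact: bmeas01.
suff claim s1 : forall s2 (V : I -> set T), (forall i, measurable (V i)) ->
    uniq (s1 ++ s2) ->
    \int[P]_w (\prod_(i <- s1) g i (Y i w) * \prod_(i <- s2) \1_(V i) (Y i w)) =
    \prod_(i <- s1) \int[P]_w g i (Y i w) * \prod_(i <- s2) fine (P (Y i @^-1` V i)).
  move=> us; have := claim s [::] (fun=> setT) (fun=> measurableT).
  rewrite cats0 !big_nil mulr1 => <-//; apply: eq_Rintegral => w _.
  by rewrite big_nil mulr1.
elim: s1 => [|k s1 ih] s2 V mV us.
  rewrite big_nil mul1r.
  transitivity (\int[P]_w \1_(\bigcap_(i in [set` s2]) (Y i @^-1` V i)) w).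
    by apply: eq_Rintegral => w _; rewrite big_nil mul1r -prod_indic.
  have mYV i : measurable (Y i @^-1` V i) by rewrite -[X in measurable X]setTI; exact: mY.
  rewrite E_indic; last by apply: fin_bigcap_measurable => //; exact: finite_seq.
  rewrite ind//= => i _; exists (V i) => //; by rewrite setTI.
have /= /andP[ks us'] := us.
pose Z w := \prod_(i <- s1) g i (Y i w) * \prod_(i <- s2) \1_(V i) (Y i w).
have bZ : bmeas Z.
  apply: bmeasM; apply: bmeas_prod => i //.
  by apply: bmeas_compT => //; exact: bmeas_indic.
pose c := \prod_(i <- s1) \int[P]_w g i (Y i w) * \prod_(i <- s2) fine (P (Y i @^-1` V i)).
transitivity (\int[P]_w (g k (Y k w) * Z w)).
  by apply: eq_Rintegral => w _; rewrite big_cons mulrA.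
transitivity (c * \int[P]_w (g k (Y k w) * 1)); last first.
  rewrite big_cons /c [LHS]mulrC mulrA; congr (_ * _ * _).
  by apply: eq_Rintegral => w _; rewrite mulr1.
have b1 := bfun_E P (mY k) bZ.
have b2 := bfunZ c (bfun_E P (mY k) (bmeas_cst _ 1)).
apply: (bfun_ext_measurable b1 b2 (mg k) (g01 k)) => // E mE.
pose V' i := if i == k then E else V i.
have mV' i : measurable (V' i) by rewrite /V'; case: ifP.
have V'k : V' k = E by rewrite /V' eqxx.
have V's2 i : i \in s2 -> V' i = V i.
  move=> is2; rewrite /V'; case: eqP => // ik; move: ks.
  by rewrite mem_cat -ik is2 orbT.
have us2 : uniq (s1 ++ k :: s2).
  by rewrite -cat_rcons -cats1 -catA uniq_catCA /= ks us'.
have := ih (k :: s2) V' mV' us2.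
have E2 : \prod_(i <- s2) fine (P (Y i @^-1` V' i)) =
    \prod_(i <- s2) fine (P (Y i @^-1` V i)).
  by apply: eq_big_seq => i is2; rewrite V's2.
rewrite big_cons V'k E2.
have mYE : measurable (Y k @^-1` E) by rewrite -[X in measurable X]setTI; exact: mY.
rewrite /= (_ : \int[P]_w (\1_E (Y k w) * 1) = fine (P (Y k @^-1` E))); last first.
  by rewrite -E_indic//; apply: eq_Rintegral => w _; rewrite mulr1.
rewrite mulrCA -/c [_ * c]mulrC => <-; apply: eq_Rintegral => w _.
rewrite big_cons V'k /Z mulrCA; congr (_ * (_ * _)).
by apply: eq_big_seq => i is2; rewrite V's2.
Qed.

(** The events are replaced by functions first on the side of [F], with [g] fixed,
    then on the side of [G], with an event of [F] fixed. *)
Lemma indep2_prod (F G : set (set Omega)) (f : g_sigma_algebraType F -> R)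
    (g : g_sigma_algebraType G -> R) :
  <<s F >> `<=` measurable -> <<s G >> `<=` measurable ->
  independent2 P <<s F >> <<s G >> ->
  measurable_fun setT f -> (forall w, 0 <= f w <= 1) ->
  measurable_fun setT g -> (forall w, 0 <= g w <= 1) ->
  \int[P]_w (f w * g w) = \int[P]_w f w * \int[P]_w g w.
Proof.
move=> mF mG ind mf f01 mg g01.
have mid (H : set (set Omega)) : <<s H >> `<=` measurable ->
    measurable_fun setT (id : Omega -> g_sigma_algebraType H).
  by move=> mH _ A mA; rewrite setTI; exact: mH.
have bf : bmeas (f : Omega -> R) := bmeas_compT (mid _ mF) (bmeas01 mf f01).
have bg : bmeas (g : Omega -> R) := bmeas_compT (mid _ mG) (bmeas01 mg g01).
transitivity ((\int[P]_w g w) * \int[P]_w (f w * 1)); last first.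
  by rewrite mulrC; congr (_ * _); apply: eq_Rintegral => w _; rewrite mulr1.
apply: (bfun_ext_measurable (bfun_E P (mid _ mF) bg)
  (bfunZ (\int[P]_w g w) (bfun_E P (mid _ mF) (bmeas_cst _ 1))) mf f01) => A mA.
have mA' : measurable (A : set Omega) := mF _ mA.
transitivity (\int[P]_w (g w * \1_A w)).
  by apply: eq_Rintegral => w _; rewrite mulrC.
transitivity ((\int[P]_w \1_A w) * \int[P]_w (g w * 1)); last first.
  rewrite mulrC; congr (_ * _); apply: eq_Rintegral => w _; by rewrite mulr1.
have bA : bmeas (\1_A : Omega -> R) by exact: bmeas_indic.
apply: (bfun_ext_measurable (bfun_E P (mid _ mG) bA)
  (bfunZ (\int[P]_w \1_A w) (bfun_E P (mid _ mG) (bmeas_cst _ 1))) mg g01) => B mB.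
have mB' : measurable (B : set Omega) := mG _ mB.
transitivity (\int[P]_w \1_(A `&` B) w).
  by apply: eq_Rintegral => w _; rewrite indicI mulrC.
rewrite E_indic//; last exact: measurableI.
rewrite ind// fineM//; [|exact: fin_num_measure|exact: fin_num_measure].
rewrite -!E_indic//; congr (_ * _); apply: eq_Rintegral => w _; by rewrite mulr1.
Qed.

(** Factorization passes from exponentials to events one index at a time, because
    the exponentials of the multiples of [Y k] determine the law of [Y k]. *)
Lemma indep_of_laplace (I : choiceType) (Y : I -> Omega -> \bar R) :
  (forall i, measurable_fun setT (Y i)) -> (forall i w, (0 <= Y i w)%E) ->
  (forall s (a : I -> R), uniq s -> (forall i, 0 <= a i) ->
    \int[P]_w \prod_(i <- s) eN ((a i)%:E * Y i w)%E =
    \prod_(i <- s) \int[P]_w eN ((a i)%:E * Y i w)%E) ->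
  mutually_independent P (fun i => preimage_set_system setT (Y i) measurable).
Proof.
move=> mY Y0 lap J E uJ FE.
have aY0 (a : R) i w : 0 <= a -> (0 <= a%:E * Y i w)%E.
  by move=> a0; rewrite mule_ge0.
have maY (a : R) i : measurable_fun setT (fun w => a%:E * Y i w)%E.
  exact: measurable_funeM.
have baY (a : R) i : 0 <= a -> bmeas (fun w => eN (a%:E * Y i w)%E).
  by move=> a0; apply: bmeas_eN => // w; exact: aY0.
have mE i : i \in J -> measurable (E i).
  by move=> /FE[V mV <-]; rewrite -[X in measurable X]setTI setTI; exact: mY.
suff claim s1 : forall s2 (a : I -> R), (forall i, 0 <= a i) ->
    {subset s1 <= J} -> uniq (s1 ++ s2) ->
    \int[P]_w (\prod_(i <- s1) \1_(E i) w * \prod_(i <- s2) eN ((a i)%:E * Y i w)%E) =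
    \prod_(i <- s1) fine (P (E i)) * \prod_(i <- s2) \int[P]_w eN ((a i)%:E * Y i w)%E.
  have := claim J [::] (fun=> 0) (fun=> lexx _) (fun=> id).
  rewrite cats0 big_nil mulr1 => /(_ uJ) <-.
  have mJ : measurable (\bigcap_(i in [set` J]) E i).
    by apply: fin_bigcap_measurable => //.
  rewrite -[LHS]fineK ?fin_num_measure//; congr EFin.
  rewrite -E_indic//; apply: eq_Rintegral => w _.
  by rewrite big_nil mulr1 prod_indic.
elim: s1 => [|k s1 ih] s2 a a0 sub us.
  rewrite big_nil mul1r -lap//.
  by apply: eq_Rintegral => w _; rewrite big_nil mul1r.
have /= /andP[ks us'] := us.
pose s1J : seq I := s1.
pose Z w := \prod_(i <- s1) \1_(E i) w * \prod_(i <- s2) eN ((a i)%:E * Y i w)%E.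
have sub1 : {subset s1 <= J} by move=> i is1; apply: sub; rewrite inE is1 orbT.
have kJ : k \in J by apply: sub; rewrite inE eqxx.
have bZ : bmeas Z.
  apply: bmeasM; last by apply: bmeas_prod => i; exact: baY.
  have : bmeas (fun w => \prod_(i <- s1) (if i \in J then \1_(E i) w else 0 : R)).
    apply: bmeas_prod => i; case: (boolP (i \in J)) => iJ; last exact: bmeas_cst.
    by apply: bmeas_indic; exact: mE.
  congr bmeas; apply/funext => w; apply: eq_big_seq => i /sub1 -> //.
pose c := \prod_(i <- s1) fine (P (E i)) * \prod_(i <- s2) \int[P]_w eN ((a i)%:E * Y i w)%E.
transitivity (\int[P]_w (\1_(E k) w * Z w)).
  by apply: eq_Rintegral => w _; rewrite big_cons mulrA.
transitivity (c * \int[P]_w (\1_(E k) w * 1)); last first.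
  rewrite big_cons -[fine (P (E k))]E_indic; last exact: mE.
  rewrite /c [LHS]mulrC mulrA; congr (_ * _ * _).
  by apply: eq_Rintegral => w _; rewrite mulr1.
have mid : measurable_fun setT (id : Omega -> Omega) by [].
have b1 := bfun_E P mid bZ.
have b2 := bfunZ c (bfun_E P mid (bmeas_cst _ 1)).
pose Phi := [set phi : Omega -> \bar R | exists2 b, 0 <= b & phi = (fun w => b%:E * Y k w)%E].
apply: (bfun_ext_laplace (Phi := Phi) b1 b2).
- by move=> _ [b b0 ->]; split => // w; exact: aY0.
- by exists 0 => //; apply/funext => w; rewrite mul0e.
- move=> _ _ [b b0 ->] [b' b'0 ->]; exists (b + b'); first exact: addr_ge0.
  by apply/funext => w; rewrite EFinD ge0_muleDl.
- move=> _ [b b0 ->].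
  pose a' i := if i == k then b else a i.
  have a'0 i : 0 <= a' i by rewrite /a'; case: ifP.
  have a'k : a' k = b by rewrite /a' eqxx.
  have a's2 i : i \in s2 -> a' i = a i.
    move=> is2; rewrite /a'; case: eqP => // ik; move: ks.
    by rewrite mem_cat -ik is2 orbT.
  have us2 : uniq (s1 ++ k :: s2).
    by rewrite -cat_rcons -cats1 -catA uniq_catCA /= ks us'.
  have := ih (k :: s2) a' a'0 sub1 us2.
  have E2 : \prod_(i <- s2) \int[P]_w eN ((a' i)%:E * Y i w)%E =
      \prod_(i <- s2) \int[P]_w eN ((a i)%:E * Y i w)%E.
    by apply: eq_big_seq => i is2; rewrite a's2.
  rewrite big_cons a'k E2.
  rewrite mulrCA -/c [_ * c]mulrC.
  rewrite (_ : \int[P]_w (eN (b%:E * Y k w)%E * 1) = \int[P]_w eN (b%:E * Y k w)%E); last first.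
    by apply: eq_Rintegral => w _; rewrite mulr1.
  move=> <-; apply: eq_Rintegral => w _.
  rewrite big_cons a'k /Z mulrCA; congr (_ * (_ * _)).
  by apply: eq_big_seq => i is2; rewrite a's2.
- apply: sub_sigma_algebra; exists (Y k); last exact: FE.
  by exists 1 => //; apply/funext => w; rewrite mul1e.
Qed.

End independence_products.

(** * Poisson variables and their Laplace transform *)

Section poisson_law.
Context (R : realType) d (Omega : measurableType d) (P : probability Omega R).

Definition poisson_weight (r : R) (n : nat) : R := r ^+ n / n`!%:R * expR (- r).

Variables (N : Omega -> \bar R) (r : R).
Hypothesis mN : measurable_fun setT N.
Hypothesis N0 : forall w, (0 <= N w)%E.
Hypothesis NE : forall n, P [set w | N w = n%:R%:E] = (poisson_weight r n)%:E.

Let mNn n : measurable [set w | N w = n%:R%:E].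
Proof.
rewrite (_ : mkset _ = N @^-1` [set n%:R%:E]); last by apply/seteqP; split.
by rewrite -[X in measurable X]setTI; exact: mN.
Qed.

(** The exponential of [- a * N] cut off to the event that [N] is a natural number.
    The expectation of [D 0] shows that this event is almost sure. *)
Let D (a : R) (w : Omega) : R :=
  if pselect (exists n, N w = n%:R%:E) then eN (a%:E * N w)%E else 0.

Let DE1 a w : (exists n, N w = n%:R%:E) -> D a w = eN (a%:E * N w)%E.
Proof. by rewrite /D; case: pselect. Qed.

Let DE0 a w : ~ (exists n, N w = n%:R%:E) -> D a w = 0.
Proof. by rewrite /D; case: pselect. Qed.

Let Dm (a : R) (m : nat) (w : Omega) : R :=
  \sum_(n < m) expR (- (a * n%:R)) * \1_[set w | N w = n%:R%:E] w.

Let natE_inj (i j : nat) : i%:R%:E = j%:R%:E :> \bar R -> i = j.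
Proof. by move=> [] /eqP; rewrite eqr_nat => /eqP. Qed.

Let DmD a w : Dm a ^~ w @ \oo --> D a w.
Proof.
rewrite /D; case: pselect => [[n Nw]|nN].
  have E : (fun _ : nat => expR (- (a * n%:R))) @ \oo --> eN (a%:E * N w)%E.
    by rewrite Nw; exact: cvg_cst.
  apply: cvg_trans E; apply: near_eq_cvg; near=> m.
  have nm : (n < m)%N by near: m; exact: nbhs_infty_gt.
  rewrite /Dm (bigD1 (Ordinal nm))//= indicE mem_set// mulr1 big1 ?addr0// => i.
  move=> /eqP ni; rewrite indicE memNset ?mulr0//= => Ni; apply: ni.
  by apply/val_inj => /=; apply: natE_inj; rewrite -Ni.
rewrite (_ : Dm a ^~ w = fun=> 0); first exact: cvg_cst.
apply/funext => m; rewrite /Dm big1// => i _.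
by rewrite indicE memNset ?mulr0//= => Ni; apply: nN; exists i.
Unshelve. all: by end_near. Qed.

Let bDm a m : bmeas (Dm a m).
Proof.
rewrite /Dm; elim: m => [|m ih].
  by under eq_fun do rewrite big_ord0; exact: bmeas_cst.
under eq_fun do rewrite big_ord_recr /= addrC.
by apply: bmeas_lin => //; apply: bmeas_indic.
Qed.

Let Dm01 a m w : 0 <= a -> `|Dm a m w| <= 1.
Proof.
move=> a0; rewrite ger0_norm; last first.
  by apply: sumr_ge0 => i _; rewrite mulr_ge0 ?expR_ge0// indicE.
have nd : {homo (fun m => Dm a m w) : m n / (m <= n)%N >-> m <= n}.
  move=> k l kl; rewrite /Dm -(subnKC kl) big_split_ord/= lerDl.
  by apply: sumr_ge0 => i _; rewrite mulr_ge0 ?expR_ge0// indicE.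
apply: (@le_trans _ _ (D a w)).
  rewrite -(cvg_lim _ (@DmD a w))//; apply: nondecreasing_cvgn_le => //.
  by apply/cvg_ex; exists (D a w); exact: DmD.
by rewrite /D; case: pselect => h; [rewrite eN_le1// mule_ge0|exact: ler01].
Qed.

Let ED a : 0 <= a -> \int[P]_w D a w = expR (- ((1 - expR (- a)) * r)).
Proof.
move=> a0.
have h := E_lim (P := P) (bDm a) (fun m w => @Dm01 a m w a0) (@DmD a).
rewrite -(cvg_lim _ h)//; apply/cvg_lim => //.
have EDm m : \int[P]_w Dm a m w = expR (- r) * series (exp_coeff (r * expR (- a))) m.
  rewrite /Dm seriesEord/=; elim: m => [|m ih].
    rewrite big_ord0 mulr0 -[RHS](E_cst P 0).
    by apply: eq_Rintegral => w _; rewrite big_ord0.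
  rewrite big_ord_recr /= mulrDr -ih.
  under eq_Rintegral do rewrite big_ord_recr /= addrC.
  rewrite E_lin; [|exact: bmeas_indic|exact: bDm].
  rewrite E_indic// NE /= addrC; congr (_ + _).
  rewrite /poisson_weight exp_coeffE exprMn -expRM_natl mulrN (mulrC a); ring.
under eq_fun do rewrite EDm.
rewrite (_ : expR _ = expR (- r) * expR (r * expR (- a))); last first.
  by rewrite -expRD; congr expR; ring.
apply: cvgMr; rewrite [X in _ --> X]/expR; exact: is_cvg_series_exp_coeff.
Qed.

Lemma poisson_laplace a : 0 <= a ->
  \int[P]_w eN (a%:E * N w)%E = expR (- ((1 - expR (- a)) * r)).
Proof.
move=> a0; rewrite -ED//.
have bD b : 0 <= b -> bmeas (D b).
  by move=> b0; exact: (bmeas_lim (bDm b) (fun m w => @Dm01 b m w b0) (@DmD b)).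
have bN : bmeas (fun w => eN (a%:E * N w)%E).
  apply: bmeas_eN => [|w]; first exact: measurable_funeM.
  by rewrite mule_ge0.
have mB : measurable [set w | exists n, N w = n%:R%:E].
  rewrite (_ : mkset _ = \bigcup_n [set w | N w = n%:R%:E]).
    by apply: bigcupT_measurable.
  by apply/seteqP; split => w /= [n]; [exists n|exists n].
have PB : P [set w | exists n, N w = n%:R%:E] = 1%E.
  rewrite -[LHS]fineK ?fin_num_measure//; congr EFin.
  rewrite -E_indic//; have := ED (lexx 0).
  rewrite oppr0 expR0 subrr mul0r oppr0 expR0 => E0; rewrite -[RHS]E0.
  apply: eq_Rintegral => w _; rewrite indicE.
  have [h|h] := pselect (exists n, N w = n%:R%:E).
    by rewrite mem_set// DE1// (_ : 0%:E * N w = 0)%E ?eN0//; exact: mul0e.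
  by rewrite memNset// DE0.
apply: E_ae => //; first exact: bD.
exists (~` [set w | exists n, N w = n%:R%:E]); split.
- exact: measurableC.
- by rewrite probability_setC// PB subee.
- move=> w /=; apply: contra_not => h; rewrite /D; case: pselect => //.
Qed.

End poisson_law.

(** At rate 0 the left-hand side is the Dirac mass at 0, in agreement with the
    weights [0 ^+ n / n`!]. *)
Lemma poisson_prob1 (R : realType) (r : R) n : 0 <= r ->
  poisson_prob r 0 [set n] = (poisson_weight r n)%:E.
Proof.
rewrite le_eqVlt => /predU1P[<-|r0]; rewrite /poisson_prob.
  rewrite ltxx /poisson_weight oppr0 expR0 mulr1 diracE expr0n.
  case: n => [|n] /=; first by rewrite mem_set// fact0 divr1.
  by rewrite mul0r memNset//=.
by rewrite r0 esum_set1 ?lee_fin ?poisson_pmf_ge0// /poisson_pmf r0.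
Qed.

(** A Poisson variable on [nat] has the same Laplace transform.  The test functions
    use [`|y|] to be nonnegative on the whole of [\bar R]. *)
Lemma poisson_inversion (R : realType) d (Omega : measurableType d)
    (P : probability Omega R) (N : Omega -> \bar R) (r : R) :
  measurable_fun setT N -> (forall w, (0 <= N w)%E) -> 0 <= r ->
  (forall a, 0 <= a ->
    \int[P]_w eN (a%:E * N w)%E = expR (- ((1 - expR (- a)) * r))) ->
  forall n, P [set w | N w = n%:R%:E] = (poisson_weight r n)%:E.
Proof.
move=> mN N0 r0 lap n.
pose Q : probability nat R := poisson_prob r 0.
pose M (n : nat) : \bar R := n%:R%:E.
have mM : measurable_fun setT M by [].
have M0 k : (0 <= M k)%E by rewrite lee_fin.
have QE k : Q [set j | M j = k%:R%:E] = (poisson_weight r k)%:E.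
  rewrite -poisson_prob1//; congr (poisson_prob r 0 _); apply/seteqP; split => j /=.
    by move=> [] /eqP; rewrite eqr_nat => /eqP.
  by move=> ->.
have lapQ := poisson_laplace mM M0 QE.
have b1 := bfun_E P mN (bmeas_cst _ 1).
have b2 := bfun_E Q mM (bmeas_cst _ 1).
pose Phi := [set phi : \bar R -> \bar R | exists2 b : R, 0 <= b & phi = (fun y => b%:E * `|y|)%E].
have := @bfun_ext_laplace _ _ _ _ _ Phi b1 b2 _ _ _ _ ((fun y => `|y|%E) @^-1` [set n%:R%:E]).
have mNn : measurable [set w | N w = n%:R%:E].
  rewrite (_ : mkset _ = N @^-1` [set n%:R%:E]); last by apply/seteqP; split.
  by rewrite -[X in measurable X]setTI; exact: mN.
have mMn : measurable [set w | M w = n%:R%:E] by [].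
move=> /(_ _ _ _ _ _) H.
rewrite -QE -[LHS]fineK ?fin_num_measure// -[RHS]fineK ?fin_num_measure//.
congr EFin; rewrite -!E_indic//.
transitivity (\int[P]_w (\1_((fun y : \bar R => `|y|%E) @^-1` [set n%:R%:E]) (N w) * 1)).
  apply: eq_Rintegral => w _; rewrite mulr1 !indicE.
  case: (pselect (N w = n%:R%:E)) => h; [rewrite !mem_set//= ?gee0_abs//|].
  by rewrite !memNset//= gee0_abs.
rewrite H.
- apply: eq_Rintegral => w _; rewrite mulr1 !indicE.
  case: (pselect (M w = n%:R%:E)) => h.
    by rewrite !mem_set// /preimage/mkset gee0_abs.
  by rewrite !memNset// /preimage/mkset gee0_abs.
- move=> _ [b b0 ->]; split; last by move=> y; rewrite mule_ge0.
  by apply: measurable_funeM; exact: abse_measurable.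
- by exists 0 => //; apply/funext => w; rewrite mul0e.
- move=> _ _ [b b0 ->] [b' b'0 ->]; exists (b + b'); first exact: addr_ge0.
  by apply/funext => w; rewrite EFinD ge0_muleDl.
- move=> _ [b b0 ->].
  transitivity (\int[P]_w eN (b%:E * N w)%E).
    by apply: eq_Rintegral => w _; rewrite mulr1 gee0_abs.
  rewrite lap// -lapQ//; apply: eq_Rintegral => w _; by rewrite mulr1 gee0_abs.
- apply: sub_sigma_algebra; exists (fun y => `|y|%E).
    by exists 1 => //; apply/funext => w; rewrite mul1e.
  by exists [set n%:R%:E] => //; rewrite setTI.
Qed.

(** * Laplace functionals of Poisson point processes *)

Section counting_points.
Context (R : realType) dS (S : measurableType dS).
Implicit Types z : nat -> S.

Definition point_measure z : {measure set S -> \bar R} :=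
  mseries (fun k => \d_(z k) : {measure set S -> \bar R}) 0.

Lemma point_countE z A : point_count R z A = point_measure z A.
Proof. by rewrite /point_count -nneseries_esumT. Qed.

Lemma integral_point_measure z (f : S -> \bar R) : measurable_fun setT f ->
  (forall s, (0 <= f s)%E) ->
  (\int[point_measure z]_s f s = \sum_(k <oo) f (z k))%E.
Proof.
move=> mf f0; rewrite ge0_integral_measure_series//.
by apply: eq_eseriesr => k _; rewrite integral_dirac// diracT mul1e.
Qed.

End counting_points.

Lemma measurable_point_measure (R : realType) dS (S : measurableType dS) d (Omega : measurableType d)
  (z : nat -> Omega -> S) A : (forall k, measurable_fun setT (z k)) -> measurable A ->
  measurable_fun setT (fun w => point_measure R (z ^~ w) A).
Proof.
move=> mz mA; apply: ge0_emeasurable_sum => // k _.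
have -> : (fun w => \d_(z k w) A : \bar R) = (fun w => (\1_A (z k w))%:E).
  by apply/funext => w; rewrite diracE.
apply/measurable_EFinP; apply: measurableT_comp => //; exact: measurable_indic.
Qed.

Section simple_integrals.
Context (R : realType) dS (S : measurableType dS).
Import HBNNSimple.

Lemma integral_comp_nnsfun (m : {measure set S -> \bar R}) (g : {nnsfun S >-> R})
    (phi : R -> R) : (forall y, 0 <= phi y) ->
  (\int[m]_s (phi (g s))%:E =
   \sum_(y <- finmap.enum_fset (fset_set (range g))) (phi y)%:E * m (g @^-1` [set y]))%E.
Proof.
move=> phi0; set r := finmap.enum_fset _.
have ur : uniq r by exact: finmap.fset_uniq.
transitivity (\int[m]_s \sum_(y <- r) ((phi y)%:E * (\1_(g @^-1` [set y]) s)%:E))%E.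
  apply: eq_integral => s _.
  have gr : g s \in r by rewrite in_fset_set// inE; exists s.
  rewrite (bigD1_seq (g s))//= indicE mem_set// mule1 big1_seq ?adde0// => y.
  move=> /andP[ygs _]; rewrite indicE memNset ?mule0//=.
  by move=> E; rewrite E eqxx in ygs.
have mg y : measurable (g @^-1` [set y]) by [].
rewrite ge0_integral_sum//.
- apply: eq_bigr => y _; rewrite ge0_integralZl//.
  + by rewrite integral_indic// setIT.
  + by apply/measurable_EFinP; exact: measurable_indic.
  + by rewrite lee_fin.
- move=> y; apply: measurable_funeM; apply/measurable_EFinP; exact: measurable_indic.
- by move=> y s _; rewrite mule_ge0// lee_fin// indicE.
Qed.

End simple_integrals.

Lemma cvg_mono_integral (R : realType) dS (S : measurableType dS)
    (mu : {measure set S -> \bar R}) (g : nat -> S -> R) (f : S -> R) :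
  (forall n, measurable_fun setT (g n)) -> (forall n s, 0 <= g n s) ->
  (forall s, {homo (fun n => g n s) : m n / (m <= n)%N >-> m <= n}) ->
  (forall s, (fun n => g n s) @ \oo --> f s) ->
  (\int[mu]_s (g n s)%:E @[n --> \oo] --> \int[mu]_s (f s)%:E)%E.
Proof.
move=> mg g0 ndg gf.
have -> : (\int[mu]_s (f s)%:E = \int[mu]_s limn (fun n => (g n s)%:E))%E.
  apply: eq_integral => s _; apply/esym/cvg_lim => //.
  by apply: cvg_EFin; [exact: nearW|exact: gf].
apply: cvg_monotone_convergence => //.
- by move=> n; exact/measurable_EFinP.
- by move=> n s _; rewrite lee_fin.
- by move=> s _ m n mn; rewrite lee_fin; exact: ndg.
Qed.

Section ppp_laplace.
Context (R : realType) d (Omega : measurableType d) (P : probability Omega R)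
  dS (S : measurableType dS) (rho : {measure set S -> \bar R})
  (z : nat -> Omega -> S).
Hypothesis mz : forall k, measurable_fun setT (z k).

Section direct.
Hypothesis ppp : poisson_point_process P rho z.

Let N A w := point_measure R (z ^~ w) A.

Let laplace1 (A : set S) a : measurable A -> 0 <= a ->
  \int[P]_w eN (a%:E * N A w)%E = eN ((1 - expR (- a))%:E * rho A)%E.
Proof.
move=> mA; rewrite le_eqVlt => /predU1P[<-|a0].
  rewrite oppr0 expR0 subrr mul0e eN0 -[RHS](E_cst P 1).
  by apply: eq_Rintegral => w _; rewrite mul0e eN0.
have mN := measurable_point_measure mz mA.
have N0 w : (0 <= N A w)%E by exact: measure_ge0.
have ea : 0 < 1 - expR (- a) by rewrite subr_gt0 -expR0 ltr_expR; lra.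
have : (0 <= rho A)%E by exact: measure_ge0.
case E : (rho A) => [r| |] // r0.
- rewrite (@poisson_laplace _ _ _ P (N A) r)//; last exact: ltW.
  move=> n; rewrite -(ppp_finite ppp n mA E); congr (P _).
  by apply/seteqP; split => w /=; rewrite point_countE.
- have := ppp_infinite ppp mA E => Pi.
  have Ni : [set w | point_count R (z ^~ w) A = +oo%E] = [set w | N A w = +oo%E].
    by apply/seteqP; split => w /=; rewrite point_countE.
  have mNi : measurable [set w | N A w = +oo%E].
    rewrite (_ : mkset _ = N A @^-1` [set +oo%E]); last by apply/seteqP; split.
    by rewrite -[X in measurable X]setTI; exact: mN.
  rewrite gt0_muley ?lte_fin//; transitivity (\int[P]_w (0 : R)); last by rewrite E_cst.
  apply: E_ae; last 2 first.
  + exact: bmeas_cst.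
  + exists (~` [set w | N A w = +oo%E]); split; first exact: measurableC.
      by rewrite probability_setC// -Ni Pi subee.
    by move=> w /=; apply: contra_not => ->; rewrite gt0_muley ?lte_fin.
  + apply: bmeas_eN; first exact: measurable_funeM.
    by move=> w; rewrite mule_ge0// ltW.
Qed.

Let laplace_fin n (A : 'I_n -> set S) (a : 'I_n -> R) :
  (forall i, measurable (A i)) -> trivIset [set: 'I_n] A -> (forall i, 0 <= a i) ->
  \int[P]_w eN (\sum_(i < n) (a i)%:E * N (A i) w)%E =
  eN (\sum_(i < n) (1 - expR (- a i))%:E * rho (A i))%E.
Proof.
move=> mA tA a0.
have N0 i w : (0 <= N (A i) w)%E by exact: measure_ge0.
rewrite eN_sum; last first.
  move=> i; rewrite mule_ge0// lee_fin subr_ge0 -expR0 ler_expR.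
  by rewrite oppr_le0.
transitivity (\int[P]_w \prod_(i < n) eN ((a i)%:E * `|point_count R (z ^~ w) (A i)|)%E).
  apply: eq_Rintegral => w _; rewrite eN_sum; last first.
    by move=> i; apply: mule_ge0 => //; rewrite lee_fin.
  by apply: eq_bigr => i _; rewrite point_countE gee0_abs.
rewrite (indep_prod (Y := fun i w => point_count R (z ^~ w) (A i))
  (g := fun i y => eN ((a i)%:E * `|y|)%E)).
- apply: eq_bigr => i _; rewrite -laplace1//.
  by apply: eq_Rintegral => w _; rewrite point_countE gee0_abs.
- move=> i; under eq_fun do rewrite point_countE; exact: measurable_point_measure.
- exact: (ppp_independent ppp).
- move=> i; apply: (@measurableT_comp _ _ _ _ _ _ (@eN R)); first exact: measurable_eN.
  by apply: measurable_funeM; exact: abse_measurable.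
- by move=> i x; rewrite eN_ge0 eN_le1//; apply: mule_ge0 => //; rewrite lee_fin.
- exact: index_enum_uniq.
Qed.

Import HBNNSimple.

Let laplace_simple (g : {nnsfun S >-> R}) :
  \int[P]_w eN (\sum_(k <oo) (g (z k w))%:E)%E =
  eN (\int[rho]_s (1 - expR (- g s))%:E)%E.
Proof.
set r := finmap.enum_fset (fset_set (range g)).
have gabs s : `|g s| = g s by rewrite ger0_norm.
have ur : uniq r by exact: finmap.fset_uniq.
have -> : (\int[rho]_s (1 - expR (- g s))%:E =
    \int[rho]_s (1 - expR (- `|g s|))%:E)%E.
  by apply: eq_integral => s _; rewrite gabs.
rewrite (@integral_comp_nnsfun _ _ _ rho g (fun y => 1 - expR (- `|y|))); last first.
  by move=> y; rewrite subr_ge0 -expR0 ler_expR oppr_le0.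
rewrite -/r (big_nth 0) big_mkord -laplace_fin//.
- apply: eq_Rintegral => w _; congr eN.
  transitivity (\int[point_measure R (z ^~ w)]_s (`|g s|)%:E)%E.
    rewrite integral_point_measure//.
      by apply: eq_eseriesr => k _; rewrite gabs.
    by apply/measurable_EFinP; apply: measurableT_comp.
  rewrite (@integral_comp_nnsfun _ _ _ _ g (fun y => `|y|))//.
  by rewrite -/r (big_nth 0) big_mkord.
- move=> i j _ _ [x [/= gi gj]]; apply/val_inj/eqP.
  by rewrite -(nth_uniq 0 _ _ ur)//= -gi -gj.
Qed.

(** For a simple function the sum over the points is a linear combination of the
    independent Poisson counts of its level sets, whose Laplace transforms
    multiply; monotone limits do the rest. *)
Theorem ppp_laplace (f : S -> R) : measurable_fun setT f -> (forall s, 0 <= f s) ->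
  \int[P]_w eN (\sum_(k <oo) (f (z k w))%:E)%E =
  eN (\int[rho]_s (1 - expR (- f s))%:E)%E.
Proof.
move=> mf f0.
have mEf : measurable_fun setT (EFin \o f) by apply/measurable_EFinP.
have Ef0 s : (0 <= (EFin \o f) s)%E by rewrite lee_fin.
pose g := nnsfun_approx measurableT mEf.
have ndg s : {homo (fun n => g n s) : m n / (m <= n)%N >-> m <= n}.
  by move=> m n mn; exact/lefP/nd_nnsfun_approx.
have gf s : (fun n => g n s) @ \oo --> f s.
  by have /fine_cvgP[] := cvg_nnsfun_approx measurableT mEf (fun x _ => Ef0 x) (x := s) I.
have mg n : measurable_fun setT (fun s => (g n s)%:E) by exact/measurable_EFinP.
have mSg n : measurable_fun setT (fun w => \sum_(k <oo) (g n (z k w))%:E)%E.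
  apply: ge0_emeasurable_sum => [k w _ _|k _]; first by rewrite lee_fin.
  by apply: (@measurableT_comp _ _ _ _ _ _ (fun s => (g n s)%:E)).
have Sg0 n w : (0 <= \sum_(k <oo) (g n (z k w))%:E)%E.
  by apply: nneseries_ge0 => k _ _; rewrite lee_fin.
have H1 : (fun n => \int[P]_w eN (\sum_(k <oo) (g n (z k w))%:E)%E) @ \oo -->
    \int[P]_w eN (\sum_(k <oo) (f (z k w))%:E)%E.
  apply: (E_lim (M := 1)).
  - by move=> n; exact: bmeas_eN.
  - by move=> n w; rewrite eN_ubound.
  - move=> w; apply: eN_cvg_nd => //.
    rewrite (_ : (fun n => _) = fun n => \int[point_measure R (z ^~ w)]_s (g n s)%:E)%E; last first.
      by apply/funext => n; rewrite integral_point_measure// => s; rewrite lee_fin.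
    rewrite -(@integral_point_measure _ _ _ _ (EFin \o f))//.
    exact: cvg_mono_integral.
have ge h s : 0 <= h s -> (0 <= (1 - expR (- h s) : R)%:E)%E.
  by move=> h0; rewrite lee_fin subr_ge0 -expR0 ler_expR oppr_le0.
have H2 : (fun n => eN (\int[rho]_s (1 - expR (- g n s))%:E)%E) @ \oo -->
    eN (\int[rho]_s (1 - expR (- f s))%:E)%E.
  apply: eN_cvg_nd.
    by move=> n; apply: integral_ge0 => s _; exact: ge.
  apply: cvg_mono_integral => //.
  - move=> n; apply: measurable_funB => //.
    by apply: (measurableT_comp (@measurable_expR R)); exact: measurable_funN.
  - by move=> n s; rewrite -lee_fin; exact: ge.
  - move=> s m n mn; rewrite lerD2l lerN2 ler_expR lerN2; exact: ndg.
  - move=> s; apply: cvgB; first exact: cvg_cst.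
    apply: (@cvg_comp _ _ _ _ expR); last exact: continuous_expR.
    by apply: cvgN; exact: gf.
rewrite -(cvg_lim _ H1)// -(cvg_lim _ H2)//; congr (lim (_ @ \oo)).
by apply/funext => n; rewrite laplace_simple.
Qed.

End direct.

(** Combinations of indicators of disjoint sets as test functions give the joint
    Laplace transform of the counts, which is that of independent Poisson
    variables. *)
Theorem laplace_ppp :
  (forall f : S -> R, measurable_fun setT f -> (forall s, 0 <= f s) ->
    \int[P]_w eN (\sum_(k <oo) (f (z k w))%:E)%E =
    eN (\int[rho]_s (1 - expR (- f s))%:E)%E) ->
  poisson_point_process P rho z.
Proof.
move=> lap.
pose N A w := point_measure R (z ^~ w) A.
have N0 A w : (0 <= N A w)%E by exact: measure_ge0.
have mN A : measurable A -> measurable_fun setT (N A) by exact: measurable_point_measure.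
have lapfin (I : choiceType) (s : seq I) (A : I -> set S) (a : I -> R) : uniq s ->
    (forall i, measurable (A i)) -> trivIset setT A -> (forall i, 0 <= a i) ->
    \int[P]_w eN (\sum_(i <- s) (a i)%:E * N (A i) w)%E =
    eN (\sum_(i <- s) (1 - expR (- a i))%:E * rho (A i))%E.
  move=> us mA tA a0.
  pose f x := \sum_(i <- s) a i * \1_(A i) x.
  have mf : measurable_fun setT f.
    by apply: measurable_sum => i; apply: measurable_funM.
  have f0 x : 0 <= f x.
    by apply: sumr_ge0 => i _; rewrite mulr_ge0// indicE.
  have ea i : 0 <= 1 - expR (- a i).
    by rewrite subr_ge0 -expR0 ler_expR oppr_le0.
  have intE (m : {measure set S -> \bar R}) (b : I -> R) : (forall i, 0 <= b i) ->
      (\int[m]_x (\sum_(i <- s) b i * \1_(A i) x)%:E =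
       \sum_(i <- s) (b i)%:E * m (A i))%E.
    move=> b0; under eq_integral do rewrite -sumEFin.
    rewrite ge0_integral_sum//.
    - apply: eq_bigr => i _; under eq_integral do rewrite EFinM.
      rewrite ge0_integralZl//; first by rewrite integral_indic// setIT.
      + by apply/measurable_EFinP; exact: measurable_indic.
      + by rewrite lee_fin.
    - by move=> i; apply/measurable_EFinP; apply: measurable_funM.
    - by move=> i x _; rewrite lee_fin mulr_ge0// indicE.
  transitivity (\int[P]_w eN (\sum_(k <oo) (f (z k w))%:E)%E).
    apply: eq_Rintegral => w _; congr eN.
    rewrite -(@integral_point_measure _ _ _ _ (fun x => (f x)%:E)); first by rewrite /f intE.
    - by apply/measurable_EFinP.
    - by move=> x; rewrite lee_fin.
  rewrite lap//; congr eN; rewrite -intE//; apply: eq_integral => x _; congr EFin.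
  rewrite /f; elim: s us {f mf f0 intE} => [|i s ih] /=.
    by rewrite !big_nil oppr0 expR0 subrr.
  move=> /andP[iNs us]; rewrite !big_cons -ih//.
  rewrite !indicE; case: (boolP (x \in A i)) => xA /=; last by rewrite !mulr0 !add0r.
  rewrite big1_seq ?addr0 ?oppr0 ?expR0 ?subrr ?mulr1 ?addr0// => j /andP[_ js].
  rewrite indicE memNset ?mulr0// => xj.
  have ij : i = j by apply: tA => //; exists x; split => //; rewrite inE in xA.
  by rewrite ij js in iNs.
have lap1 A a : measurable A -> 0 <= a ->
    \int[P]_w eN (a%:E * N A w)%E = eN ((1 - expR (- a))%:E * rho A)%E.
  move=> mA a0.
  have := @lapfin unit [:: tt] (fun=> A) (fun=> a) erefl (fun=> mA) _ (fun=> a0).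
  rewrite big_seq1 => <-; last by move=> [] [].
  by apply: eq_Rintegral => w _; rewrite big_seq1.
split.
- move=> A r n mA rA.
  have -> : [set w | point_count R (z ^~ w) A = n%:R%:E] = [set w | N A w = n%:R%:E].
    by apply/seteqP; split => w /=; rewrite point_countE.
  rewrite (@poisson_inversion _ _ _ P (N A) r)//.
  + exact: mN.
  + by have : (0 <= rho A)%E; [exact: measure_ge0|rewrite rA lee_fin].
  + by move=> a a0; rewrite lap1// rA.
- move=> A mA rA.
  have -> : [set w | point_count R (z ^~ w) A = +oo%E] = [set w | N A w = +oo%E].
    by apply/seteqP; split => w /=; rewrite point_countE.
  have mNi : measurable [set w | N A w = +oo%E].
    rewrite (_ : mkset _ = N A @^-1` [set +oo%E]); last by apply/seteqP; split.
    by rewrite -[X in measurable X]setTI; exact: mN.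
  have := lap1 A 1 mA ler01; rewrite rA gt0_muley; last first.
    by rewrite lte_fin subr_gt0 expR_lt1 oppr_lt0.
  rewrite [RHS]/eN /= => E0.
  have E1 : \int[P]_w eN (N A w) = 0.
    by rewrite -E0; apply: eq_Rintegral => w _; rewrite mul1e.
  have be : bmeas (fun w => eN (N A w)) by apply: bmeas_eN => //; exact: mN.
  have : (\int[P]_w `|(eN (N A w))%:E| = 0)%E.
    transitivity (\int[P]_w (eN (N A w))%:E)%E.
      by apply: eq_integral => w _; rewrite gee0_abs// lee_fin eN_ge0.
    by rewrite E_EFin// E1.
  have m0 : measurable_fun setT (fun w => (eN (N A w))%:E).
    by apply/measurable_EFinP; exact: be.1.
  move=> /(ae_eq_integral_abs P measurableT m0) [B [mB PB NB]].
  have : P (~` [set w | N A w = +oo%E]) = 0%E.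
    apply/eqP; rewrite eq_le measure_ge0 andbT -PB le_measure ?inE//.
      exact: measurableC.
    move=> w /= Nw; apply: NB => /= /(_ I) [].
    have := N0 A w; move: Nw; case: (N A w) => // r _ _; rewrite /eN /= => /eqP.
    by rewrite gt_eqF// expR_gt0.
  rewrite probability_setC// => /eqP; rewrite sube_eq ?fin_num_measure//.
  by rewrite add0e => /eqP.
- move=> n A mA tA.
  have E : (fun i => preimage_set_system setT (fun w => point_count R (z ^~ w) (A i))
      (measurable : set (set (\bar R)))) =
    (fun i => preimage_set_system setT (N (A i)) measurable).
    apply/funext => i; congr preimage_set_system.
    by apply/funext => w; rewrite point_countE.
  rewrite E; apply: indep_of_laplace => //.
    by move=> i; exact: mN.
  move=> s a us a0.
  transitivity (\int[P]_w eN (\sum_(i <- s) (a i)%:E * N (A i) w)%E).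
    by apply: eq_Rintegral => w _; rewrite eN_sum// => i; apply: mule_ge0 => //; rewrite lee_fin.
  rewrite lapfin// eN_sum; last first.
    move=> i; apply: mule_ge0 => //.
    by rewrite lee_fin subr_ge0 -expR0 ler_expR oppr_le0.
  by apply: eq_bigr => i _; rewrite lap1.
Qed.

End ppp_laplace.

(** * Averaging over a mark, summing over atoms *)

(** Inversion is discontinuous at 0, but [x^-1 = x * (x ^ 2)^-1], and on nonnegative
    numbers inversion is a real power. *)
Lemma measurable_inv (R : realType) : measurable_fun [set: R] (fun x : R => x^-1).
Proof.
rewrite (_ : (fun x => _) = fun x : R => x * (x ^+ 2) `^ (-1)); last first.
  apply/funext => x; rewrite powR_inv1 ?sqr_ge0//.
  have [->|x0] := eqVneq x 0; first by rewrite mul0r invr0.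
  by rewrite expr2 invfM mulrA divff// mul1r.
apply: measurable_funM => //.
exact: (measurableT_comp (@measurable_powR R (-1)) (exprn_measurable 2)).
Qed.

Lemma measurable_funinv (R : realType) d (T : measurableType d) (f : T -> R) :
  measurable_fun setT f -> measurable_fun setT (fun x => (f x)^-1).
Proof.
by apply: (@measurableT_comp _ _ _ _ _ _ (fun x : R => x^-1)); exact: measurable_inv.
Qed.

Lemma prod01 (R : realType) (I : Type) (s : seq I) (F : I -> R) :
  (forall i, 0 <= F i <= 1) -> 0 <= \prod_(i <- s) F i <= 1.
Proof.
move=> F01; elim: s => [|i s /andP[ih0 ih1]]; first by rewrite big_nil ler01 lexx.
by have /andP[Fi0 Fi1] := F01 i; rewrite big_cons mulr_ge0//= mulr_ile1.
Qed.

Section mix.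
Context (R : realType).

(** The average of [a] and [b] with the probabilities [t / (1 + t)] and
    [1 / (1 + t)] of the marks 1 and 0.  The absolute value makes it an average,
    and measurable, for all real [t]. *)
Definition mix (t a b : R) : R := (`|t| * a + b) / (1 + `|t|).

Lemma mix_den (t : R) : 0 < 1 + `|t|.
Proof. by rewrite ltr_pwDl. Qed.

Lemma mix01 t a b : 0 < a <= 1 -> 0 < b <= 1 -> 0 < mix t a b <= 1.
Proof.
move=> /andP[a0 a1] /andP[b0 b1]; rewrite /mix divr_gt0 ?mix_den//=; last first.
  by rewrite ltr_wpDl// mulr_ge0// ltW.
rewrite ler_pdivrMr ?mix_den// mul1r addrC lerD// ler_piMr//.
Qed.

Lemma mix_ge01 t a b : 0 <= a <= 1 -> 0 <= b <= 1 -> 0 <= mix t a b <= 1.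
Proof.
move=> /andP[a0 a1] /andP[b0 b1]; rewrite /mix divr_ge0 ?(ltW (mix_den _))//=; last first.
  by rewrite addr_ge0// mulr_ge0.
rewrite ler_pdivrMr ?mix_den// mul1r addrC lerD// ler_piMr//.
Qed.

Lemma mixE t a b : 0 < t ->
  mix t a b = odds_bernoulli_pmf true t * a + odds_bernoulli_pmf false t * b.
Proof.
move=> t0; rewrite /mix /odds_bernoulli_pmf gtr0_norm//= expr1 expr0.
by rewrite mulrDl mulrAC div1r (mulrC b).
Qed.

Lemma measurable_mix d (T : measurableType d) (t a b : T -> R) :
  measurable_fun setT t -> measurable_fun setT a -> measurable_fun setT b ->
  measurable_fun setT (fun x => mix (t x) (a x) (b x)).
Proof.
move=> mt ma mb.
have mnt : measurable_fun setT (fun x => `|t x|) by exact: measurableT_comp.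
apply: measurable_funM.
  by apply: measurable_funD => //; exact: measurable_funM.
apply: measurable_funinv; exact: measurable_funD.
Qed.

Lemma pmf01 e (t : R) : 0 < t -> 0 <= odds_bernoulli_pmf e t <= 1.
Proof.
move=> t0; rewrite /odds_bernoulli_pmf.
have d0 : 0 < 1 + t by rewrite addr_gt0.
rewrite divr_ge0 ?exprn_ge0 ?(ltW t0) ?(ltW d0)//= ler_pdivrMr// mul1r.
by case: e; rewrite /= ?expr1 ?expr0; lra.
Qed.

Lemma measurable_pmf e : measurable_fun setT (@odds_bernoulli_pmf R e).
Proof.
apply: measurable_funM; first exact: exprn_measurable.
apply: measurable_funinv; exact: measurable_funD.
Qed.

(** When a mark is averaged out, the pair of exponents [a] and [b] is replaced by
    this single exponent. *)
Definition neglog_mix (t a b : R) : R := - ln (mix t (expR (- a)) (expR (- b))).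

Lemma neglog_mix_ge0 t a b : 0 <= a -> 0 <= b -> 0 <= neglog_mix t a b.
Proof.
move=> a0 b0; rewrite /neglog_mix oppr_ge0 ln_le0//.
have /andP[] // : 0 < mix t (expR (- a)) (expR (- b)) <= 1.
by apply: mix01; rewrite expR_gt0/= expR_le1 oppr_le0.
Qed.

Lemma expR_neglog_mix t a b : 0 <= a -> 0 <= b ->
  expR (- neglog_mix t a b) = mix t (expR (- a)) (expR (- b)).
Proof.
move=> a0 b0; rewrite /neglog_mix opprK lnK// posrE.
have /andP[] // : 0 < mix t (expR (- a)) (expR (- b)) <= 1.
by apply: mix01; rewrite expR_gt0/= expR_le1 oppr_le0.
Qed.

Lemma measurable_expRN d (T : measurableType d) (a : T -> R) :
  measurable_fun setT a -> measurable_fun setT (fun x => expR (- a x)).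
Proof.
by move=> ma; apply: (measurableT_comp (@measurable_expR R)); exact: measurable_funN.
Qed.

Lemma measurable_neglog_mix d (T : measurableType d) (t a b : T -> R) :
  measurable_fun setT t -> measurable_fun setT a -> measurable_fun setT b ->
  measurable_fun setT (fun x => neglog_mix (t x) (a x) (b x)).
Proof.
move=> mt ma mb; apply: measurable_funN.
apply: (measurableT_comp (@measurable_ln R)).
by apply: measurable_mix => //; exact: measurable_expRN.
Qed.

End mix.

Section total.
Context (R : realType) (K : nat).
Local Open Scope ereal_scope.

(** The sum over all atoms, written as a finite sum plus a series. *)
Definition atom_sum (F : 'I_K + nat -> \bar R) : \bar R :=
  \sum_(k < K) F (inl k) + \sum_(j <oo) F (inr j).

Lemma esum_atom_sum F : (forall k, 0 <= F k) -> \esum_(k in [set: 'I_K + nat]) F k = atom_sum F.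
Proof.
move=> F0; rewrite (esumID (range (@inl 'I_K nat)))// !setTI /atom_sum; congr (_ + _).
  rewrite esum_image; last by move=> ? ? _ _ [].
  rewrite esum_fset//= fsbig_finite//=; apply: perm_big.
  apply: uniq_perm; rewrite ?finmap.fset_uniq ?index_enum_uniq// => k.
  by rewrite mem_index_enum in_fset_set ?in_setT//; exact: finite_finset.
rewrite (_ : ~` _ = range (@inr 'I_K nat)); last first.
  apply/seteqP; split => [[k|j] //= h|_ [j _ <-] [] //].
  - by exfalso; apply: h; exists k.
  - by exists j.
by rewrite esum_image ?nneseries_esumT//; move=> ? ? _ _ [].
Qed.

Lemma atom_sum_ge0 F : (forall k, 0 <= F k) -> 0 <= atom_sum F.
Proof. by move=> F0; rewrite adde_ge0 ?sume_ge0// nneseries_ge0. Qed.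

Lemma eN_atom_sum F : (forall k, 0 <= F k) ->
  eN (atom_sum F) = (\prod_(k < K) eN (F (inl k)) * eN (\sum_(j <oo) F (inr j)))%R.
Proof.
by move=> F0; rewrite eND ?eN_sum ?sume_ge0// nneseries_ge0.
Qed.

Lemma eq_atom_sum F G : F =1 G -> atom_sum F = atom_sum G.
Proof. by move=> /funext ->. Qed.

End total.

Lemma measurable_atom_sum (R : realType) K d (T : measurableType d)
   (F : 'I_K + nat -> T -> \bar R) :
  (forall k, measurable_fun setT (F k)) -> (forall k x, (0 <= F k x)%E) ->
  measurable_fun setT (fun x => atom_sum (F ^~ x)).
Proof.
move=> mF F0; apply: emeasurable_funD.
  by apply: emeasurable_sum => k.
by apply: ge0_emeasurable_sum.
Qed.

(** * Laplace functionals of completely random measures *)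

Section crm_laplace.
Context (R : realType) d (Omega : measurableType d) (P : probability Omega R)
  dPsi (Psi : measurableType dPsi) (K : nat) (psi_fix : 'I_K -> Psi)
  (rho : {measure set (R * Psi) -> \bar R})
  (theta : 'I_K + nat -> {RV P >-> R}) (psi : 'I_K + nat -> {RV P >-> Psi}).

Hypothesis fix_loc : forall k w, psi (inl k) w = psi_fix k.
Hypothesis fix_ind : mutually_independent P (fun k : 'I_K =>
  preimage_set_system [set: Omega] (theta (inl k)) measurable).
Hypothesis ord_ppp : poisson_point_process P rho
  (fun k w => (theta (inr k) w, psi (inr k) w)).
Hypothesis fix_ord : independent2 P
  (sigma_of [set: 'I_K] (fun k => theta (inl k)))
  (sigma_of measurable (fun (A : set (R * Psi)) w =>
    point_count R (fun k => (theta (inr k) w, psi (inr k) w)) A)).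

Let z k w := (theta k w, psi k w).

Lemma measurable_atom k : measurable_fun setT (z k).
Proof. by apply: measurable_fun_pair. Qed.

(** The fixed and the ordinary component are independent, as are the fixed weights;
    the ordinary component contributes the exponential of [ppp_laplace]. *)
Theorem crm_laplace (f : 'I_K + nat -> R * Psi -> R) (g : R * Psi -> R) :
  (forall k, measurable_fun setT (f k)) -> (forall k s, 0 <= f k s) ->
  (forall j, f (inr j) = g) ->
  \int[P]_w eN (atom_sum (fun k => (f k (z k w))%:E)) =
  \prod_(k < K) \int[P]_w expR (- f (inl k) (theta (inl k) w, psi_fix k)) *
  eN (\int[rho]_s (1 - expR (- g s))%:E)%E.
Proof.
move=> mf f0 fg.
have mg : measurable_fun setT g by rewrite -(fg 0).
have g0 s : 0 <= g s by rewrite -(fg 0).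
pose F := \bigcup_(i in [set: 'I_K]) preimage_set_system [set: Omega]
  (theta (inl i)) (measurable : set (set R)).
pose G := \bigcup_(A in (measurable : set (set (R * Psi))))
  preimage_set_system [set: Omega]
   (fun w => point_count R (fun k => (theta (inr k) w, psi (inr k) w)) A) (measurable : set (set (\bar R))).
have mpc A : measurable A -> measurable_fun setT
   (fun w => point_count R (fun k => (theta (inr k) w, psi (inr k) w)) A).
  move=> mA; under eq_fun do rewrite point_countE.
  by apply: measurable_point_measure => // k; exact: measurable_atom.
have sF : <<s F >> `<=` measurable.
  apply: smallest_sub; first exact: sigma_algebra_measurable.
  by move=> _ [k _ [A mA <-]]; exact: measurable_funP.
have sG : <<s G >> `<=` measurable.
  apply: smallest_sub; first exact: sigma_algebra_measurable.
  by move=> _ [A mA [B mB <-]]; exact: mpc.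
pose Y (w : g_sigma_algebraType F) := \prod_(k < K) expR (- f (inl k) (theta (inl k) w, psi_fix k)).
pose Z (w : g_sigma_algebraType G) := eN (\sum_(j <oo) (g (z (inr j) w))%:E)%E.
have msec k : measurable_fun setT (fun t : R => f (inl k) (t, psi_fix k)).
  apply: (measurableT_comp (mf (inl k))).
  by apply: measurable_fun_pair; [exact: measurable_id|exact: measurable_cst].
have mthetaF k : measurable_fun setT (theta (inl k) : g_sigma_algebraType F -> R).
  move=> _ A mA; apply: sub_sigma_algebra; exists k => //; exists A => //.
have mY : measurable_fun setT Y.
  apply: measurable_prod => k _; apply: measurable_expRN.
  exact: (measurableT_comp (msec k) (mthetaF k)).
have e01 (y : R) : 0 <= y -> 0 <= expR (- y) <= 1.
  by move=> y0; rewrite expR_ge0 expR_le1 oppr_le0.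
have Y01 w : 0 <= Y w <= 1.
  by apply: prod01 => k; exact: e01.
have mZ : measurable_fun setT Z.
  apply: (@measurableT_comp _ _ _ _ _ _ (@eN R)); first exact: measurable_eN.
  have mEg : measurable_fun setT (fun s => (g s)%:E) by apply/measurable_EFinP.
  have Eg0 s : (0 <= (g s)%:E)%E by rewrite lee_fin.
  have := @measurable_fun_integral_kernel _ _ (g_sigma_algebraType G) (R * Psi)%type R
    (fun w => point_measure R (fun j => z (inr j) w)) _ (fun s => (g s)%:E) Eg0 mEg.
  rewrite (_ : (fun w => \int[_]_y _)%E = (fun w => \sum_(j <oo) (g (z (inr j) w))%:E)%E).
    apply=> A mA _ B mB; apply: sub_sigma_algebra; exists A => //; exists B => //.
    by congr (_ `&` _); apply/seteqP; split => w /=; rewrite point_countE.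
  by apply/funext => w; rewrite integral_point_measure.
have Z01 w : 0 <= Z w <= 1.
  by rewrite eN_ge0 eN_le1// nneseries_ge0// => j _ _; rewrite lee_fin.
transitivity (\int[P]_w (Y w * Z w)).
  apply: eq_Rintegral => w _; rewrite eN_atom_sum; last by move=> k; rewrite lee_fin.
  congr (_ * _).
    by apply: eq_bigr => k _; rewrite /z fix_loc.
  by congr eN; apply: eq_eseriesr => j _; rewrite fg.
rewrite (indep2_prod sF sG fix_ord mY Y01 mZ Z01); congr (_ * _).
  rewrite (indep_prod (Y := fun k => theta (inl k)) (g := fun k t => expR (- f (inl k) (t, psi_fix k))))//.
  - by move=> k; apply: measurable_expRN.
  - by move=> k t; exact: e01.
  - exact: index_enum_uniq.
rewrite -(ppp_laplace _ ord_ppp)// => k; exact: measurable_atom.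
Qed.

End crm_laplace.

Section marks.
Context (R : realType) d (Omega : measurableType d) (P : probability Omega R)
  dPsi (Psi : measurableType dPsi) (K : nat)
  (theta : 'I_K + nat -> {RV P >-> R}) (psi : 'I_K + nat -> {RV P >-> Psi})
  (x : 'I_K + nat -> {RV P >-> bool}).
Hypothesis theta_gt0 : forall k w, 0 < theta k w.
Hypothesis marks : odds_bernoulli_marks theta psi x.

Local Notation I := ('I_K + nat)%type.
Let z k w := (theta k w, psi k w).
Let F := \bigcup_(k in [set: I]) preimage_set_system [set: Omega] (z k) (measurable : set (set (R * Psi))).

Let mz k : measurable_fun setT (z k).
Proof. by apply: measurable_fun_pair. Qed.

Let sF : <<s F >> `<=` measurable.
Proof.
apply: smallest_sub; first exact: sigma_algebra_measurable.
by move=> _ [k _ [A mA <-]]; exact: mz.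
Qed.

Let mid : measurable_fun setT (id : Omega -> g_sigma_algebraType F).
Proof. by move=> _ A mA; rewrite setTI; exact: sF. Qed.

Let mzF k : measurable_fun setT (z k : g_sigma_algebraType F -> R * Psi).
Proof. by move=> _ A mA; apply: sub_sigma_algebra; exists k => //; exists A. Qed.

Let xind k (e : bool) w : R := (x k w == e)%:R.

Let bxind k e : bmeas (xind k e).
Proof.
rewrite /xind (_ : (fun w => _) = \1_(x k @^-1` [set e])).
  by apply: bmeas_indic; rewrite -[X in measurable X]setTI; exact: measurable_funPT.
apply/funext => w; rewrite indicE; case: eqP => xe; [rewrite mem_set//|rewrite memNset//].
Qed.

Let bpmf k e : bmeas (fun w => odds_bernoulli_pmf e (theta k w)).
Proof.
apply: bmeas01 => [|w]; last exact: pmf01.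
exact: (measurableT_comp (measurable_pmf e) (measurable_funPT (theta k))).
Qed.

Let marks0 (s : seq I) (e : I -> bool) (Y : g_sigma_algebraType F -> R) : uniq s ->
  measurable_fun setT Y -> (forall w, 0 <= Y w <= 1) ->
  \int[P]_w (Y w * \prod_(k <- s) xind k (e k) w) =
  \int[P]_w (Y w * \prod_(k <- s) odds_bernoulli_pmf (e k) (theta k w)).
Proof.
move=> us mY Y01.
have b1 : bmeas (fun w => \prod_(k <- s) xind k (e k) w).
  by apply: bmeas_prod => k; exact: bxind.
have b2 : bmeas (fun w => \prod_(k <- s) odds_bernoulli_pmf (e k) (theta k w)).
  by apply: bmeas_prod => k; exact: bpmf.
apply: (bfun_ext_measurable (bfun_E P mid b1) (bfun_E P mid b2) mY Y01) => E mE.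
have mE' : measurable (E : set Omega) := sF mE.
have mS : measurable [set w | forall k, k \in s -> x k w = e k].
  rewrite (_ : mkset _ = \bigcap_(k in [set` s]) (x k @^-1` [set e k])); last by apply/seteqP; split.
  apply: fin_bigcap_measurable => // k _.
  by rewrite -[X in measurable X]setTI; exact: measurable_funPT.
have H := marks e us mE.
apply: EFin_inj; rewrite -[RHS]E_EFin; last by apply: bmeasM => //; exact: bmeas_indic.
transitivity (\int[P]_(w in E) (\prod_(k <- s) odds_bernoulli_pmf (e k) (theta k w))%:E)%E; last first.
  rewrite integral_mkcond; apply: eq_integral => w _.
  rewrite patchE indicE; case: ifP => wE /=; rewrite ?mul1r ?mul0r//.
rewrite -H -[RHS]fineK ?fin_num_measure//; last exact: measurableI.
congr EFin; rewrite -E_indic; last exact: measurableI.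
apply: eq_Rintegral => w _; rewrite !indicE in_setI -mulnb natrM -!indicE; congr (_ * _).
have -> : [set w | forall k, k \in s -> x k w = e k] = \bigcap_(k in [set` s]) (x k @^-1` [set e k]).
  by apply/seteqP; split.
rewrite -prod_indic; apply: eq_bigr => k _.
by rewrite /xind indicE; case: eqP => xe; [rewrite mem_set//|rewrite memNset//].
Qed.

(** The marks are averaged out one at a time.  The conditioning on the atoms is
    carried by the factor [Y], an arbitrary function of the atoms, into which the
    factors [G k z_k b] with a constant mark [b] are absorbed; [s2] lists the atoms
    whose mark has already been fixed to a constant. *)
Let marks_fin (G : I -> R * Psi -> bool -> R) (s : seq I) : uniq s ->
  (forall k e, measurable_fun setT (fun y => G k y e)) ->
  (forall k y e, 0 <= G k y e <= 1) ->
  \int[P]_w \prod_(k <- s) G k (z k w) (x k w) =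
  \int[P]_w \prod_(k <- s) mix (theta k w) (G k (z k w) true) (G k (z k w) false).
Proof.
move=> us mG G01.
have bG k e : bmeas (fun w => G k (z k w) e).
  apply: bmeas01 => [|w]; last exact: G01.
  exact: (measurableT_comp (mG k e) (mz k)).
have bmix k : bmeas (fun w => mix (theta k w) (G k (z k w) true) (G k (z k w) false)).
  apply: bmeas01 => [|w]; last by apply: mix_ge01; exact: G01.
  by apply: measurable_mix; [|exact: (bG k true).1|exact: (bG k false).1].
have Gx k w : G k (z k w) (x k w) =
    xind k true w * G k (z k w) true + xind k false w * G k (z k w) false.
  by rewrite /xind; case: (x k w); rewrite /= ?mul1r ?mul0r ?addr0 ?add0r.
have bGx k : bmeas (fun w => G k (z k w) (x k w)).
  under eq_fun do rewrite Gx -[X in X + _]mul1r.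
  by apply: bmeas_lin; apply: bmeasM.
suff claim s1 : forall s2 (e : I -> bool) (Y : g_sigma_algebraType F -> R), uniq (s1 ++ s2) ->
    measurable_fun setT Y -> (forall w, 0 <= Y w <= 1) ->
    \int[P]_w (Y w * (\prod_(k <- s1) G k (z k w) (x k w) * \prod_(k <- s2) xind k (e k) w)) =
    \int[P]_w (Y w * (\prod_(k <- s1) mix (theta k w) (G k (z k w) true) (G k (z k w) false) *
       \prod_(k <- s2) odds_bernoulli_pmf (e k) (theta k w))).
  have us0 : uniq (s ++ [::]) by rewrite cats0.
  have h01 (w : g_sigma_algebraType F) : 0 <= (1 : R) <= 1 by rewrite ler01 lexx.
  have H := claim s [::] (fun=> true) (fun=> 1) us0 (measurable_cst _) h01.
  transitivity (\int[P]_w (1 * (\prod_(k <- s) G k (z k w) (x k w) * \prod_(k <- [::]) xind k true w))).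
    by apply: eq_Rintegral => w _; rewrite big_nil mul1r mulr1.
  rewrite H; by apply: eq_Rintegral => w _; rewrite big_nil mul1r mulr1.
elim: s1 => [|k s1 ih] s2 e Y us' mY Y01.
  transitivity (\int[P]_w (Y w * \prod_(k <- s2) xind k (e k) w)).
    by apply: eq_Rintegral => w _; rewrite big_nil mul1r.
  rewrite marks0//; by apply: eq_Rintegral => w _; rewrite big_nil mul1r.
have /= /andP[ks us''] := us'.
have us2 : uniq (s1 ++ k :: s2).
  by rewrite -cat_rcons -cats1 -catA uniq_catCA /= ks us''.
have bY : @bmeas R d Omega Y := bmeas_compT mid (bmeas01 mY Y01).
pose ee b i := if i == k then b else e i.
have eek b : ee b k = b by rewrite /ee eqxx.
have ees2 b i : i \in s2 -> ee b i = e i.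
  move=> is2; rewrite /ee; case: eqP => // ik; move: ks.
  by rewrite mem_cat -ik is2 orbT.
have key b := ih (k :: s2) (ee b) (fun w => Y w * G k (z k w) b) us2.
have mYG b : measurable_fun setT (fun w : g_sigma_algebraType F => Y w * G k (z k w) b).
  by apply: measurable_funM => //; exact: (measurableT_comp (mG k b) (mzF k)).
have YG01 b w : 0 <= Y w * G k (z k w) b <= 1.
  have /andP[y0 y1] := Y01 w; have /andP[g0 g1] := G01 k (z k w) b.
  by rewrite mulr_ge0//= mulr_ile1.
have {}key b := key b (mYG b) (YG01 b).
have E1 b (H : I -> bool -> Omega -> R) w :
    \prod_(i <- k :: s2) H i (ee b i) w = H k b w * \prod_(i <- s2) H i (e i) w.
  rewrite big_cons eek; congr (_ * _).
  by apply: eq_big_seq => i is2; rewrite ees2.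
pose A b (w : Omega) : R := Y w * G k (z k w) b * (\prod_(i <- s1) G i (z i w) (x i w) *
   \prod_(i <- k :: s2) xind i (ee b i) w).
pose B b (w : Omega) : R := Y w * G k (z k w) b *
  (\prod_(i <- s1) mix (theta i w) (G i (z i w) true) (G i (z i w) false) *
   \prod_(i <- k :: s2) odds_bernoulli_pmf (ee b i) (theta i w)).
have bA b : bmeas (A b).
  apply: (bmeasM (bmeasM bY (bG k b))).
  by apply: bmeasM; apply: bmeas_prod.
have bB b : bmeas (B b).
  apply: (bmeasM (bmeasM bY (bG k b))).
  by apply: bmeasM; apply: bmeas_prod.
transitivity (\int[P]_w (1 * A true w + A false w)).
  apply: eq_Rintegral => w _; rewrite big_cons Gx /A !(E1 _ xind); ring.
transitivity (\int[P]_w (1 * B true w + B false w)).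
  by rewrite !E_lin// !mul1r; congr (_ + _); exact: key.
apply: eq_Rintegral => w _; rewrite big_cons mixE// /B.
rewrite !(E1 _ (fun i b w => odds_bernoulli_pmf b (theta i w))); ring.
Qed.

(** Given the atoms the marks are independent, so each exponential may be replaced
    by its average over the mark; the finite case [marks_fin] passes to the
    limit. *)
Theorem marks_laplace (f : I -> R * Psi -> bool -> R) :
  (forall k e, measurable_fun setT (fun y => f k y e)) ->
  (forall k y e, 0 <= f k y e) ->
  \int[P]_w eN (atom_sum (fun k => (f k (z k w) (x k w))%:E)) =
  \int[P]_w eN (atom_sum (fun k => (neglog_mix (theta k w) (f k (z k w) true) (f k (z k w) false))%:E)).
Proof.
move=> mf f0.
pose J n : seq I := [seq inl k | k <- index_enum 'I_K] ++ [seq inr j | j <- index_iota 0 n].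
have uJ n : uniq (J n).
  rewrite cat_uniq !map_inj_uniq ?index_enum_uniq ?iota_uniq//=; last 2 first.
  - by move=> ? ? [].
  - by move=> ? ? [].
  by rewrite andbT; apply/hasPn => _ /mapP[j _ ->]; apply/negP => /mapP[].
have JE (H : I -> R) n : (forall k, 0 <= H k) ->
    \prod_(k <- J n) expR (- H k) =
    eN (\sum_(k < K) (H (inl k))%:E + \sum_(0 <= j < n) (H (inr j))%:E)%E.
  move=> H0; rewrite eND ?eN_sum//; first by rewrite big_cat/= !big_map.
  - by move=> i; rewrite lee_fin.
  - by move=> i; rewrite lee_fin.
  - by apply: sume_ge0 => i _; rewrite lee_fin.
  - by apply: sume_ge0 => i _; rewrite lee_fin.
have climE (H : I -> Omega -> R) : (forall k, measurable_fun setT (H k)) -> (forall k w, 0 <= H k w) ->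
    (fun n => \int[P]_w \prod_(k <- J n) expR (- H k w)) @ \oo -->
    \int[P]_w eN (atom_sum (fun k => (H k w)%:E)).
  move=> mH H0.
  have e01 k w : 0 <= expR (- H k w) <= 1 by rewrite expR_ge0 expR_le1 oppr_le0 H0.
  apply: (E_lim (M := 1)).
  - move=> n; apply: bmeas_prod => k; apply: bmeas01 => //.
    exact: measurable_expRN.
  - move=> n w; have /andP[? ?] := prod01 (J n) (fun k => e01 k w).
    by rewrite ger0_norm.
  - move=> w; under eq_fun do rewrite JE//.
    apply: eN_cvg_nd.
      by move=> n; rewrite adde_ge0// sume_ge0// => i _; rewrite lee_fin.
    apply: cvgeD.
    + by rewrite ge0_adde_def// inE ?sume_ge0 ?nneseries_ge0// => *; rewrite lee_fin.
    + exact: cvg_cst.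
    + by apply: is_cvg_nneseries => *; rewrite lee_fin.
pose H1 k w := f k (z k w) (x k w).
pose H2 k w := neglog_mix (theta k w) (f k (z k w) true) (f k (z k w) false).
have m1 k : measurable_fun setT (H1 k).
  rewrite (_ : H1 k = (fun w => xind k true w * f k (z k w) true + xind k false w * f k (z k w) false)); last first.
    by apply/funext => w; rewrite /H1 /xind; case: (x k w); rewrite /= ?mul1r ?mul0r ?addr0 ?add0r.
  apply: measurable_funD; apply: measurable_funM.
  - exact: (bxind k true).1.
  - exact: (measurableT_comp (mf k true) (mz k)).
  - exact: (bxind k false).1.
  - exact: (measurableT_comp (mf k false) (mz k)).
have m2 k : measurable_fun setT (H2 k).
  apply: measurable_neglog_mix => //.
  + exact: (measurableT_comp (mf k true) (mz k)).
  + exact: (measurableT_comp (mf k false) (mz k)).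
have h1 := climE H1 m1 (fun k w => f0 _ _ _).
have h2 := climE H2 m2 (fun k w => neglog_mix_ge0 _ (f0 _ _ _) (f0 _ _ _)).
have E n : \int[P]_w \prod_(k <- J n) expR (- H1 k w) = \int[P]_w \prod_(k <- J n) expR (- H2 k w).
  rewrite (marks_fin (G := fun k y e => expR (- f k y e)))//.
  - by apply: eq_Rintegral => w _; apply: eq_bigr => k _; rewrite expR_neglog_mix.
  - by move=> k e; exact: measurable_expRN.
  - by move=> k y e; rewrite expR_ge0 expR_le1 oppr_le0 f0.
rewrite (funext E) in h1.
exact: (cvg_unique (@Rhausdorff R) h1 h2).
Qed.

End marks.

(** * The beta integral *)

Section scaling.
Context (R : realType).
Local Notation mu := (@lebesgue_measure R).
Local Open Scope ereal_scope.

Section pack.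
Variables (k : R).
Hypothesis k0 : (0 < k)%R.

Let phi (t : measurableTypeR R) : measurableTypeR R := (k * t)%R.
Let mphi : measurable_fun setT phi.
Proof. exact: measurable_funM. Qed.

Let knng : {nonneg R} := NngNum (ltW k0).

Let lebesgue_scale (A : set R) : measurable A ->
  mu A = k%:E * mu (phi @^-1` A).
Proof.
move=> mA.
pose m0 : {measure set (measurableTypeR R) -> \bar R} := mscale knng (pushforward mu phi).
pose m := m0 mphi.
rewrite (_ : k%:E * mu (phi @^-1` A) = m A)//.
apply: lebesgue_measure_unique => //= _ [[a b]] _ <-.
rewrite /mscale /= /pushforward /=.
have -> : phi @^-1` `]a, b]%classic = `](a / k)%R, (b / k)%R]%classic.
  apply/seteqP; split => t /=; rewrite !in_itv/= => /andP[ta tb].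
    by rewrite ltr_pdivrMr// ler_pdivlMr// mulrC ta tb.
  by rewrite /phi mulrC -ltr_pdivrMr// -ler_pdivlMr// ta tb.
rewrite !lebesgue_measure_itv/= !lte_fin ltr_pM2r ?invr_gt0//.
case: ifPn => _; last by rewrite mule0.
by rewrite -!EFinB -EFinM -mulrBl mulrCA divff ?mulr1// gt_eqF.
Qed.

Lemma integral_scale (f : R -> \bar R) : measurable_fun setT f -> (forall t, 0 <= f t) ->
  \int[mu]_(t in `]0%R, +oo[) f t = k%:E * \int[mu]_(t in `]0%R, +oo[) f (k * t)%R.
Proof.
move=> mf f0.
pose g := f \_ `]0%R, +oo[%classic.
have mg : measurable_fun setT g.
  by apply/(measurable_restrictT f) => //; exact: measurable_funS mf.
have g0 t : 0 <= g t by apply: erestrict_ge0.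
pose m0 : {measure set (measurableTypeR R) -> \bar R} := mscale knng (pushforward mu phi).
pose m := m0 mphi.
rewrite integral_mkcond -/g.
transitivity (\int[m]_t g t).
  by apply: eq_measure_integral => /= A mA _; rewrite lebesgue_scale.
rewrite ge0_integral_mscale//=; congr (_ * _).
rewrite ge0_integral_pushforward//=.
rewrite [RHS]integral_mkcond; apply: eq_integral => t _ /=.
rewrite /g !patchE /phi; congr (if _ then _ else _).
apply/idP/idP; rewrite !inE/= !in_itv/= !andbT.
  by rewrite pmulr_rgt0.
by move=> t0; rewrite mulr_gt0.
Qed.

End pack.
End scaling.

Section gamma.
Context (R : realType).
Local Notation mu := (@lebesgue_measure R).
Local Notation D := (`]0%R, +oo[%classic : set R).
Local Open Scope ereal_scope.

(** The integral behind [Gamma], before its conversion to a real number. *)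
Definition eGamma (a : R) : \bar R := \int[mu]_(t in D) (t `^ (a - 1) * expR (- t))%:E.

Let mgam (a : R) : measurable_fun setT (fun t : R => (t `^ (a - 1) * expR (- t))%R).
Proof.
apply: measurable_funM; first exact: measurable_powR.
by apply: (measurableT_comp (@measurable_expR R)); exact: oppr_measurable.
Qed.

Let gam_ge0 (a t : R) : 0 <= (t `^ (a - 1) * expR (- t))%:E.
Proof. by rewrite lee_fin mulr_ge0 ?powR_ge0 ?expR_ge0. Qed.

Let mgamD (a : R) (E : set R) :
  measurable_fun E (fun t : R => (t `^ (a - 1) * expR (- t))%:E).
Proof. by apply: measurable_funTS; apply/measurable_EFinP; exact: (mgam a). Qed.

Let mrestr (E : set R) (f : R -> \bar R) : measurable E ->
  measurable_fun setT f -> measurable_fun setT (f \_ E).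
Proof.
by move=> mE mf; apply/(measurable_restrictT f) => //; exact: measurable_funS mf.
Qed.

Let mpow (a : R) : measurable_fun setT (fun t : R => (t `^ (a - 1))%:E).
Proof. by apply/measurable_EFinP; exact: measurable_powR. Qed.

(** The fundamental theorem of calculus on [[1 / (n + 2), 1]], then monotone
    convergence. *)
Lemma pow_int01 (a : R) : (0 < a)%R ->
  \int[mu]_(t in `]0%R, 1%R]) (t `^ (a - 1))%:E <= (a^-1)%:E.
Proof.
move=> a0.
pose F n : set R := `[(n.+2%:R^-1)%R, 1%R]%classic.
have -> : `]0%R, 1%R]%classic = \bigcup_n F n.
  apply/seteqP; split => t /=.
    rewrite in_itv/= => /andP[t0 t1].
    have [n nt] : exists n, (t^-1 < n.+2%:R)%R.
      exists (Num.truncn t^-1); apply: lt_trans (truncnS_gt _) _.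
      by rewrite ltr_nat.
    exists n => //; rewrite /F/= in_itv/= t1 andbT.
    by rewrite -[leRHS]invrK lef_pV2 ?posrE ?invr_gt0// ltW.
  by move=> [n _]; rewrite /F/= !in_itv/= => /andP[h ->]; rewrite andbT (lt_le_trans _ h).
have ndF : nondecreasing_seq F.
  move=> m n mn; apply/subsetPset => t; rewrite /F/= !in_itv/= => /andP[h ->].
  by rewrite andbT (le_trans _ h)// lef_pV2 ?posrE// ler_nat !ltnS.
have H : \int[mu]_(t in F n) (t `^ (a - 1))%:E @[n --> \oo] -->
    \int[mu]_(t in \bigcup_n F n) (t `^ (a - 1))%:E.
  apply: ge0_nondecreasing_set_cvg_integral => //.
  - by move=> i; exact: measurable_itv.
  - by move=> i; apply: measurable_funTS; exact: mpow.
  - by move=> i t _; rewrite lee_fin powR_ge0.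
rewrite -(cvg_lim _ H)//; apply: lime_le; first by apply/cvg_ex; eexists; exact: H.
apply: nearW => n; rewrite /F.
pose e : R := (n.+2%:R^-1)%R.
have e0 : (0 < e)%R by rewrite invr_gt0 ltr0n.
have e1 : (e < 1)%R by rewrite invf_lt1// ltr1n.
have cpow (p x : R) : (0 < x)%R -> {for x, continuous (@powR R ^~ p)}.
  move=> x0; apply: differentiable_continuous; apply/derivable1_diffP.
  by apply: derivable_powR; rewrite in_itv/= x0.
rewrite (@continuous_FTC2 _ _ (fun t => a^-1 * t `^ a)%R)//.
- rewrite powR1 mulr1 leeBlDr// leeDl// lee_fin mulr_ge0 ?powR_ge0// invr_ge0 ltW//.
- apply: continuous_in_subspaceT => x; rewrite inE/= in_itv/= => /andP[ex _].
  by apply: cpow; exact: lt_le_trans ex.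
- split.
  + move=> x; rewrite in_itv/= => /andP[ex _].
    apply: derivableM => //; apply: derivable_powR; rewrite in_itv/= andbT.
    exact: lt_trans ex.
  + apply: cvg_at_right_filter; apply: cvgMr; exact: cpow.
  + apply: cvg_at_left_filter; apply: cvgMr; exact: cpow.
- move=> x; rewrite in_itv/= => /andP[ex _].
  have x0 : (0 < x)%R by exact: lt_trans ex.
  rewrite derive1E deriveM//; last by apply: derivable_powR; rewrite in_itv/= x0.
  rewrite derive_cst scaler0 addr0 -derive1E powR_derive1 ?in_itv/= ?x0//.
  by rewrite /GRing.scale/= mulrA mulVf ?mul1r// gt_eqF.
Qed.

(** With [m >= a - 1], the power is at most [t ^ m], which a multiple of
    [exp (t / 2)] dominates.  What is left is a multiple of an exponential density
    of rate 1/2. *)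
Let exp_bound (a : R) : exists2 C : R, (0 <= C)%R &
  (forall t, 1 <= t -> t `^ (a - 1) * expR (- t) <= C * expR (- (2^-1 * t)))%R.
Proof.
pose m := (Num.truncn `|a - 1|%R).+1.
exists (2 ^+ m * m`!%:R)%R; first by rewrite mulr_ge0// exprn_ge0.
move=> t t1; have t0 : (0 <= t)%R by exact: le_trans t1.
have am : (a - 1 <= m%:R)%R.
  by rewrite (le_trans (ler_norm _))// ltW// truncnS_gt.
have h1 : (t `^ (a - 1) <= t ^+ m)%R.
  by rewrite -powR_mulrn// ler_powR.
have h2 : (t ^+ m <= 2 ^+ m * m`!%:R * expR (2^-1 * t))%R.
  have := @expR_ge1Dxn R (2^-1 * t) (Num.truncn `|a - 1|%R).
  rewrite -/m => /(_ _)/wrap[]; first by rewrite mulr_ge0// invr_ge0.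
  move=> h; have {h} : ((2^-1 * t) ^+ m / m`!%:R <= expR (2^-1 * t))%R.
    by apply: le_trans h; rewrite lerDr.
  rewrite ler_pdivrMr ?ltr0n ?fact_gt0// exprMn exprVn.
  by rewrite ler_pdivrMl ?exprn_gt0// mulrA mulrAC.
have -> : (expR (- t) = expR (- (2^-1 * t)) * expR (- (2^-1 * t)))%R.
  by rewrite -expRD; congr expR; lra.
rewrite mulrA ler_wpM2r ?expR_ge0//.
rewrite -[leRHS](mulfK (lt0r_neq0 (expR_gt0 (2^-1 * t)))) -expRN.
rewrite ler_wpM2r ?expR_ge0//; exact: le_trans h1 h2.
Qed.

Lemma eGamma_lty (a : R) : (0 < a)%R -> eGamma a < +oo.
Proof.
move=> a0; rewrite /eGamma.
have -> : D = `]0%R, 1%R]%classic `|` `]1%R, +oo[%classic.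
  by rewrite -itv_bndbnd_setU// bnd_simp.
rewrite ge0_integral_setU//=; last 2 first.
- exact: (mgamD a).
- apply/disj_setPS => t [] /=; rewrite !in_itv/= => /andP[_ t1].
  by rewrite andbT ltNge t1.
apply: lte_add_pinfty.
  apply: (@le_lt_trans _ _ (a^-1)%:E); last exact: ltry.
  apply: le_trans (pow_int01 a0); apply: ge0_le_integral => //.
  - exact: mgamD.
  - by apply: measurable_funTS; exact: (mpow a).
  - move=> t; rewrite /= in_itv/= => /andP[t0 _].
    by rewrite lee_fin ler_piMr ?powR_ge0// expR_le1 oppr_le0 ltW.
have [C C0 Ct] := exp_bound a.
apply: (@le_lt_trans _ _ (\int[mu]_t ((2 * C)%:E * (exponential_pdf 2^-1 t)%:E))); last first.
  rewrite ge0_integralZl//.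
  - by rewrite integral_exponential_pdf ?invr_gt0// mule1 ltry.
  - by apply/measurable_EFinP; exact: measurable_exponential_pdf.
  - by move=> t _; rewrite lee_fin exponential_pdf_ge0// invr_ge0.
  - by rewrite lee_fin mulr_ge0.
rewrite integral_mkcond; apply: ge0_le_integral => //.
- by move=> t _; apply: erestrict_ge0 => ? _; exact: gam_ge0.
- apply: mrestr => //; exact: mgamD.
- apply: measurable_funeM; apply/measurable_EFinP; exact: measurable_exponential_pdf.
- move=> t _; rewrite patchE; case: ifPn => [|_]; last first.
    by rewrite -EFinM lee_fin !mulr_ge0// exponential_pdf_ge0// invr_ge0.
  rewrite inE/= in_itv/= andbT => t1; rewrite -EFinM lee_fin.
  rewrite exponential_pdfE; last by rewrite ltW// (lt_trans _ t1).
  rewrite mulNr mulrA (_ : 2 * C * 2^-1 = C)%R; last by field.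
  by apply: Ct; exact: ltW.
Qed.

Lemma eGamma_gt0 (a : R) : 0 < eGamma a.
Proof.
(* a lower bound of the integrand on [[1, 2]], whatever the sign of [a - 1] *)
pose c : R := (Num.min 1 (2 `^ (a - 1)) * expR (- 2))%R.
have c0 : (0 < c)%R by rewrite mulr_gt0 ?expR_gt0// lt_min ltr01 powR_gt0.
apply: (@lt_le_trans _ _ (\int[mu]_(t in `[1%R, 2%R]) (cst c%:E t))).
  rewrite integral_cst//= lebesgue_measure_itv/= lte_fin ltr1n.
  by rewrite -EFinB -EFinM lte_fin mulr_gt0// subr_gt0 ltr1n.
apply: (@le_trans _ _ (\int[mu]_(t in `[1%R, 2%R]) (t `^ (a - 1) * expR (- t))%:E)).
  apply: ge0_le_integral => //.
  - by move=> t _; rewrite lee_fin ltW.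
  - exact: mgamD.
  - move=> t; rewrite /= in_itv/= => /andP[t1 t2]; rewrite lee_fin.
    apply: ler_pM; rewrite ?expR_ge0 ?ler_expR ?lerN2//.
    have [a1|a1] := leP 0%R (a - 1)%R.
      by rewrite ge_min -[X in (X <= _)%R](powRr0 t) ler_powR.
    rewrite ge_min; apply/orP; right.
    have -> : (a - 1 = - (1 - a))%R by ring.
    rewrite !powRN lef_pV2 ?posrE ?powR_gt0//; last exact: lt_le_trans t1.
    have a1' : (0 <= 1 - a)%R by lra.
    by apply: (ge0_ler_powR a1') => //; rewrite nnegrE ?ler0n//; exact: le_trans t1.
apply: ge0_subset_integral => //.
- exact: mgamD.
- by move=> t; rewrite /= !in_itv/= andbT => /andP[t1 _]; exact: lt_le_trans t1.
Qed.

Lemma Gamma_gt0 (a : R) : (0 < a)%R -> (0 < Gamma a)%R.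
Proof. by move=> a0; apply: fine_gt0; rewrite eGamma_gt0 eGamma_lty. Qed.

Lemma eGammaE (a : R) : (0 < a)%R -> eGamma a = (Gamma a)%:E.
Proof.
move=> a0; rewrite [in RHS]/Gamma /Rintegral fineK//.
by rewrite ge0_fin_numE ?eGamma_lty// ltW// eGamma_gt0.
Qed.

Lemma eGamma_scale (c k : R) : (0 < k)%R ->
  \int[mu]_(t in D) (t `^ (c - 1) * expR (- (k * t)))%:E = (k `^ (- c))%:E * eGamma c.
Proof.
move=> k0; have k0' := ltW k0.
pose J := \int[mu]_(t in D) (t `^ (c - 1) * expR (- (k * t)))%:E.
have E2 : \int[mu]_(t in D) ((k * t) `^ (c - 1) * expR (- (k * t)))%:E = (k `^ (c - 1))%:E * J.
  rewrite /J -ge0_integralZl//; last 3 first.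
  - apply: measurable_funTS; apply/measurable_EFinP; apply: measurable_funM; first exact: measurable_powR.
    by apply: (measurableT_comp (@measurable_expR R)); apply: measurable_funN; exact: measurable_funM.
  - by move=> t _; rewrite lee_fin mulr_ge0 ?powR_ge0 ?expR_ge0.
  - by rewrite lee_fin powR_ge0.
  apply: eq_integral => t; rewrite inE/= in_itv/= andbT => t0.
  by rewrite -EFinM powRM ?(ltW t0)// mulrA.
have E : eGamma c = k%:E * ((k `^ (c - 1))%:E * J).
  have mg : measurable_fun setT (fun t : R => (t `^ (c - 1) * expR (- t))%:E) by exact: mgamD.
  have := integral_scale k0 mg (gam_ge0 c).
  by rewrite -/(eGamma c) => ->; rewrite -E2.
rewrite -/J E !muleA -!EFinM.
rewrite (_ : _ * _ * _ = 1)%R ?mul1e// -{2}(powRr1 k0').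
by rewrite -!powRD ?(gt_eqF k0) ?implybT// (_ : _ + _ = 0)%R ?powRr0//; lra.
Qed.

Let divE (J : \bar R) (A B C : R) : (0 < C)%R ->
  J * C%:E = B%:E * A%:E -> J = (A * B / C)%:E.
Proof.
move=> C0 E; transitivity (J * C%:E * (C^-1)%:E).
  by rewrite -muleA -EFinM divff ?mule1// gt_eqF.
by rewrite E -!EFinM (mulrC B).
Qed.

(** The theorem of Tonelli for [t ^ (a-1) * u ^ (a+b-1) * exp (- (1 + t) * u)]: the
    integral in [u] gives a factor [Gamma (a + b)], the integral in [t] gives
    [Gamma a] and leaves the integrand of [Gamma b]. *)
Theorem beta_integral (a b : R) : (0 < a)%R -> (0 < b)%R ->
  \int[mu]_(t in D) (t `^ (a - 1) * (1 + t) `^ (- (a + b)))%:E =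
  (Gamma a * Gamma b / Gamma (a + b))%:E.
Proof.
move=> a0 b0; have c0 : (0 < a + b)%R by rewrite addr_gt0.
pose h (z : R * R) : R := (\1_D z.1 * \1_D z.2 *
  (z.1 `^ (a - 1) * (z.2 `^ (a + b - 1) * expR (- ((1 + z.1) * z.2)))))%R.
have mfst : measurable_fun setT (@fst R R) by exact: measurable_fst.
have msnd : measurable_fun setT (@snd R R) by exact: measurable_snd.
have mD : measurable_fun setT (\1_D : R -> R) by exact: measurable_indic.
have mh : measurable_fun setT h.
  apply: measurable_funM.
    by apply: measurable_funM; [exact: (measurableT_comp mD mfst)|exact: (measurableT_comp mD msnd)].
  apply: measurable_funM.
    exact: (measurableT_comp (measurable_powR (a - 1)) mfst).
  apply: measurable_funM.
    exact: (measurableT_comp (measurable_powR (a + b - 1)) msnd).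
  apply: (measurableT_comp (@measurable_expR R)); apply: measurable_funN.
  by apply: measurable_funM => //; exact: measurable_funD.
have h0 z : 0 <= (h z)%:E.
  by rewrite lee_fin !mulr_ge0 ?powR_ge0 ?expR_ge0 ?indicE ?ler0n.
have := @fubini_tonelli _ _ _ _ R mu mu (fun z => (h z)%:E) _ h0.
have inner1 t : \int[mu]_u (h (t, u))%:E =
    (((fun t => (t `^ (a - 1) * (1 + t) `^ (- (a + b)))%:E) \_ D) t) * eGamma (a + b).
  rewrite patchE; case: ifPn => tD; last first.
    rewrite mul0e integral0_eq// => u _.
    by rewrite /h/= !indicE (negbTE tD) !mul0r.
  have t0 : (0 < 1 + t)%R.
    by move: tD; rewrite inE/= in_itv/= andbT => ?; rewrite addr_gt0.
  rewrite EFinM -muleA -(eGamma_scale (a + b) t0) -ge0_integralZl//; last 3 first.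
  - apply/measurable_funTS/measurable_EFinP; apply: measurable_funM; first exact: measurable_powR.
    by apply: (measurableT_comp (@measurable_expR R)); apply: measurable_funN; exact: measurable_funM.
  - by move=> u _; rewrite lee_fin mulr_ge0 ?powR_ge0 ?expR_ge0.
  - by rewrite lee_fin powR_ge0.
  rewrite [RHS]integral_mkcond; apply: eq_integral => u _.
  rewrite /h/= patchE !indicE tD mul1r.
  by case: ifP => uD; rewrite ?mul1r ?mul0r.
have inner2 u : \int[mu]_t (h (t, u))%:E =
    (((fun u => (u `^ (b - 1) * expR (- u))%:E) \_ D) u) * eGamma a.
  rewrite patchE; case: ifPn => uD; last first.
    rewrite mul0e integral0_eq// => t _.
    by rewrite /h/= !indicE (negbTE uD) mulr0 !mul0r.
  have u0 : (0 < u)%R by move: uD; rewrite inE/= in_itv/= andbT.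
  have -> : (u `^ (b - 1) * expR (- u) = (u `^ (a + b - 1) * expR (- u)) * u `^ (- a))%R.
    rewrite mulrAC -powRD; last by rewrite (gt_eqF u0) implybT.
    by congr (_ `^ _ * _)%R; ring.
  rewrite EFinM -muleA -(eGamma_scale a u0) -ge0_integralZl//; last 2 first.
  - apply/measurable_funTS/measurable_EFinP; apply: measurable_funM; first exact: measurable_powR.
    by apply: (measurableT_comp (@measurable_expR R)); apply: measurable_funN; exact: measurable_funM.
  - by move=> t _; rewrite lee_fin mulr_ge0 ?powR_ge0 ?expR_ge0.
  rewrite [RHS]integral_mkcond; apply: eq_integral => t _.
  rewrite /h/= patchE !indicE uD mulr1.
  case: ifP => tD; rewrite ?mul1r ?mul0r// -EFinM; congr EFin.
  rewrite (_ : expR (- ((1 + t) * u)) = expR (- u) * expR (- (u * t)))%R; first by ring.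
  by rewrite -expRD; congr expR; ring.
move=> /(_ _)/wrap[]; first by apply/measurable_EFinP.
under eq_integral do rewrite inner1.
under [in X in _ = X]eq_integral do rewrite inner2.
have mpw (x y : R) : measurable_fun setT (fun t : R => (t `^ x * (1 + t) `^ y)%R).
  apply: measurable_funM; first exact: measurable_powR.
  apply: (measurableT_comp (measurable_powR y)); exact: measurable_funD.
pose F1 : R -> \bar R := (fun t : R => (t `^ (a - 1) * (1 + t) `^ (- (a + b)))%:E) \_ D.
pose F2 : R -> \bar R := (fun t : R => (t `^ (b - 1) * expR (- t))%:E) \_ D.
have mF1 : measurable_fun setT F1.
  by apply: mrestr => //; apply/measurable_EFinP; exact: mpw.
have mF2 : measurable_fun setT F2 by apply: mrestr => //; exact: mgamD.
have F10 t : setT t -> 0 <= F1 t.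
  by move=> _; apply: erestrict_ge0 => ? _; rewrite lee_fin mulr_ge0 ?powR_ge0.
have F20 t : setT t -> 0 <= F2 t.
  by move=> _; apply: erestrict_ge0 => ? _; exact: gam_ge0.
have E1 : \int[mu]_x (F1 x * eGamma (a + b)) = \int[mu]_x F1 x * eGamma (a + b).
  by apply: ge0_integralZr => //; rewrite ltW// eGamma_gt0.
have E2 : \int[mu]_x (F2 x * eGamma a) = \int[mu]_x F2 x * eGamma a.
  by apply: ge0_integralZr => //; rewrite ltW// eGamma_gt0.
rewrite -/F1 -/F2 E1 E2 /F1 /F2 -!integral_mkcond -/(eGamma b) !eGammaE// => E.
exact: (divE (Gamma_gt0 c0) E).
Qed.

Let divKK (A B C : R) : (0 < A)%R -> (0 < B)%R -> (0 < C)%R ->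
  (C / (A * B) * (A * B / C) = 1)%R.
Proof. by move=> A0 B0 C0; field; rewrite !gt_eqF. Qed.

Let div_ge0 (A B C : R) : (0 < A)%R -> (0 < B)%R -> (0 < C)%R -> (0 <= C / (A * B))%R.
Proof. by move=> A0 B0 C0; rewrite divr_ge0 ?mulr_ge0 ?ltW. Qed.

Lemma beta_prime_density_total (xi lambda : R) : (-1 < xi)%R -> (xi + 1 < lambda)%R ->
  \int[mu]_(t in D) (beta_prime_density xi lambda t)%:E = 1.
Proof.
move=> x1 l1; rewrite /beta_prime_density /beta_prime_shape.
have a0 : (0 < xi + 1)%R by lra.
have b0 : (0 < lambda - xi - 1)%R by lra.
have c0 : (0 < lambda)%R by lra.
have Ga := Gamma_gt0 a0; have Gb := Gamma_gt0 b0; have Gc := Gamma_gt0 c0.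
have := beta_integral a0 b0.
have -> : (xi + 1 + (lambda - xi - 1) = lambda)%R by ring.
rewrite addrK => H.
under eq_integral do rewrite EFinM.
rewrite ge0_integralZl//.
- by rewrite H -EFinM divKK.
- apply/measurable_funTS/measurable_EFinP; apply: measurable_funM; first exact: measurable_powR.
  apply: (measurableT_comp (measurable_powR (- lambda))); exact: measurable_funD.
- by move=> t _; rewrite lee_fin mulr_ge0 ?powR_ge0.
- by rewrite lee_fin; exact: div_ge0.
Qed.

End gamma.

(** * Integration against a density *)

Section density.
Context (R : realType) d (S : measurableType d).
Variables (m mu : {measure set S -> \bar R}) (g : S -> R).
Hypothesis mg : measurable_fun setT g.
Hypothesis g0 : forall s, 0 <= g s.
Hypothesis mE : forall A, measurable A -> (m A = \int[mu]_(s in A) (g s)%:E)%E.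
Import HBNNSimple.

Theorem integral_density (f : S -> R) : measurable_fun setT f -> (forall s, 0 <= f s) ->
  (\int[m]_s (f s)%:E = \int[mu]_s (f s * g s)%:E)%E.
Proof.
move=> mf f0.
have mEf : measurable_fun setT (EFin \o f) by apply/measurable_EFinP.
have Ef0 s : (0 <= (EFin \o f) s)%E by rewrite lee_fin.
pose h := nnsfun_approx measurableT mEf.
have ndh s : {homo (fun n => h n s) : m n / (m <= n)%N >-> m <= n}.
  by move=> i j ij; exact/lefP/nd_nnsfun_approx.
have hf s : (fun n => h n s) @ \oo --> f s.
  by have /fine_cvgP[] := cvg_nnsfun_approx measurableT mEf (fun x _ => Ef0 x) (x := s) I.
have H1 := @cvg_mono_integral _ _ _ m h f (fun n => measurable_funPT (h n)) (fun n s => fun_ge0 s) ndh hf.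
have H2 : (\int[mu]_s (h n s * g s)%:E @[n --> \oo] --> \int[mu]_s (f s * g s)%:E)%E.
  apply: cvg_mono_integral.
  - by move=> n; apply: measurable_funM.
  - by move=> n s; rewrite mulr_ge0.
  - by move=> s i j ij; rewrite ler_wpM2r// ndh.
  - by move=> s; apply: cvgMl; exact: hf.
suff E n : (\int[m]_s (h n s)%:E = \int[mu]_s (h n s * g s)%:E)%E.
  rewrite (funext E) in H1.
  exact: (cvg_unique (@ereal_hausdorff R) H1 H2).
have habs s : `|h n s| = h n s by rewrite ger0_norm.
under eq_integral do rewrite -habs.
rewrite (@integral_comp_nnsfun _ _ _ m (h n) (fun y => `|y|))//.
set r := finmap.enum_fset _.
have ur : uniq r by exact: finmap.fset_uniq.
transitivity (\sum_(y <- r) (`|y|%:E * \int[mu]_(s in (h n @^-1` [set y])) (g s)%:E))%E.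
  by apply: eq_bigr => y _; rewrite mE.
transitivity (\int[mu]_s \sum_(y <- r) (`|y| * (\1_(h n @^-1` [set y]) s * g s))%:E)%E; last first.
  apply: eq_integral => s _.
  have gr : h n s \in r by rewrite in_fset_set// inE; exists s.
  rewrite (bigD1_seq (h n s))//= indicE mem_set// mul1r habs big1_seq ?adde0// => y.
  move=> /andP[ygs _]; rewrite indicE memNset ?mul0r ?mulr0//=.
  by move=> E; rewrite E eqxx in ygs.
have mi y : measurable_fun setT (fun s => \1_(h n @^-1` [set y]) s * g s).
  by apply: measurable_funM.
rewrite ge0_integral_sum//.
- apply: eq_bigr => y _.
  under [RHS]eq_integral do rewrite EFinM.
  rewrite ge0_integralZl//.
  + congr (_ * _)%E; rewrite integral_mkcond; apply: eq_integral => s _.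
    by rewrite patchE indicE; case: ifP => _; rewrite ?mul1r ?mul0r.
  + by apply/measurable_EFinP.
  + by move=> s _; rewrite lee_fin mulr_ge0// indicE.
- by move=> y; apply/measurable_EFinP; exact: measurable_funM.
- by move=> y s _; rewrite lee_fin !mulr_ge0// indicE.
Qed.

End density.

(** Also of use when [phi] is the identity between two types that have the same
    points and the same measurable sets. *)
Lemma integral_density_map (R : realType) d (S : measurableType d) d' (S' : measurableType d')
    (m : {measure set S -> \bar R}) (mu : {measure set S' -> \bar R}) (phi : S -> S')
    (g f : S' -> R) :
  measurable_fun setT phi ->
  measurable_fun setT g -> (forall s, 0 <= g s) ->
  (forall A, measurable A -> m (phi @^-1` A) = \int[mu]_(s in A) (g s)%:E)%E ->
  measurable_fun setT f -> (forall s, 0 <= f s) ->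
  (\int[m]_s (f (phi s))%:E = \int[mu]_s (f s * g s)%:E)%E.
Proof.
move=> mphi mg g0 mE mf f0.
pose m' : {measure set S' -> \bar R} := pushforward m phi.
pose m'' := m' mphi.
rewrite -(@integral_density _ _ _ m'' mu g mg g0 mE f mf f0).
rewrite [RHS]ge0_integral_pushforward//; first by apply/measurable_EFinP.
by move=> y _; rewrite lee_fin.
Qed.

Lemma integral_addEFin (R : realType) d (T : measurableType d) (m : {measure set T -> \bar R})
    (f g : T -> R) : measurable_fun setT f -> measurable_fun setT g ->
  (forall s, 0 <= f s) -> (forall s, 0 <= g s) ->
  (\int[m]_s (f s + g s)%:E = \int[m]_s (f s)%:E + \int[m]_s (g s)%:E)%E.
Proof.
move=> mf mg f0 g0; under eq_integral do rewrite EFinD.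
rewrite ge0_integralD//.
- by move=> s _; rewrite lee_fin.
- exact/measurable_EFinP.
- by move=> s _; rewrite lee_fin.
- exact/measurable_EFinP.
Qed.

Lemma integral_cstM (R : realType) (c : R) (f : R -> R) : 0 <= c -> measurable_fun setT f ->
  (forall t, 0 <= f t) ->
  (\int[lebesgue_measure]_t (c * f t)%:E = c%:E * \int[lebesgue_measure]_t (f t)%:E)%E.
Proof.
move=> c0 mf f0; rewrite -ge0_integralZl//; first exact/measurable_EFinP.
by move=> t _; rewrite lee_fin.
Qed.


(** * Atomic measures and the space of measures *)

Section atomic.
Context (R : realType) (K : nat).
Local Open Scope ereal_scope.

Definition aidx (n : nat) : 'I_K + nat :=
  if insub n is Some k then inl k else inr (n - K)%N.

Let aidx_inl (k : 'I_K) : aidx k = inl k.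
Proof. by rewrite /aidx valK. Qed.

Let aidx_inr j : aidx (K + j) = inr j.
Proof. by rewrite /aidx insubN ?addKn// -leqNgt leq_addr. Qed.

Let aidx_inj : injective aidx.
Proof.
move=> i j; rewrite /aidx; case: insubP => [k _ <-|]; case: insubP => [l _ <-|] //.
- by move=> [->].
- by rewrite -!leqNgt => Kj Ki [] /(congr1 (addn K)); rewrite !subnKC.
Qed.

Lemma atom_sum_aidx (a : 'I_K + nat -> \bar R) : (forall k, 0 <= a k) ->
  \sum_(n <oo) a (aidx n) = atom_sum a.
Proof.
move=> a0; rewrite nneseries_esumT// -esum_atom_sum//.
rewrite (_ : [set: 'I_K + nat] = range aidx).
  by rewrite esum_image// => ? ? _ _ /aidx_inj.
apply/seteqP; split => // -[k|j] _; first by exists k.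
by exists (K + j)%N.
Qed.

End atomic.

Section atomic_measure.
Context (R : realType) dPsi (Psi : measurableType dPsi) (K : nat).
Local Open Scope ereal_scope.
Variables (w : 'I_K + nat -> R) (p : 'I_K + nat -> Psi).
Hypothesis w0 : forall k, (0 <= w k)%R.

Definition atomic_measure : {measure set Psi -> \bar R} :=
  mseries (fun n => mscale (NngNum (w0 (aidx K n)))
    (\d_(p (aidx K n)) : {measure set Psi -> \bar R})) 0.

Lemma atomic_measureE A : atomic_measure A =
  \esum_(k in [set: 'I_K + nat]) (w k)%:E * \d_(p k) A.
Proof.
have h0 k : 0 <= (w k)%:E * \d_(p k) A :> \bar R.
  by rewrite mule_ge0// lee_fin.
by rewrite esum_atom_sum// -atom_sum_aidx.
Qed.

Lemma integral_atomic (M : {measure set Psi -> \bar R}) (f : Psi -> R) :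
  (forall A, measurable A -> M A = \esum_(k in [set: 'I_K + nat]) (w k)%:E * \d_(p k) A) ->
  measurable_fun setT f -> (forall s, (0 <= f s)%R) ->
  \int[M]_s (f s)%:E = atom_sum (fun k => (w k * f (p k))%:E).
Proof.
move=> ME mf f0.
have mEf : measurable_fun setT (fun s => (f s)%:E) by apply/measurable_EFinP.
have Ef0 s : 0 <= (f s)%:E by rewrite lee_fin.
transitivity (\int[atomic_measure]_s (f s)%:E).
  by apply: eq_measure_integral => A mA _; rewrite ME// atomic_measureE.
rewrite ge0_integral_measure_series// -atom_sum_aidx; last first.
  by move=> k; rewrite lee_fin mulr_ge0.
apply: eq_eseriesr => n _.
by rewrite ge0_integral_mscale//= integral_dirac// diracT mul1e.
Qed.

End atomic_measure.

Section measure_space_measurable.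
Context (R : realType) dPsi (Psi : measurableType dPsi).
Local Notation MS := (measure_space R Psi).

Lemma measurable_measure_eval A : measurable A ->
  measurable_fun setT (measure_eval A : MS -> \bar R).
Proof.
by move=> mA _ V mV; apply: sub_sigma_algebra; exists A => //; exists V.
Qed.

Lemma measurable_to_measure_space d (T : measurableType d) (F : T -> MS) :
  (forall A, measurable A -> measurable_fun setT (fun t => measure_eval A (F t))) ->
  measurable_fun setT F.
Proof.
move=> h; have E : @measurable _ MS = <<s @eval_preimages R _ Psi >> by [].
apply: (measurability _ E).
move=> _ [B [A mA [V mV <-]] <-].
by rewrite !setTI; have := h A mA measurableT V mV; rewrite setTI.
Qed.

Lemma measurable_measure_integral (f : Psi -> R) :
  measurable_fun setT f -> (forall s, 0 <= f s) ->
  measurable_fun setT (fun m : MS => \int[m : {measure set Psi -> \bar R}]_s (f s)%:E)%E.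
Proof.
move=> mf f0.
apply: (@measurable_fun_integral_kernel _ _ MS Psi R
  (fun m : MS => m : {measure set Psi -> \bar R}) _ (fun s => (f s)%:E)).
- by move=> A mA; exact: measurable_measure_eval.
- by move=> s; rewrite lee_fin.
- by apply/measurable_EFinP.
Qed.

End measure_space_measurable.

(** * Laws with a given density and independent families *)

Section density_measure.
Context (R : realType) (g : R -> R).
Hypothesis mg : measurable_fun setT g.
Hypothesis g0 : forall t, 0 <= g t.
Local Open Scope ereal_scope.

Definition density_measure (A : set R) : \bar R :=
  \int[lebesgue_measure]_(t in A `&` `]0%R, +oo[%classic) (g t)%:E.

Let density_measure0 : density_measure set0 = 0.
Proof. by rewrite /density_measure set0I integral_set0. Qed.

Let density_measure_ge0 A : 0 <= density_measure A.
Proof. by apply: integral_ge0 => t _; rewrite lee_fin. Qed.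

Let density_measure_sigma : semi_sigma_additive density_measure.
Proof.
move=> F mF tF mUF; rewrite /density_measure; apply: cvg_toP.
  apply: ereal_nondecreasing_is_cvgn => m n mn.
  apply: lee_sum_nneg_natr => // k _ _; apply: integral_ge0 => t _.
  by rewrite lee_fin.
rewrite setI_bigcupl ge0_integral_bigcup//=.
- by move=> k; apply: measurableI; [exact: mF|exact: measurable_itv].
- by apply/measurable_funTS/measurable_EFinP.
- by move=> t _; rewrite lee_fin.
- exact: trivIset_setIr.
Qed.

Lemma density_probability : density_measure setT = 1 ->
  exists Q : probability R R, forall A, Q A = density_measure A.
Proof.
move=> d1.
pose m : {measure set R -> \bar R} := HB.pack density_measure
  (isMeasure.Build _ _ _ density_measure density_measure0 density_measure_ge0 density_measure_sigma).
have m1 : m setT = 1 by [].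
pose Q : probability R R := HB.pack (Measure.sort m)
  (@Measure_isProbability.Build _ _ R m m1).
by exists Q.
Qed.

End density_measure.

Section independent_family.
Context (R : realType).
Local Open Scope ereal_scope.

(** By induction on [n], a product with one more factor. *)
Lemma independent_family n (mu : 'I_n -> probability R R) :
  exists d (T : measurableType d) (Q : probability T R) (Y : 'I_n -> T -> R),
    (forall i, measurable_fun setT (Y i)) /\
    forall V : 'I_n -> set R, (forall i, measurable (V i)) ->
      Q (\bigcap_(i in [set: 'I_n]) (Y i @^-1` V i)) = \prod_(i < n) mu i (V i).
Proof.
elim: n mu => [|n ih] mu.
  exists _, unit, (\d_tt : probability _ R), (fun _ _ => 0%R).
  split => [i|V _]; first exact: measurable_cst.
  have -> : \bigcap_(i in [set: 'I_0]) ((fun=> 0%R : R) @^-1` V i) = [set: unit].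
    by apply/seteqP; split => // x _ [].
  by rewrite big_ord0; exact: probability_setT.
have [d [T [Q [Y [mY QY]]]]] := ih (fun i => mu (lift ord0 i)).
pose Z (i : 'I_n.+1) (z : R * T) : R :=
  if unlift ord0 i is Some j then Y j z.2 else z.1.
exists _, (R * T)%type, (mu ord0 \x Q), Z; split.
  move=> i; rewrite /Z; case: unliftP => [j|] _.
    exact: (measurableT_comp (mY j) measurable_snd).
  exact: measurable_fst.
move=> V mV.
rewrite (_ : \bigcap_(i in _) _ = V ord0 `*`
    \bigcap_(j in [set: 'I_n]) (Y j @^-1` V (lift ord0 j))); last first.
  apply/seteqP; split => [z h|z [h0 h] i _] /=.
    split; first by have := h ord0 I; rewrite /Z/= unlift_none.
    by move=> j _; have := h (lift ord0 j) I; rewrite /Z/= liftK.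
  by rewrite /Z; case: unliftP => [j|] -> //; exact: h.
rewrite big_ord_recl -QY//; apply: product_measure1E => //.
apply: fin_bigcap_measurable => [|j _]; first exact: finite_finset.
by rewrite -[X in measurable X]setTI; exact: mY.
Qed.

End independent_family.

(** * Renumbering the atoms with an unset mark *)

Section thinning.
Context (b : nat -> bool).

Definition unset_count (i : nat) : nat := count (fun i' => ~~ b i') (iota 0 i).

(** The default value 0 stands for the [j]-th unset index when there are at most [j]
    of them. *)
Definition kth_unset (j : nat) : nat := xget 0%N [set i | ~~ b i /\ unset_count i = j].

Lemma unset_countS i : unset_count i.+1 = (unset_count i + ~~ b i)%N.
Proof. by rewrite /unset_count -addn1 iotaD count_cat /= add0n addn0. Qed.

Lemma unset_count_le i j : (i <= j)%N -> (unset_count i <= unset_count j)%N.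
Proof. by move=> /subnKC <-; rewrite /unset_count iotaD count_cat leq_addr. Qed.

Lemma unset_count_inj i j : ~~ b i -> ~~ b j -> unset_count i = unset_count j -> i = j.
Proof.
move=> bi bj E; case: (ltngtP i j) => // ij.
- by have := unset_count_le ij; rewrite unset_countS bi E addn1 ltnn.
- by have := unset_count_le ij; rewrite unset_countS bj E addn1 ltnn.
Qed.

Lemma kth_unset_count i : ~~ b i -> kth_unset (unset_count i) = i.
Proof.
move=> bi; rewrite /kth_unset; case: xgetP => [y _ [by_ cy]|/(_ i)].
  exact: unset_count_inj.
by move=> h; exfalso; apply: h.
Qed.

Hypothesis infinite_unset : forall n, exists2 i, (n <= i)%N & ~~ b i.

Lemma kth_unsetP j : ~~ b (kth_unset j) /\ unset_count (kth_unset j) = j.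
Proof.
suff [i bi ci] : exists2 i, ~~ b i & unset_count i = j.
  by rewrite -ci kth_unset_count.
elim: j => [|j [i bi ci]].
  have [i0 _ bi0] := infinite_unset 0.
  case: (ex_minnP (ex_intro (fun i => ~~ b i) i0 bi0)) => i bi mini.
  exists i => //; rewrite /unset_count; apply/eqP; rewrite -leqn0 leqNgt -has_count.
  apply/hasPn => k; rewrite mem_iota add0n => /= ki; apply/negP => bk.
  by have := mini _ bk; rewrite leqNgt ki.
have [i0 ii0 bi0] := infinite_unset i.+1.
have ex : exists k, (i < k)%N && ~~ b k by exists i0; rewrite ii0.
case: (ex_minnP ex) => k /andP[ik bk] mink.
exists k => //; rewrite /unset_count -(subnKC ik) iotaD count_cat -/(unset_count i.+1) unset_countS bi ci add0n.
rewrite (_ : count _ _ = 0)%N ?addn0 ?addn1//.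
apply/eqP; rewrite -leqn0 leqNgt -has_count.
apply/hasPn => l; rewrite mem_iota subnKC// => /andP[il lk]; apply/negP => bl.
by have := mink l; rewrite il bl => /(_ isT); rewrite leqNgt lk.
Qed.

Lemma kth_unset_inj : injective kth_unset.
Proof. by move=> i j E; rewrite -(kth_unsetP i).2 -(kth_unsetP j).2 E. Qed.

Lemma sum_kth_unset (R : realType) (F : nat -> \bar R) : (forall i, 0 <= F i)%E ->
  (\sum_(j <oo) F (kth_unset j) = \sum_(i <oo) (if b i then 0 else F i))%E.
Proof.
move=> F0; rewrite !nneseries_esumT//; last by move=> i; case: ifP.
rewrite -(esum_image [set: nat] kth_unset); last by move=> ? ? _ _ /kth_unset_inj.
rewrite esum_mkcond; apply: eq_esum => i _.
case: (boolP (b i)) => bi.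
  rewrite memNset// => -[j _ ji]; have := (kth_unsetP j).1.
  by rewrite ji bi.
by rewrite mem_set//; exists (unset_count i) => //; exact: kth_unset_count.
Qed.

End thinning.

(** * Beta prime laws and Bernoulli marks of odds type *)

Section beta_prime_laplace.
Context (R : realType).
Local Notation mu := (@lebesgue_measure R).
Local Notation D := (`]0%R, +oo[%classic : set R).

Lemma measurable_shape (xi lambda : R) : measurable_fun setT (beta_prime_shape xi lambda).
Proof.
apply: measurable_funM; first exact: measurable_powR.
apply: (measurableT_comp (measurable_powR (- lambda))); exact: measurable_funD.
Qed.

Lemma shape_ge0 (xi lambda t : R) : 0 <= beta_prime_shape xi lambda t.
Proof. by rewrite mulr_ge0// powR_ge0. Qed.

(** The density extended by 0, to integrate over the whole line. *)
Definition bp_density (xi lam t : R) : R := beta_prime_density xi lam t * \1_D t.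

Definition bp_laplace (xi lam s : R) : R :=
  fine (\int[mu]_t (expR (- (s * `|t|)) * bp_density xi lam t)%:E)%E.

Lemma measurable_bp_density xi lam : measurable_fun setT (bp_density xi lam).
Proof.
apply: measurable_funM; last exact: measurable_indic.
by apply: measurable_funM => //; exact: measurable_shape.
Qed.

Lemma measurable_expM : measurable_fun setT (fun z : R * R => expR (- (z.1 * `|z.2|))).
Proof.
apply: measurable_expRN; apply: measurable_funM => //.
by apply: measurableT_comp => //; exact: measurable_snd.
Qed.

Lemma measurable_expM2 (s : R) : measurable_fun setT (fun t : R => expR (- (s * `|t|))).
Proof. by apply: measurable_expRN; apply: measurable_funM => //; exact: measurableT_comp. Qed.

Section params.
Variables (xi lam : R).
Hypotheses (hx : -1 < xi) (hl : xi + 1 < lam).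

Let a0 : 0 < xi + 1. Proof. by have := hx; lra. Qed.
Let b0 : 0 < lam - xi - 1. Proof. by have := hl; lra. Qed.
Let c0 : 0 < lam. Proof. by have := a0; have := hl; lra. Qed.

Lemma beta_prime_density_ge0 t : 0 <= beta_prime_density xi lam t.
Proof.
rewrite mulr_ge0 ?shape_ge0// divr_ge0 ?mulr_ge0// ltW// Gamma_gt0//.
Qed.

Lemma bp_density_ge0 t : 0 <= bp_density xi lam t.
Proof. by rewrite mulr_ge0 ?beta_prime_density_ge0// indicE. Qed.

Lemma bp_densityE A : (\int[mu]_(t in A `&` D) (beta_prime_density xi lam t)%:E =
  \int[mu]_(t in A) (bp_density xi lam t)%:E)%E.
Proof.
rewrite integral_mkcondr; apply: eq_integral => t _.
by rewrite patchE /bp_density indicE; case: ifP => _; rewrite ?mulr1 ?mulr0.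
Qed.

Section law.
Context d (T : measurableType d) (P : probability T R) (Y : T -> R).
Hypothesis mY : measurable_fun setT Y.
Hypothesis PY : forall A : set R, measurable A ->
  (P (Y @^-1` A) = \int[mu]_(t in A `&` D) (beta_prime_density xi lam t)%:E)%E.

Lemma bp_law_integral (F : R -> R) : measurable_fun setT F -> (forall t, 0 <= F t) ->
  (\int[P]_w (F (Y w))%:E = \int[mu]_t (F t * bp_density xi lam t)%:E)%E.
Proof.
move=> mF F0.
have mY' : measurable_fun setT (Y : T -> measurableTypeR R) by [].
apply: (@integral_density_map _ _ _ _ _ P mu Y (bp_density xi lam) F mY') => //.
- exact: measurable_bp_density.
- exact: bp_density_ge0.
- by move=> A mA; rewrite -bp_densityE; exact: PY.
Qed.

Lemma bp_laplaceE s : \int[P]_w expR (- (s * `|Y w|)) = bp_laplace xi lam s.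
Proof.
rewrite /Rintegral /bp_laplace; congr fine.
apply: (@bp_law_integral (fun t => expR (- (s * `|t|)))); last by move=> t; exact: expR_ge0.
exact: measurable_expM2.
Qed.

End law.

(** The real line itself carries a variable with this law, so that facts on
    expectations apply to the density. *)
Let Q_ex : exists Q : probability R R, forall A : set R, measurable A ->
  (Q A = \int[mu]_(t in A `&` D) (beta_prime_density xi lam t)%:E)%E.
Proof.
have [|||Q QE] := @density_probability R (beta_prime_density xi lam).
- by apply: measurable_funM => //; exact: measurable_shape.
- exact: beta_prime_density_ge0.
- by rewrite /density_measure setTI beta_prime_density_total.
- by exists Q => A _; rewrite QE.
Qed.

Let bexp s : 0 <= s -> bmeas (fun t : R => expR (- (s * `|t|))).
Proof.
move=> s0; apply: bmeas01; first exact: measurable_expM2.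
by move=> t; rewrite expR_ge0 expR_le1 oppr_le0 mulr_ge0.
Qed.

Lemma bp_density_integral_lin (c d s : R) : 0 <= s -> 0 <= d <= c ->
  (\int[mu]_t ((c - d * expR (- (s * `|t|))) * bp_density xi lam t)%:E =
   (c - d * bp_laplace xi lam s)%:E)%E.
Proof.
move=> s0 /andP[d0 dc]; have [Q QE] := Q_ex.
have mid : measurable_fun setT (id : R -> R) by [].
pose F (t : R) := c - d * expR (- (s * `|t|)).
have E : forall t : R, F t = - d * expR (- (s * `|t|)) + c by move=> t; rewrite /F; lra.
have bF : bmeas F.
  by rewrite (funext E); apply: bmeas_lin; [exact: bexp|exact: bmeas_cst].
have F0 t : 0 <= F t.
  rewrite /F subr_ge0 (le_trans _ dc)// ler_piMr//.
  by rewrite expR_le1 oppr_le0 mulr_ge0.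
rewrite -(@bp_law_integral _ _ Q id mid QE F bF.1 F0) E_EFin//; congr EFin.
rewrite -(@bp_laplaceE _ _ Q id mid QE) (funext E) E_lin; [|exact: bexp|exact: bmeas_cst].
by rewrite E_cst; lra.
Qed.

Lemma bp_laplace_integral s : 0 <= s ->
  (\int[mu]_t (expR (- (s * `|t|)) * bp_density xi lam t)%:E = (bp_laplace xi lam s)%:E)%E.
Proof.
move=> s0; have [Q QE] := Q_ex.
have mid : measurable_fun setT (id : R -> R) by [].
have e0 (t : R) : 0 <= expR (- (s * `|t|)) by exact: expR_ge0.
rewrite -(@bp_law_integral _ _ Q id mid QE _ (measurable_expM2 s) e0) E_EFin; last exact: bexp.
by rewrite -(@bp_laplaceE _ _ Q id mid QE).
Qed.

Lemma bp_density_total : (\int[mu]_t (bp_density xi lam t)%:E = 1)%E.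
Proof. by rewrite -bp_densityE setTI beta_prime_density_total. Qed.

(** Positivity makes it possible to take logarithms and so to write a product of
    such factors over atoms as the exponential of an integral. *)
Lemma bp_laplace_gt0_le1 s : 0 <= s -> 0 < bp_laplace xi lam s <= 1.
Proof.
move=> s0; have [Q QE] := Q_ex.
have mid : measurable_fun setT (id : R -> R) by [].
rewrite -(@bp_laplaceE _ _ Q id mid QE) -[X in _ <= X](E_cst Q 1); apply/andP; split; last first.
  apply: E_le; [exact: bexp|exact: bmeas_cst|].
  by move=> t; rewrite expR_le1 oppr_le0 mulr_ge0.
rewrite lt_neqAle E_ge0 ?andbT; last by move=> t; exact: expR_ge0.
apply/eqP => E0.
have : (\int[Q]_t `| (expR (- (s * `|t|)))%:E | = 0)%E.
  under eq_integral do rewrite gee0_abs ?lee_fin ?expR_ge0//.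
  by rewrite E_EFin; [rewrite -E0|exact: bexp].
move/ae_eq_integral_abs => /(_ measurableT) H.
have {}H := H (iffRL (measurable_EFinP _ _) (bexp s0).1).
have : \int[Q]_t (1 : R) = \int[Q]_t (0 : R).
  apply: E_ae; [exact: bmeas_cst|exact: bmeas_cst|].
  apply: filterS H => t /(_ I) [] /eqP.
  by rewrite gt_eqF// expR_gt0.
by rewrite !E_cst => /eqP; rewrite oner_eq0.
Qed.

Lemma measurable_bp_laplace : measurable_fun setT (bp_laplace xi lam).
Proof.
apply: (measurableT_comp (f := fine)) => //.
pose F (z : R * measurableTypeR R) : \bar R :=
  (expR (- (z.1 * `|z.2 : R|)) * bp_density xi lam z.2)%:E.
have mid : measurable_fun setT (id : R * measurableTypeR R -> R * R) by [].
have mF : measurable_fun setT F.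
  apply/measurable_EFinP; apply: measurable_funM.
    exact: (measurableT_comp measurable_expM mid).
  apply: (measurableT_comp (measurable_bp_density xi lam)).
  exact: (measurableT_comp measurable_snd mid).
have F0 z : (0 <= F z)%E by rewrite lee_fin mulr_ge0 ?expR_ge0 ?bp_density_ge0.
exact: (measurable_fun_fubini_tonelli_F (m2 := mu) F mF F0).
Qed.

End params.

Definition bp_norm (xi lam : R) : R := Gamma lam / (Gamma (xi + 1) * Gamma (lam - xi - 1)).

Lemma bp_norm_gt0 xi lam : -1 < xi -> xi + 1 < lam -> 0 < bp_norm xi lam.
Proof.
move=> hx hl.
have a0 : 0 < xi + 1 by lra.
have b0 : 0 < lam - xi - 1 by lra.
have c0 : 0 < lam by lra.
by rewrite divr_gt0 ?mulr_gt0 ?Gamma_gt0.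
Qed.

Lemma beta_prime_densityE xi lam t :
  beta_prime_density xi lam t = bp_norm xi lam * beta_prime_shape xi lam t.
Proof. by []. Qed.

Lemma shape_unobserved xi lam (t : R) : 0 < t ->
  beta_prime_shape xi lam t / (1 + t) = beta_prime_shape xi (lam + 1) t.
Proof.
move=> t0; have t1 : 0 < 1 + t by rewrite addr_gt0.
rewrite /beta_prime_shape -mulrA; congr (_ * _).
by rewrite opprD powRD ?(gt_eqF t1) ?implybT// powR_inv1// ltW.
Qed.

(** Together with [shape_unobserved] this is the whole algebra of conjugacy: the
    likelihood of a mark shifts the exponents of the shape. *)
Lemma shape_observed xi lam (t : R) : 0 < t ->
  t / (1 + t) * beta_prime_shape xi lam t = beta_prime_shape (xi + 1) (lam + 1) t.
Proof.
move=> t0; have t1 : 0 < 1 + t by rewrite addr_gt0.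
rewrite /beta_prime_shape.
rewrite opprD !powRD ?(gt_eqF t1) ?(gt_eqF t0) ?implybT// powR_inv1 ?(ltW t1)//.
by rewrite powRr1 ?(ltW t0)//; ring.
Qed.

Let rescale (c c' r : R) : c' != 0 -> c * r = c / c' * (c' * r).
Proof. by move=> c0; rewrite [RHS]mulrA divfK. Qed.

Lemma bp_density_observed xi lam (t : R) : -1 < xi -> xi + 1 < lam ->
  `|t| / (1 + `|t|) * bp_density xi lam t =
  bp_norm xi lam / bp_norm (xi + 1) (lam + 1) * bp_density (xi + 1) (lam + 1) t.
Proof.
move=> hx hl; rewrite /bp_density indicE; case: (boolP (t \in _)) => tD; last by rewrite !mulr0.
have t0 : 0 < t by move: tD; rewrite inE/= in_itv/= andbT.
have c0 : bp_norm (xi + 1) (lam + 1) != 0 by rewrite gt_eqF// bp_norm_gt0//; lra.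
rewrite !mulr1 !beta_prime_densityE.
rewrite gtr0_norm// -(shape_observed xi lam t0) mulrCA; exact: rescale.
Qed.

Lemma bp_density_unobserved xi lam (t : R) : -1 < xi -> xi + 1 < lam ->
  bp_density xi lam t / (1 + `|t|) = bp_norm xi lam / bp_norm xi (lam + 1) * bp_density xi (lam + 1) t.
Proof.
move=> hx hl; rewrite /bp_density indicE; case: (boolP (t \in _)) => tD; last by rewrite !mulr0 mul0r.
have t0 : 0 < t by move: tD; rewrite inE/= in_itv/= andbT.
have c0 : bp_norm xi (lam + 1) != 0 by rewrite gt_eqF// bp_norm_gt0//; lra.
rewrite !mulr1 !beta_prime_densityE.
rewrite gtr0_norm// -mulrA -(shape_unobserved xi lam t0); exact: rescale.
Qed.

(** Whatever its mark, a weight with a beta prime law keeps a law of this family;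
    [p1] and [p0] are the probabilities of the two marks. *)
Lemma bp_density_mix xi lam : -1 < xi -> xi + 1 < lam -> exists p1 p0 : R, [/\ 0 <= p1, 0 <= p0,
  (forall t, `|t| / (1 + `|t|) * bp_density xi lam t = p1 * bp_density (xi + 1) (lam + 1) t) &
  (forall t, bp_density xi lam t / (1 + `|t|) = p0 * bp_density xi (lam + 1) t)].
Proof.
move=> hx hl.
have hx1 : -1 < xi + 1 by lra.
have hl1 : xi + 1 + 1 < lam + 1 by lra.
have hl0 : xi + 1 < lam + 1 by lra.
have c0 := ltW (bp_norm_gt0 hx hl).
have c1 := ltW (bp_norm_gt0 hx1 hl1).
have c2 := ltW (bp_norm_gt0 hx hl0).
exists (bp_norm xi lam / bp_norm (xi + 1) (lam + 1)), (bp_norm xi lam / bp_norm xi (lam + 1)).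
split; [exact: (divr_ge0 c0 c1)|exact: (divr_ge0 c0 c2)| |] => t.
- exact: (bp_density_observed t hx hl).
- exact: (bp_density_unobserved t hx hl).
Qed.

(** The formula of Bayes for a weight and its mark, [u] and [v] being the functions
    of the weight that correspond to the two marks. *)
Lemma integral_mix (g g1 g0 u v : R -> R) (p1 p0 : R) :
  measurable_fun setT g1 -> measurable_fun setT g0 ->
  (forall t, 0 <= g1 t) -> (forall t, 0 <= g0 t) -> 0 <= p1 -> 0 <= p0 ->
  (forall t, `|t| / (1 + `|t|) * g t = p1 * g1 t) ->
  (forall t, g t / (1 + `|t|) = p0 * g0 t) ->
  measurable_fun setT u -> measurable_fun setT v ->
  (forall t, 0 <= u t) -> (forall t, 0 <= v t) ->
  (\int[mu]_t (mix t (u t) (v t) * g t)%:E =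
   p1%:E * (\int[mu]_t (u t * g1 t)%:E) + p0%:E * (\int[mu]_t (v t * g0 t)%:E))%E.
Proof.
move=> mg1 mg0 g1_ge0 g0_ge0 p1_ge0 p0_ge0 H1 H0 mu_ mv u0 v0.
have m1 : measurable_fun setT (fun t => u t * g1 t) by exact: measurable_funM.
have m0 : measurable_fun setT (fun t => v t * g0 t) by exact: measurable_funM.
have i1 t : 0 <= u t * g1 t by exact: mulr_ge0.
have i0 t : 0 <= v t * g0 t by exact: mulr_ge0.
rewrite -integral_cstM// -(integral_cstM p0_ge0)//.
rewrite -ge0_integralD//.
- apply: eq_integral => t _; rewrite -EFinD; apply: (f_equal EFin).
  transitivity (u t * (`|t| / (1 + `|t|) * g t) + v t * (g t / (1 + `|t|))).
    by rewrite /mix; field; rewrite gt_eqF// ?mix_den.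
  by rewrite H1 H0; congr (_ + _); exact: mulrCA.
- by move=> t _; rewrite lee_fin mulr_ge0.
- by apply/measurable_EFinP; exact: (measurable_funM (measurable_cst p1) m1).
- by move=> t _; rewrite lee_fin mulr_ge0.
- by apply/measurable_EFinP; exact: (measurable_funM (measurable_cst p0) m0).
Qed.

End beta_prime_laplace.

(** * Finitely many set marks *)

Lemma finite_of_sum (R : realType) (b : nat -> bool) :
  (\sum_(i <oo) ((b i)%:R : R)%:E < +oo)%E -> finite_set [set i | b i].
Proof.
move=> S; apply: contrapT => /infinite_set_fset H.
have [r Sr] : exists r : R, (\sum_(i <oo) ((b i)%:R : R)%:E = r%:E)%E.
  have S0 : (0 <= \sum_(i <oo) ((b i)%:R : R)%:E)%E by apply: nneseries_ge0.
  by exists (fine (\sum_(i <oo) ((b i)%:R : R)%:E)); rewrite fineK// ge0_fin_numE.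
have [A Ab Ar] := H (Num.truncn r).+1.
suff : ((Num.truncn r).+1%:R%:E <= \sum_(i <oo) ((b i)%:R : R)%:E)%E.
  by rewrite Sr lee_fin leNgt truncnS_gt.
rewrite nneseries_esumT//; apply: esum_ge.
exists [set` finmap.enum_fset A]; first by split => //; exact: finite_seq.
rewrite -fsbig_seq ?finmap.fset_uniq//.
rewrite (eq_big_seq (fun=> 1%:E)); last first.
  by move=> i iA; have /= -> := Ab i iA.
rewrite sumEFin lee_fin big_const_seq count_predT iter_addr_0 ler_nat.
exact: Ar.
Qed.

(** The witness exceeds the sum of all set indices, hence each of them. *)
Lemma finite_infinite_unset (b : nat -> bool) : finite_set [set i | b i] ->
  forall n, exists2 i, (n <= i)%N & ~~ b i.
Proof.
move=> fb n; set s := finmap.enum_fset (fset_set [set i | b i]).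
have us : uniq s by exact: finmap.fset_uniq.
exists (n + \sum_(j <- s) j).+1; first by rewrite leqW// leq_addr.
apply/negP => bi; have is_ : (n + \sum_(j <- s) j).+1 \in s.
  by rewrite in_fset_set// mem_set.
have : ((n + \sum_(j <- s) j).+1 <= \sum_(j <- s) j)%N.
  by rewrite {2}(bigD1_seq _ is_ us)/= leq_addr.
by rewrite leqNgt ltnS leq_addl.
Qed.

Lemma series_finite_support (R : realType) (b : nat -> bool) (F : nat -> \bar R) :
  finite_set [set i | b i] -> (forall i, 0 <= F i)%E ->
  (\sum_(i <oo) (if b i then F i else 0) =
   \sum_(i <- finmap.enum_fset (fset_set [set i | b i])) F i)%E.
Proof.
move=> fb F0; rewrite nneseries_esumT//; last by move=> i; case: ifP.
transitivity (\esum_(i in [set i | b i]) F i)%E.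
  rewrite [RHS]esum_mkcond; apply: eq_esum => i _.
  by case: (boolP (b i)) => bi; [rewrite mem_set|rewrite memNset//=; exact/negP].
by rewrite esum_fset// fsbig_finite.
Qed.

(** * Rates of the observed and of the unobserved atoms *)

Section rates.
Context (R : realType) dPsi (Psi : measurableType dPsi).
Local Notation mu := (@lebesgue_measure R).
Local Notation D := (`]0%R, +oo[%classic : set R).

Definition rate_density (h : beta_prime_param R Psi) (t : R) : R :=
  bp_gamma h * beta_prime_shape (bp_xi h) (bp_lambda h) t * \1_D t.

Lemma measurable_rate_density h : measurable_fun setT (rate_density h).
Proof.
apply: measurable_funM; last exact: measurable_indic.
by apply: measurable_funM => //; exact: measurable_shape.
Qed.

Lemma rate_density_ge0 h t : 0 <= rate_density h t.
Proof.
apply: mulr_ge0; last by rewrite indicE.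
by apply: mulr_ge0; [exact: ltW (bp_gamma_gt0 h)|exact: shape_ge0].
Qed.

Lemma weight_rateE h A : measurable A ->
  (weight_rate h A = \int[mu]_(t in A) (rate_density h t)%:E)%E.
Proof.
move=> mA; rewrite /weight_rate integral_mkcondr; apply: eq_integral => t _.
by rewrite patchE /rate_density indicE; case: ifP => _; rewrite ?mulr1 ?mulr0.
Qed.

(** The location is integrated last, which lets two rates be compared location by
    location. *)
Lemma rate_integral (h : beta_prime_param R Psi) (F : R * Psi -> R) :
  measurable_fun setT F -> (forall z, 0 <= F z) ->
  (\int[weight_rate h \x bp_G h]_z (F z)%:E =
   \int[bp_G h]_p \int[mu]_t (F (t, p) * rate_density h t)%:E)%E.
Proof.
move=> mF F0.
have mw : measurable_fun setT (fun z : R * Psi => rate_density h z.1).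
  exact: (measurableT_comp (measurable_rate_density h) measurable_fst).
have w0 (z : R * Psi) : 0 <= rate_density h z.1 by exact: rate_density_ge0.
have mid : measurable_fun setT (id : R * Psi -> measurableTypeR R * Psi) by [].
rewrite (@integral_density_map _ _ _ _ _ (weight_rate h \x bp_G h)%E (mu \x bp_G h)%E
  id (fun z => rate_density h z.1) F mid mw w0)//.
  rewrite fubini_tonelli2//.
  - by apply/measurable_EFinP; exact: measurable_funM.
  - by move=> z; rewrite lee_fin mulr_ge0.
move=> A mA.
have mG : measurable_fun setT (fun t : R => bp_G h (xsection A t)).
  exact: measurable_fun_xsection.
have fG t : bp_G h (xsection A t) \is a fin_num.
  by apply: fin_num_measure; exact: measurable_xsection.
transitivity (\int[weight_rate h]_t (fine (bp_G h (xsection A t)))%:E)%E.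
  by apply: eq_integral => t _; rewrite fineK.
have mfG : measurable_fun setT (fun t : R => fine (bp_G h (xsection A t))).
  by apply: (measurableT_comp _ mG).
have mid1 : measurable_fun setT (id : R -> measurableTypeR R) by [].
rewrite (@integral_density_map _ _ _ _ _ (weight_rate h) mu id (rate_density h)
  (fun t => fine (bp_G h (xsection A t))) mid1 (measurable_rate_density h) (rate_density_ge0 h)); last first.
- by move=> t; exact: fine_ge0.
- exact: mfG.
- exact: weight_rateE.
rewrite [RHS]integral_mkcond.
have -> : (fun z : R * Psi => (rate_density h z.1)%:E) \_ A = (fun z => (\1_A z * rate_density h z.1)%:E).
  by apply/funext => z; rewrite patchE indicE; case: ifP => _; rewrite ?mul1r ?mul0r.
rewrite fubini_tonelli1.
- apply: eq_integral => t _; rewrite /fubini_F.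
  transitivity (\int[bp_G h]_y ((rate_density h t)%:E * (\1_A (t, y))%:E))%E; last first.
    by apply: eq_integral => y _; rewrite /= EFinM muleC.
  rewrite ge0_integralZl//=.
  + rewrite EFinM fineK// muleC; congr (_ * _)%E.
    transitivity (\int[bp_G h]_y (\1_(xsection A t) y)%:E)%E.
      by rewrite integral_indic ?setIT//; exact: measurable_xsection.
    apply: eq_integral => y _; congr EFin; rewrite !indicE; congr (_ %:R).
    by rewrite mem_xsection.
  + apply/measurable_EFinP.
    have -> : (fun y : Psi => \1_A (t, y) : R) = \1_(xsection A t).
      by apply/funext => y; rewrite !indicE mem_xsection.
    by apply: measurable_indic; exact: measurable_xsection.
  + by rewrite lee_fin rate_density_ge0.
- apply/measurable_EFinP; apply: measurable_funM => //; exact: measurable_indic.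
- by move=> z; rewrite lee_fin mulr_ge0 ?rate_density_ge0// indicE.
Qed.

End rates.

Section posterior_param.
Context (R : realType) dPsi (Psi : measurableType dPsi) (h : beta_prime_param R Psi).

Let lam_gt : bp_xi h + 1 < bp_lambda h + 1.
Proof. by have := bp_lambda_gt h; have := bp_xi_le h; lra. Qed.

Definition post_param (m : nat) (loc : 'I_m -> Psi) (loc_inj : injective loc)
    (xi lam : 'I_m -> R) (hx : forall i, -1 < xi i) (hl : forall i, xi i + 1 < lam i) :
    beta_prime_param R Psi :=
  @BetaPrimeParam R _ Psi m loc loc_inj xi lam hx hl (bp_gamma h) (bp_xi h)
    (bp_lambda h + 1) (bp_gamma_gt0 h) (bp_xi_gt h) (bp_xi_le h) lam_gt (bp_G h)
    (@bp_G_diffuse _ _ _ h).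

(** The rate [nu (dt) / (1 + t)] of the unobserved atoms, packaged with the fixed part
    of the prior as a parameter of the family. *)
Definition thinned : beta_prime_param R Psi :=
  post_param (@bp_loc_inj _ _ _ h) (@bp_xi_fix_gt _ _ _ h) (@bp_lambda_fix_gt _ _ _ h).

Lemma rate_density_thinned t : rate_density thinned t = rate_density h t / (1 + `|t|).
Proof.
rewrite /rate_density /= indicE; case: (boolP (t \in _)) => tD; last by rewrite !mulr0 mul0r.
have t0 : 0 < t by move: tD; rewrite inE/= in_itv/= andbT.
by rewrite !mulr1 gtr0_norm// -mulrA -shape_unobserved.
Qed.

(** The total rate [\int t / (1 + t) nu (dt)] of the observed ordinary atoms.  It is
    finite since [xi > - 2]: the additional factor [t] compensates the singularity
    of the weight rate at 0. *)
Definition obs_mass : R :=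
  bp_gamma h * (Gamma (bp_xi h + 2) * Gamma (bp_lambda h - bp_xi h - 1) / Gamma (bp_lambda h + 1)).

Lemma ord_post1 : -1 < bp_xi h + 1.
Proof. by have := bp_xi_gt h; lra. Qed.

Lemma ord_post2 : bp_xi h + 1 + 1 < bp_lambda h + 1.
Proof. by have := bp_lambda_gt h; lra. Qed.

Lemma obs_mass_ge0 : 0 <= obs_mass.
Proof.
rewrite /obs_mass mulr_ge0 ?(ltW (bp_gamma_gt0 h))//.
have := bp_xi_gt h; have := bp_lambda_gt h; have := bp_xi_le h => ? ? ?.
by rewrite divr_ge0 ?mulr_ge0// ltW// Gamma_gt0//; lra.
Qed.

Lemma rate_density_observed t :
  `|t| / (1 + `|t|) * rate_density h t = obs_mass * bp_density (bp_xi h + 1) (bp_lambda h + 1) t.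
Proof.
rewrite /rate_density /bp_density indicE; case: (boolP (t \in _)) => tD; last by rewrite !mulr0.
have t0 : 0 < t by move: tD; rewrite inE/= in_itv/= andbT.
have := bp_xi_gt h; have := bp_xi_le h; have := bp_lambda_gt h => h1 h2 h3.
have a0 : Gamma (bp_xi h + 2) != 0 by rewrite gt_eqF// Gamma_gt0//; lra.
have b0 : Gamma (bp_lambda h - bp_xi h - 1) != 0 by rewrite gt_eqF// Gamma_gt0//; lra.
have c0 : Gamma (bp_lambda h + 1) != 0 by rewrite gt_eqF// Gamma_gt0//; lra.
rewrite !mulr1 gtr0_norm// mulrCA shape_observed// /obs_mass /beta_prime_density.
have -> : bp_xi h + 1 + 1 = bp_xi h + 2 by ring.
have -> : bp_lambda h + 1 - (bp_xi h + 1) - 1 = bp_lambda h - bp_xi h - 1 by ring.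
move: (Gamma _) (Gamma _) (Gamma _) (beta_prime_shape _ _ _) a0 b0 c0 => x y z s a0 b0 c0.
by field; rewrite a0 b0 c0.
Qed.

Lemma obs_integral :
  (\int[lebesgue_measure]_t (`|t| / (1 + `|t|) * rate_density h t)%:E = obs_mass%:E)%E.
Proof.
under eq_integral do rewrite rate_density_observed.
rewrite (integral_cstM obs_mass_ge0 (measurable_bp_density _ _) (bp_density_ge0 ord_post1 ord_post2)).
by rewrite (bp_density_total ord_post1 ord_post2) mule1.
Qed.

End posterior_param.

(** * Laplace functionals of the marked atoms *)

Section unobserved.
Context (R : realType) d (Omega : measurableType d) (P : probability Omega R)
  dPsi (Psi : measurableType dPsi) (h : beta_prime_param R Psi)
  (theta : 'I_(bp_K h) + nat -> {RV P >-> R}) (psi : 'I_(bp_K h) + nat -> {RV P >-> Psi})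
  (x : 'I_(bp_K h) + nat -> {RV P >-> bool}).
Hypothesis prior : beta_prime_atoms theta psi.
Hypothesis marks : odds_bernoulli_marks theta psi x.

Local Notation K := (bp_K h).
Let z k w := (theta k w, psi k w).

Lemma marked_crm_laplace (f : 'I_K + nat -> R * Psi -> bool -> R) (g : R * Psi -> bool -> R) :
  (forall k e, measurable_fun setT (fun y => f k y e)) ->
  (forall k y e, 0 <= f k y e) -> (forall j, f (inr j) = g) ->
  \int[P]_w eN (atom_sum (fun k => (f k (z k w) (x k w))%:E)) =
  \prod_(k < K) \int[P]_w mix (theta (inl k) w)
     (expR (- f (inl k) (theta (inl k) w, bp_loc k) true))
     (expR (- f (inl k) (theta (inl k) w, bp_loc k) false)) *
  eN (\int[weight_rate h \x bp_G h]_s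
    (1 - mix s.1 (expR (- g s true)) (expR (- g s false)))%:E)%E.
Proof.
move=> mf f0 fg; have crm := bp_crm prior.
rewrite (marks_laplace (crm_weight_gt0 crm) marks mf f0).
have mF k : measurable_fun setT (fun y : R * Psi => neglog_mix y.1 (f k y true) (f k y false)).
  by apply: measurable_neglog_mix => //; exact: measurable_fst.
have F0 k y : 0 <= neglog_mix y.1 (f k y true) (f k y false) by exact: neglog_mix_ge0.
have := @crm_laplace _ _ _ P _ _ _ _ (weight_rate h \x bp_G h)%E theta psi
  (crm_fix_loc crm) (crm_fix_independent crm) (crm_ord_poisson crm)
  (crm_fix_ord_independent crm)
  (fun k y => neglog_mix y.1 (f k y true) (f k y false))
  (fun y => neglog_mix y.1 (g y true) (g y false)) mF F0.
rewrite -/z => ->; last by move=> j; rewrite fg.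
congr (_ * eN _).
  by apply: eq_bigr => k _; apply: eq_Rintegral => w _; rewrite expR_neglog_mix.
apply: eq_integral => s _; rewrite expR_neglog_mix//; by rewrite -(fg 0).
Qed.

Let mix11 (t : R) : mix t 1 1 = 1.
Proof. by rewrite /mix mulr1 addrC divff// gt_eqF// mix_den. Qed.

(** Observed atoms are given the value 0, so that an atom of weight [t] contributes
    with probability [1 / (1 + t)] only: this is the thinned Poisson process. *)
Lemma unobserved_laplace (f : R * Psi -> R) : measurable_fun setT f -> (forall s, 0 <= f s) ->
  \int[P]_w eN (\sum_(i <oo) (if x (inr i) w then 0 else (f (z (inr i) w))%:E))%E =
  eN (\int[weight_rate (thinned h) \x bp_G (thinned h)]_s (1 - expR (- f s))%:E)%E.
Proof.
move=> mf f0.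
pose g (y : R * Psi) (e : bool) : R := if e then 0 else f y.
pose F (k : 'I_K + nat) := if k is inr _ then g else (fun _ _ => 0).
have mF k e : measurable_fun setT (fun y => F k y e).
  by case: k => [k|j] /=; [|case: e].
have F0 k y e : 0 <= F k y e by case: k => [k|j] //=; rewrite /g; case: e.
transitivity (\int[P]_w eN (atom_sum (fun k => (F k (z k w) (x k w))%:E))).
  apply: eq_Rintegral => w _; congr eN; rewrite /atom_sum big1 ?add0e//.
  by apply: eq_eseriesr => i _; rewrite /F /g; case: ifP.
rewrite (marked_crm_laplace mF F0 (g := g))// big1 ?mul1r; last first.
  move=> k _; rewrite /= -[RHS](E_cst P 1); apply: eq_Rintegral => w _.
  by rewrite oppr0 expR0 mix11.
apply: (f_equal (@eN R)); rewrite /g oppr0 expR0.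
have mm : measurable_fun setT (fun s : R * Psi => mix s.1 1 (expR (- f s))).
  by apply: measurable_mix => //; exact: measurable_expRN.
have e01 s : 0 <= expR (- f s) <= 1 by rewrite expR_ge0 expR_le1 oppr_le0 f0.
have m1 : measurable_fun setT (fun s : R * Psi => 1 - mix s.1 1 (expR (- f s))).
  exact: measurable_funB.
have m2 : measurable_fun setT (fun s : R * Psi => 1 - expR (- f s)).
  by apply: measurable_funB => //; exact: measurable_expRN.
have p1 s : 0 <= 1 - mix s.1 1 (expR (- f s)).
  have /andP[] : 0 <= mix s.1 1 (expR (- f s)) <= 1.
    by apply: mix_ge01 => //; rewrite ler01 lexx.
  by rewrite subr_ge0.
have p2 s : 0 <= 1 - expR (- f s) by rewrite subr_ge0; case/andP: (e01 s).
apply: etrans (rate_integral h m1 p1) _.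
apply: etrans _ (esym (rate_integral (thinned h) m2 p2)).
apply: eq_integral => p _; apply: eq_integral => t _; apply: (f_equal EFin).
rewrite rate_density_thinned /mix /=; field; rewrite gt_eqF// ?mix_den//.
Qed.

(** The number [S] of observed ordinary atoms satisfies
    [E exp (- s * S) = exp (- (1 - exp (- s)) * obs_mass)], and [s -> 0] gives the
    probability that [S] is finite. *)
Lemma observed_finite :
  {ae P, forall w, finite_set [set i | x (inr i) w]}.
Proof.
pose S w : \bar R := (\sum_(i <oo) (((x (inr i) w) : bool)%:R : R)%:E)%E.
have mS : measurable_fun setT S.
  apply: ge0_emeasurable_sum => // i _; apply/measurable_EFinP.
  apply: (@measurableT_comp _ _ _ _ _ _ (fun b : bool => b%:R : R)) => //.
have S0 w : (0 <= S w)%E by apply: nneseries_ge0.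
have lapS s : 0 <= s -> \int[P]_w eN (s%:E * S w)%E = expR (- ((1 - expR (- s)) * obs_mass h)).
  move=> s0.
  pose g (y : R * Psi) (e : bool) : R := if e then s else 0.
  pose F (k : 'I_K + nat) := if k is inr _ then g else (fun _ _ => 0).
  have mF k e : measurable_fun setT (fun y => F k y e).
    by case: k => [k|j] /=; [|case: e].
  have F0 k y e : 0 <= F k y e by case: k => [k|j] //=; rewrite /g; case: e.
  transitivity (\int[P]_w eN (atom_sum (fun k => (F k (z k w) (x k w))%:E))).
    apply: eq_Rintegral => w _; congr eN; rewrite /atom_sum big1 ?add0e//.
    rewrite /S -nneseriesZl//; apply: eq_eseriesr => i _; rewrite /F /g.
    by case: (x (inr i) w); rewrite /= ?mule1 ?mule0.
  rewrite (marked_crm_laplace mF F0 (g := g))// big1 ?mul1r; last first.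
    move=> k _; rewrite /= -[RHS](E_cst P 1); apply: eq_Rintegral => w _.
    by rewrite oppr0 expR0 mix11.
  rewrite /g oppr0 expR0.
  have mm : measurable_fun setT (fun u : R * Psi => mix u.1 (expR (- s)) 1).
    exact: measurable_mix.
  have es : 0 <= expR (- s) <= 1 by rewrite expR_ge0 expR_le1 oppr_le0 s0.
  have m1 : measurable_fun setT (fun u : R * Psi => 1 - mix u.1 (expR (- s)) 1).
    exact: measurable_funB.
  have p1 (u : R * Psi) : 0 <= 1 - mix u.1 (expR (- s)) 1 :> R.
    have /andP[] : 0 <= mix u.1 (expR (- s)) 1 <= 1.
      by apply: mix_ge01 => //; rewrite ler01 lexx.
    by rewrite subr_ge0.
  apply: etrans (f_equal (@eN R) (rate_integral h m1 p1)) _.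
  transitivity (eN (\int[bp_G h]_p ((1 - expR (- s)) * obs_mass h)%:E)%E); last first.
    by rewrite integral_cst//= probability_setT mule1.
  apply: (f_equal (@eN R)); apply: eq_integral => p _; rewrite EFinM -obs_integral -ge0_integralZl//.
  - apply: eq_integral => t _; rewrite -EFinM; congr EFin.
    rewrite /mix /=; field; rewrite gt_eqF// ?mix_den//.
  - apply/measurable_EFinP; apply: measurable_funM; last exact: measurable_rate_density.
    apply: measurable_funM => //; apply: measurable_funinv; exact: measurable_funD.
  - by move=> t _; rewrite lee_fin mulr_ge0 ?rate_density_ge0// divr_ge0// ltW// mix_den.
  - by rewrite lee_fin subr_ge0; case/andP: es.
pose A := [set w | (S w < +oo)%E].
have mA : measurable A.
  rewrite (_ : A = S @^-1` `[-oo%E, +oo%E[%classic).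
    by rewrite -[X in measurable X]setTI; apply: mS => //; exact: emeasurable_itv.
  by apply/seteqP; split => w /=; rewrite in_itv/= ?leNye//; move=> ->.
have L1 : (fun n => \int[P]_w eN ((n.+1%:R^-1)%:E * S w)%E) @ \oo --> \int[P]_w \1_A w.
  apply: (E_lim (M := 1)).
  - by move=> n; apply: bmeas_eN => [|w]; [exact: measurable_funeM|rewrite mule_ge0// lee_fin].
  - by move=> n w; rewrite eN_ubound// mule_ge0// lee_fin.
  - move=> w; rewrite indicE; have := S0 w; case E : (S w) => [r| |] // r0.
      rewrite mem_set/= ?/A/= ?E ?ltry//.
      rewrite -[X in _ --> X](@expR0 R).
      apply: (@cvg_comp _ _ _ _ (@expR R)); last exact: continuous_expR.
      rewrite -oppr0; apply: cvgN; rewrite -(mul0r r); apply: cvgMl.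
      exact: cvg_harmonic.
    rewrite memNset/= ?/A/= ?E ?ltxx//.
    under eq_fun do rewrite gt0_muley ?lte_fin ?invr_gt0 ?ltr0n//.
    exact: cvg_cst.
have L2 : (fun n => \int[P]_w eN ((n.+1%:R^-1)%:E * S w)%E) @ \oo --> (1 : R).
  have E n : \int[P]_w eN ((n.+1%:R^-1)%:E * S w)%E =
      expR (- ((1 - expR (- n.+1%:R^-1)) * obs_mass h)).
    by apply: lapS; rewrite invr_ge0 ler0n.
  rewrite (funext E).
  rewrite -[X in _ --> X](@expR0 R).
  apply: (@cvg_comp _ _ _ _ (@expR R)); last exact: continuous_expR.
  rewrite -oppr0; apply: cvgN; rewrite -(mul0r (obs_mass h)); apply: cvgMl.
  rewrite -(subrr 1); apply: cvgB; first exact: cvg_cst.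
  rewrite -[X in _ --> X](@expR0 R).
  apply: (@cvg_comp _ _ _ _ (@expR R)); last exact: continuous_expR.
  rewrite -oppr0; apply: cvgN; exact: cvg_harmonic.
have PA : P A = 1%E.
  have := cvg_unique (@Rhausdorff R) L1 L2; rewrite E_indic// => E.
  by rewrite -[LHS]fineK ?fin_num_measure// E.
exists (~` A); split.
- exact: measurableC.
- by rewrite probability_setC// PA subee.
- by move=> w /=; apply: contra_not => /finite_of_sum.
Qed.

End unobserved.

(** * Construction of the posterior process *)

Section random_variables.
Context d (T : measurableType d) (R : realType) (P : probability T R)
  d' (T' : measurableType d').

Definition rv_of (f : T -> T') (mf : measurable_fun setT f) : {RV P >-> T'} :=
  HB.pack f (isMeasurableFun.Build _ _ _ _ f mf).

End random_variables.

Section select.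
Context d (T : measurableType d) d' (T' : measurableType d').

Lemma measurable_select (kk : T -> nat) (f : nat -> T -> T') :
  (forall i, measurable [set w | kk w = i]) -> (forall i, measurable_fun setT (f i)) ->
  measurable_fun setT (fun w => f (kk w) w).
Proof.
move=> mk mf _ V mV; rewrite setTI.
rewrite (_ : _ @^-1` V = \bigcup_i ([set w | kk w = i] `&` (f i @^-1` V))).
  apply: bigcupT_measurable => i; apply: measurableI => //.
  by rewrite -[X in measurable X]setTI; exact: mf.
apply/seteqP; split => [w /= Vw|w [i _ [/= <-]]//].
by exists (kk w).
Qed.

End select.

Section select_kth.
Context d (T : measurableType d).

Lemma measurable_kth_unset (b : nat -> T -> bool) :
  (forall i, measurable [set w | b i w]) ->
  forall j i, measurable [set w | kth_unset (b ^~ w) j = i].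
Proof.
move=> mb j i.
have mb' k : measurable [set w | ~~ b k w].
  rewrite (_ : mkset _ = ~` [set w | b k w]); first exact: measurableC.
  by apply/seteqP; split => w /=; [move/negP|move/negP].
have mC k l : measurable [set w | unset_count (b ^~ w) k = l].
  elim: k l => [|k ih] l.
    case: l => [|l].
      rewrite (_ : mkset _ = setT)//; first by apply/seteqP; split.
    by rewrite (_ : mkset _ = set0)//; apply/seteqP; split.
  rewrite (_ : mkset _ = ([set w | b k w] `&` [set w | unset_count (b ^~ w) k = l]) `|`
    ([set w | ~~ b k w] `&` [set w | (unset_count (b ^~ w) k).+1 = l])); last first.
    apply/seteqP; split => w /=; rewrite unset_countS.
      by case: (b k w) => /=; rewrite ?addn0 ?addn1 => ?; [left|right].
    by move=> [[-> <-]|[/negbTE -> <-]] /=; rewrite ?addn0 ?addn1.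
  apply: measurableU; apply: measurableI => //.
  case: l => [|l].
    by rewrite (_ : mkset _ = set0)//; apply/seteqP; split.
  rewrite (_ : mkset _ = [set w | unset_count (b ^~ w) k = l])//.
  by apply/seteqP; split => w /=; [case|move=> ->].
pose B k := [set w | ~~ b k w] `&` [set w | unset_count (b ^~ w) k = j].
have mB k : measurable (B k) by exact: measurableI.
have mN : measurable (~` \bigcup_k B k) by apply: measurableC; exact: bigcupT_measurable.
rewrite (_ : mkset _ = B i `|` (if i == 0%N then ~` \bigcup_k B k else set0)).
  by apply: measurableU => //; case: ifP.
apply/seteqP; split => w /=.
  rewrite /kth_unset; case: xgetP => [y _ [by_ cy] <-|nB <-]; first by left.
  by right; rewrite eqxx => -[k _ Bk]; exact: (nB k).
case => [[bi ci]|]; first by rewrite -ci kth_unset_count.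
case: eqP => // -> nB; rewrite /kth_unset; case: xgetP => // y _ [by_ cy].
by exfalso; apply: nB; exists y.
Qed.

End select_kth.


Section joint_independence.
Context (R : realType) d (Omega : measurableType d) (P : probability Omega R) (m : nat)
  (Z : 'I_m -> Omega -> R) (mu : 'I_m -> probability R R).
Hypothesis joint : forall V : 'I_m -> set R, (forall i, measurable (V i)) ->
  (P (\bigcap_(i in [set: 'I_m]) (Z i @^-1` V i)) = \prod_(i < m) mu i (V i))%E.

Let jointR (V : 'I_m -> set R) : (forall i, measurable (V i)) ->
  P (\bigcap_(i in [set: 'I_m]) (Z i @^-1` V i)) = (\prod_(i < m) fine (mu i (V i)))%:E.
Proof.
move=> mV; rewrite joint// (big_morph EFin EFinM erefl).
by apply: eq_bigr => i _; rewrite fineK// fin_num_measure.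
Qed.

Let mu1 i : fine (mu i setT) = 1.
Proof. by rewrite probability_setT. Qed.

Let prodJ (J : seq 'I_m) (V : 'I_m -> set R) : uniq J ->
  \prod_(i < m) fine (mu i (if i \in J then V i else setT)) =
  \prod_(i <- J) fine (mu i (V i)).
Proof.
move=> uJ; transitivity (\prod_(i in J) fine (mu i (V i))); last by rewrite big_uniq.
by rewrite [RHS]big_mkcond; apply: eq_bigr => i _; case: ifP => // _; rewrite mu1.
Qed.

Let mVJ (J : seq 'I_m) (V : 'I_m -> set R) : (forall i, measurable (V i)) ->
  forall i, measurable (if i \in J then V i else setT).
Proof. by move=> mV i; case: ifP. Qed.

Let PJ (J : seq 'I_m) (V : 'I_m -> set R) : uniq J -> (forall i, measurable (V i)) ->
  P (\bigcap_(i in [set` J]) (Z i @^-1` V i)) = (\prod_(i <- J) fine (mu i (V i)))%:E.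
Proof.
move=> uJ mV; rewrite -prodJ// -jointR; last exact: mVJ.
congr (P _); apply/seteqP; split => w /= h i.
  by move=> _ /=; case: ifPn => // iJ; apply: h.
by move=> /= iJ; have := h i I; rewrite /= iJ.
Qed.

Lemma joint_law i A : measurable A -> P (Z i @^-1` A) = mu i A.
Proof.
move=> mA; have := @PJ [:: i] (fun=> A) erefl (fun=> mA).
rewrite big_seq1 fineK ?fin_num_measure// => <-; congr (P _).
apply/seteqP; split => w /= h; first by move=> j; rewrite /= inE => /eqP ->.
by apply: (h i); rewrite /= inE.
Qed.

Lemma joint_independent :
  mutually_independent P (fun i => preimage_set_system setT (Z i) measurable).
Proof.
move=> J E uJ FE.
have : forall i, exists V, measurable V /\ (i \in J -> E i = Z i @^-1` V).
  move=> i; case: (boolP (i \in J)) => iJ; last by exists setT.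
  by have [V mV <-] := FE i iJ; exists V; split => //; rewrite setTI.
move=> /choice[V HV].
have mV i := (HV i).1.
rewrite (_ : \bigcap_(i in _) _ = \bigcap_(i in [set` J]) (Z i @^-1` V i)); last first.
  by apply: eq_bigcapr => i iJ; exact: (HV i).2.
rewrite PJ//; congr EFin; apply: eq_big_seq => i iJ.
by rewrite (HV i).2// joint_law.
Qed.

End joint_independence.

Section product_space.
Context (R : realType) d (Omega : measurableType d) (P : probability Omega R)
  d2 (T : measurableType d2) (Q : probability T R).

Definition prodP : probability (Omega * T)%type R := (P \x Q)%E.

Lemma prodP_fst A : measurable A -> prodP (fst @^-1` A) = P A.
Proof.
move=> mA; have -> : fst @^-1` A = A `*` [set: T].
  by apply/seteqP; split => z //= [].
transitivity (P A * Q setT)%E; first exact: product_measure1E.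
by rewrite probability_setT mule1.
Qed.

Lemma prodP_snd B : measurable B -> prodP (snd @^-1` B) = Q B.
Proof.
move=> mB; have -> : snd @^-1` B = [set: Omega] `*` B.
  by apply/seteqP; split => z //= [].
transitivity (P setT * Q B)%E; first exact: product_measure1E.
by rewrite probability_setT mul1e.
Qed.

Lemma prodP_fst_snd A B : measurable A -> measurable B ->
  prodP (fst @^-1` A `&` snd @^-1` B) = (P A * Q B)%E.
Proof.
move=> mA mB; have -> : fst @^-1` A `&` snd @^-1` B = A `*` B.
  by apply/seteqP; split => z.
exact: product_measure1E.
Qed.

Lemma E_prodP_fst (f : Omega -> R) : bmeas f -> (forall w, 0 <= f w) ->
  \int[prodP]_z f z.1 = \int[P]_w f w.
Proof.
move=> bf f0; apply/esym; apply: E_pushforward => //.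
by move=> B mB; rewrite prodP_fst.
Qed.

Lemma ae_prodP_fst (A : set Omega) : {ae P, forall w, A w} -> {ae prodP, forall z, A z.1}.
Proof.
move=> [N [mN PN AN]]; exists (fst @^-1` N); split.
- by rewrite -[X in measurable X]setTI; exact: measurable_fst.
- by rewrite prodP_fst.
- by move=> z /= h; exact: AN.
Qed.

End product_space.

Section construction.
Context (R : realType) d (Omega : measurableType d) (P : probability Omega R)
  dPsi (Psi : measurableType dPsi) (h : beta_prime_param R Psi)
  (theta : 'I_(bp_K h) + nat -> {RV P >-> R}) (psi : 'I_(bp_K h) + nat -> {RV P >-> Psi})
  (x : 'I_(bp_K h) + nat -> {RV P >-> bool}).
Hypothesis singletons : forall p : Psi, measurable [set p].
Hypothesis prior : beta_prime_atoms theta psi.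
Hypothesis marks : odds_bernoulli_marks theta psi x.

Let crm := bp_crm prior.

(** The rate of [R * {p}] is 0 because [G] is diffuse. *)
Lemma ord_avoids (p : Psi) : {ae P, forall w, forall i, psi (inr i) w <> p}.
Proof.
pose A : set (R * Psi) := [set: R] `*` [set p].
have mA : measurable A by apply: measurableX.
have rA : (weight_rate h \x bp_G h)%E A = (0 : R)%:E.
  transitivity (weight_rate h setT * bp_G h [set p])%E; first exact: product_measure1E.
  by rewrite bp_G_diffuse mule0.
have := ppp_finite (crm_ord_poisson crm) 0 mA rA.
rewrite expr0 fact0 divr1 mul1r oppr0 expR0.
set B := [set w | _] => PB.
have mB : measurable B.
  pose N w := point_measure R (fun k => (theta (inr k) w, psi (inr k) w)) A.
  have mN : measurable_fun setT N.
    by apply: measurable_point_measure => // k; exact: measurable_fun_pair.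
  rewrite (_ : B = N @^-1` [set 0%:R%:E]).
    by rewrite -[X in measurable X]setTI; exact: mN.
  by apply/seteqP; split => w; rewrite /B /N /= point_countE.
exists (~` B); split.
- exact: measurableC.
- by rewrite probability_setC// PB subee.
- move=> w /=; apply: contra_not; rewrite /B /= => N0 i pi.
  have : ((1 : R)%:E <= point_count R (fun k => (theta (inr k) w, psi (inr k) w)) A)%E.
    apply: esum_ge; exists [set i]; first by split => //; exact: finite_set1.
    by rewrite fsbig_set1 diracE mem_set//.
  by rewrite N0 lee_fin ler10.
Qed.

Lemma ord_avoids_family m (loc : 'I_m -> Psi) :
  {ae P, forall w, forall i j, psi (inr j) w <> loc i}.
Proof.
have : {ae P, forall w, forall i, i \in enum 'I_m -> forall j, psi (inr j) w <> loc i}.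
  elim: (enum 'I_m) => [|i s ih]; first exact: aeW.
  apply: filterS2 (ord_avoids (loc i)) ih => w h1 h2 i'.
  by rewrite inE => /predU1P[->|/h2].
by apply: filterS => w H i; apply: H; rewrite mem_enum.
Qed.

Variables (m : nat) (loc : 'I_m -> Psi) (xi lam : 'I_m -> R).
Hypothesis hx : forall i, -1 < xi i.
Hypothesis hl : forall i, xi i + 1 < lam i.

Let b i w : bool := x (inr i) w.
Let kk j w := kth_unset (b ^~ w) j.

Let mkk j i : measurable [set w | kk j w = i].
Proof.
apply: measurable_kth_unset => k.
rewrite (_ : mkset _ = x (inr k) @^-1` [set true]).
  by rewrite -[X in measurable X]setTI; exact: measurable_funPT.
by apply/seteqP; split => w.
Qed.

(** The unobserved atoms of the prior, renumbered, already form the ordinary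
    component; their number is infinite because only finitely many ordinary atoms
    are observed.  The product with [T] supplies independent weights for the fixed
    atoms, and [r] changes their nonpositive values, which have probability 0, to
    make the weights positive everywhere. *)
Theorem posterior_construction :
  exists d' (Omega' : measurableType d') (P' : probability Omega' R)
    (theta' : 'I_m + nat -> {RV P' >-> R}) (psi' : 'I_m + nat -> {RV P' >-> Psi}),
  [/\ (forall k w, 0 < theta' k w),
      (forall i w, psi' (inl i) w = loc i),
      mutually_independent P' (fun i : 'I_m =>
        preimage_set_system [set: Omega'] (theta' (inl i)) measurable),
      poisson_point_process P' (weight_rate (thinned h) \x bp_G (thinned h))%E
        (fun k w => (theta' (inr k) w, psi' (inr k) w)) &
      independent2 P' (sigma_of [set: 'I_m] (fun i => theta' (inl i)))
       (sigma_of measurable (fun (A : set (R * Psi)) w =>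
         point_count R (fun k => (theta' (inr k) w, psi' (inr k) w)) A))] /\
  (forall i (A : set R), measurable A -> distribution P' (theta' (inl i)) A =
    \int[lebesgue_measure]_(t in A `&` `]0%R, +oo[%classic)
      (beta_prime_density (xi i) (lam i) t)%:E)%E /\
  (injective loc -> {ae P', forall w, injective (fun k => psi' k w)}).
Proof.
have : forall i, exists Q : probability R R, forall A, Q A = density_measure (beta_prime_density (xi i) (lam i)) A.
  move=> i; apply: density_probability.
  - by apply: measurable_funM => //; exact: measurable_shape.
  - exact: (beta_prime_density_ge0 (hx i) (hl i)).
  - by rewrite /density_measure setTI beta_prime_density_total.
move=> /choice[mu muE].
have [d2 [T [Q [Y [mY QY]]]]] := independent_family mu.
pose r (t : R) := if 0 < t then t else 1.
have mr : measurable_fun setT r.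
  by apply: measurable_fun_ifT => //; exact: measurable_fun_ltr.
have mur i A : mu i (r @^-1` A) = mu i A.
  rewrite !muE /density_measure; congr integral; apply/seteqP; split => t /=.
    by rewrite in_itv/= andbT => -[+ t0]; rewrite /r t0.
  by rewrite in_itv/= andbT => -[At t0]; split => //; rewrite /r t0.
pose P' := prodP P Q.
pose th (k : 'I_m + nat) (z : Omega * T) : R := match k with
  | inl i => r (Y i z.2) | inr j => theta (inr (kk j z.1)) z.1 end.
pose ps (k : 'I_m + nat) (z : Omega * T) : Psi := match k with
  | inl i => loc i | inr j => psi (inr (kk j z.1)) z.1 end.
have mth k : measurable_fun setT (th k).
  case: k => [i|j] /=.
    by apply: (measurableT_comp mr); exact: (measurableT_comp (mY i) measurable_snd).
  have := @measurable_select _ _ _ _ (kk j) (fun i => theta (inr i)) (mkk j).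
  by move=> /(_ (fun=> measurable_funPT _)) mj; exact: (measurableT_comp mj measurable_fst).
have mps k : measurable_fun setT (ps k).
  case: k => [i|j] /=; first exact: measurable_cst.
  have := @measurable_select _ _ _ _ (kk j) (fun i => psi (inr i)) (mkk j).
  by move=> /(_ (fun=> measurable_funPT _)) mj; exact: (measurableT_comp mj measurable_fst).
pose theta' k := rv_of P' (mth k); pose psi' k := rv_of P' (mps k).
exists _, (Omega * T)%type, P', theta', psi'.
have joint (V : 'I_m -> set R) : (forall i, measurable (V i)) ->
    (P' (\bigcap_(i in [set: 'I_m]) (theta' (inl i) @^-1` V i)) = \prod_(i < m) mu i (V i))%E.
  move=> mV.
  rewrite (_ : \bigcap_(i in _) _ = snd @^-1` (\bigcap_(i in [set: 'I_m]) (Y i @^-1` (r @^-1` V i))))//.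
  have mrV i : measurable (r @^-1` V i) by rewrite -[X in measurable X]setTI; exact: mr.
  rewrite prodP_snd; last first.
    apply: fin_bigcap_measurable => [|i _]; first exact: finite_finset.
    by rewrite -[X in measurable X]setTI; exact: mY.
  by rewrite QY//; apply: eq_bigr => i _; rewrite mur.
have ae_inf := observed_finite prior marks.
split; [split|split].
- move=> [i|j] z /=; last exact: (crm_weight_gt0 crm).
  by rewrite /th /r; case: ifP.
- by [].
- exact: joint_independent joint.
- apply: laplace_ppp => [k|f mf f0]; first exact: measurable_fun_pair.
  pose g i w : \bar R := (f (theta (inr i) w, psi (inr i) w))%:E.
  have g0 i w : (0 <= g i w)%E by rewrite lee_fin.
  have mg i : measurable_fun setT (g i).
    by apply/measurable_EFinP; apply: (measurableT_comp mf); exact: measurable_fun_pair.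
  have mg1 : measurable_fun setT (fun w => \sum_(j <oo) g (kk j w) w)%E.
    apply: ge0_emeasurable_sum => // j _.
    exact: (@measurable_select _ _ _ _ (kk j) g (mkk j)).
  have b1 : bmeas (fun w => eN (\sum_(j <oo) g (kk j w) w)%E).
    by apply: bmeas_eN => // w; apply: nneseries_ge0.
  apply: (etrans (@E_prodP_fst R _ Omega P _ T Q _ b1 (fun w => eN_ge0 _))).
  rewrite -(unobserved_laplace prior marks mf f0).
  apply: E_ae => //.
    have h0 i w : (0 <= if x (inr i) w then 0 else g i w)%E by case: ifP.
    apply: (@bmeas_eN _ _ _ (fun w => \sum_(i <oo) if x (inr i) w then 0 else g i w)%E) => [|w].
      apply: ge0_emeasurable_sum => [i w _ _|i _]; first exact: h0.
      apply: measurable_fun_ifT; [exact: (measurable_funPT (x (inr i)))|exact: measurable_cst|exact: mg].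
    by apply: nneseries_ge0 => i _ _; exact: h0.
  apply: filterS ae_inf => w fw; congr eN.
  exact: (@sum_kth_unset (b ^~ w) (finite_infinite_unset fw) R (g ^~ w)).
- move=> A B FA GB.
  have [A0 mA0 EA] : exists2 A0, measurable A0 & snd @^-1` A0 = A.
    suff : preimage_set_system setT (@snd Omega T) measurable A.
      by case=> A0 mA0 <-; exists A0 => //; rewrite setTI.
    move: A FA; apply: smallest_sub.
      by apply: sigma_algebra_preimage; exact: sigma_algebra_measurable.
    move=> _ [i _ [V mV <-]]; exists (Y i @^-1` (r @^-1` V)) => //.
    rewrite -[X in measurable X]setTI; apply: mY => //.
    by rewrite -[X in measurable X]setTI; exact: mr.
  have [B0 mB0 EB] : exists2 B0, measurable B0 & fst @^-1` B0 = B.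
    suff : preimage_set_system setT (@fst Omega T) measurable B.
      by case=> B0 mB0 <-; exists B0 => //; rewrite setTI.
    move: B GB; apply: smallest_sub.
      by apply: sigma_algebra_preimage; exact: sigma_algebra_measurable.
    move=> _ [C mC [V mV <-]].
    pose N w := point_count R (fun j => (theta (inr (kk j w)) w, psi (inr (kk j w)) w)) C.
    exists (N @^-1` V) => //.
    rewrite -[X in measurable X]setTI.
    suff mN : measurable_fun setT N by exact: mN.
    rewrite /N; under eq_fun do rewrite point_countE.
    apply: measurable_point_measure => // j; apply: measurable_fun_pair.
      exact: (@measurable_select _ _ _ _ (kk j) (fun i => theta (inr i)) (mkk j)).
    exact: (@measurable_select _ _ _ _ (kk j) (fun i => psi (inr i)) (mkk j)).
  rewrite -EA -EB setIC prodP_fst_snd// prodP_fst// prodP_snd//.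
  by rewrite muleC.
- by move=> i A mA; rewrite /distribution /pushforward (joint_law joint i mA) muE.
- move=> loc_inj.
  have av := ord_avoids_family loc.
  have : {ae P, forall w, [/\ injective (fun k => psi k w),
      (forall i j, psi (inr j) w <> loc i) & finite_set [set i | b i w]]}.
    by apply: filterS3 (crm_distinct crm) av ae_inf => w h1 h2 h3.
  move=> /(@ae_prodP_fst R _ Omega P _ T Q); apply: filterS => z [inj avo fin].
  have kinj := kth_unset_inj (finite_infinite_unset fin).
  move=> [i|j] [i'|j'] //=.
  + by move=> /loc_inj ->.
  + by move=> /esym /avo.
  + by move=> /avo.
  + by move=> /inj [] /kinj ->.
Qed.

End construction.

Lemma measurable_atomic_sum (R : realType) d (Omega : measurableType d)
    dPsi (Psi : measurableType dPsi) K (w : 'I_K + nat -> Omega -> R)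
    (p : 'I_K + nat -> Omega -> Psi) (M : Omega -> measure_space R Psi) :
  (forall k, measurable_fun setT (w k)) -> (forall k o, 0 <= w k o) ->
  (forall k, measurable_fun setT (p k)) -> is_atomic_sum w p M -> measurable_fun setT M.
Proof.
move=> mw w0 mp ME; apply: measurable_to_measure_space => A mA.
have F0 k o : (0 <= (w k o)%:E * \d_(p k o) A :> \bar R)%E by rewrite mule_ge0// lee_fin.
under eq_fun => o do rewrite ME// esum_atom_sum//.
apply: measurable_atom_sum => // k; apply: emeasurable_funM; first exact/measurable_EFinP.
apply/measurable_EFinP.
apply: (@measurableT_comp _ _ _ _ _ _ (\1_A : Psi -> R)) => //.
Qed.

Section posterior_law.
Context (R : realType) d (Omega : measurableType d) (P : probability Omega R)
  dPsi (Psi : measurableType dPsi) (h : beta_prime_param R Psi)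
  (theta : 'I_(bp_K h) + nat -> {RV P >-> R}) (psi : 'I_(bp_K h) + nat -> {RV P >-> Psi})
  (x : 'I_(bp_K h) + nat -> {RV P >-> bool}).
Hypothesis singletons : forall p : Psi, measurable [set p].
Hypothesis prior : beta_prime_atoms theta psi.
Hypothesis marks : odds_bernoulli_marks theta psi x.

Definition unobserved_exponent (a : Psi -> R) : \bar R :=
  (\int[weight_rate (thinned h) \x bp_G (thinned h)]_s (1 - expR (- (a s.2 * `|s.1|)))%:E)%E.

Variables (m : nat) (loc : 'I_m -> Psi) (xi lam : 'I_m -> R).
Hypothesis hx : forall i, -1 < xi i.
Hypothesis hl : forall i, xi i + 1 < lam i.

(** The Laplace functional is available for repeated locations too, so that a law can
    be attached to all observations with finitely many new atoms and not just to
    almost all of them. *)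
Theorem posterior_law : exists Q : probability (measure_space R Psi) R,
  (forall a : Psi -> R, measurable_fun setT a -> (forall p, 0 <= a p) ->
    \int[Q]_M eN (\int[M : {measure set Psi -> \bar R}]_p (a p)%:E)%E =
    \prod_(i < m) bp_laplace (xi i) (lam i) (a (loc i)) * eN (unobserved_exponent a)) /\
  (injective loc -> beta_prime_law Q).
Proof.
have [d' [Om [P' [th [ps [[th0 fixl fixi ppp ind] [law inj]]]]]]] :=
  posterior_construction singletons prior marks loc hx hl.
have w0 w k : 0 <= th k w by exact/ltW/th0.
pose M (w : Om) : measure_space R Psi := atomic_measure (ps ^~ w) (w0 w).
have ME : is_atomic_sum th ps M.
  by move=> w A mA; rewrite /measure_eval atomic_measureE.
have mM : measurable_fun setT M.
  apply: (measurable_atomic_sum _ _ _ ME) => // k; exact: measurable_funPT.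
exists (distribution P' (rv_of P' mM)); split.
- move=> a ma a0.
  have bphi : bmeas (fun M : measure_space R Psi =>
      eN (\int[M : {measure set Psi -> \bar R}]_p (a p)%:E)%E).
    apply: bmeas_eN; first exact: measurable_measure_integral.
    by move=> M'; apply: integral_ge0 => p _; rewrite lee_fin.
  rewrite (E_pushforward mM (P := P') _ bphi)//; last by move=> ?; exact: eN_ge0.
  pose f (s : R * Psi) : R := a s.2 * `|s.1|.
  have mf : measurable_fun setT f.
    apply: measurable_funM; first exact: (measurableT_comp ma measurable_snd).
    by apply: measurableT_comp => //; exact: measurable_fst.
  have f0 s : 0 <= f s by rewrite mulr_ge0.
  have := @crm_laplace _ _ _ P' _ _ _ _ (weight_rate (thinned h) \x bp_G (thinned h))%E th ps
    fixl fixi ppp ind (fun _ => f) f (fun _ => mf) (fun _ => f0) (fun _ => erefl).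
  move=> E; transitivity (\int[P']_w eN (atom_sum (fun k => (f (th k w, ps k w))%:E))).
    apply: eq_Rintegral => w _.
    rewrite (integral_atomic (w0 w) (ME w) ma a0); congr eN; apply: eq_atom_sum => k.
    by rewrite /f/= gtr0_norm// mulrC.
  rewrite E; congr (_ * _); apply: eq_bigr => i _.
  have mth : measurable_fun setT (th (inl i) : Om -> R) by exact: measurable_funPT.
  transitivity (\int[P']_w expR (- (a (loc i) * `|th (inl i) w|))); first by [].
  have := bp_laplaceE (hx i) (hl i) mth (law i) (a (loc i)).
  exact.
- move=> loc_inj; exists d', Om, P', M; split => //.
  exists (post_param h loc_inj hx hl), th, ps; split => //; split => //.
  by split => //; exact: inj.
Qed.

End posterior_law.

(** * Conjugacy of the Laplace functionals *)

Section joint.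
Context (R : realType) d (Omega : measurableType d) (P : probability Omega R)
  dPsi (Psi : measurableType dPsi) (h : beta_prime_param R Psi)
  (theta : 'I_(bp_K h) + nat -> {RV P >-> R}) (psi : 'I_(bp_K h) + nat -> {RV P >-> Psi})
  (x : 'I_(bp_K h) + nat -> {RV P >-> bool}) (Theta X : Omega -> measure_space R Psi).
Hypothesis singletons : forall p : Psi, measurable [set p].
Hypothesis prior : beta_prime_atoms theta psi.
Hypothesis marks : odds_bernoulli_marks theta psi x.
Hypothesis ThetaE : is_atomic_sum theta psi Theta.
Hypothesis XE : is_atomic_sum (fun k omega => (x k omega)%:R%R) psi X.

Local Notation K := (bp_K h).
Local Notation mu := (@lebesgue_measure R).
Local Notation mint a M := (\int[M : {measure set Psi -> \bar R}]_p (a p)%:E)%E.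
Let crm := bp_crm prior.
Let z k w := (theta k w, psi k w).
Let th0 k w : 0 < theta k w := crm_weight_gt0 crm k w.

Definition fixed_set : set Psi := range (@bp_loc _ _ _ h).

Lemma measurable_fixed_set : measurable fixed_set.
Proof.
have -> : fixed_set = \bigcup_(k in [set: 'I_K]) [set bp_loc k].
  by apply/seteqP; split => [_ [k _ <-]|_ [k _ ->]]; exists k.
by apply: fin_bigcup_measurable => //; exact: finite_finset.
Qed.

Definition fix_laplace (k : 'I_K) (e : bool) : R -> R :=
  bp_laplace (bp_xi_fix k + e%:R) (bp_lambda_fix k + 1).

Definition ord_laplace : R -> R := bp_laplace (bp_xi h + 1) (bp_lambda h + 1).

Lemma fix_post1 (k : 'I_K) (e : bool) : -1 < bp_xi_fix k + e%:R.
Proof. by have := bp_xi_fix_gt k; case: e => /=; lra. Qed.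

Lemma fix_post2 (k : 'I_K) (e : bool) : bp_xi_fix k + e%:R + 1 < bp_lambda_fix k + 1.
Proof. by have := bp_lambda_fix_gt k; case: e => /=; lra. Qed.

Lemma fix_laplace01 k e s : 0 <= s -> 0 < fix_laplace k e s <= 1.
Proof. by move=> s0; apply: bp_laplace_gt0_le1 => //; [exact: fix_post1|exact: fix_post2]. Qed.

Lemma ord_laplace01 s : 0 <= s -> 0 < ord_laplace s <= 1.
Proof. by move=> s0; apply: bp_laplace_gt0_le1 => //; [exact: (ord_post1 h)|exact: (ord_post2 h)]. Qed.

Lemma measurable_ord_laplace : measurable_fun setT ord_laplace.
Proof. by apply: measurable_bp_laplace; [exact: (ord_post1 h)|exact: (ord_post2 h)]. Qed.

(** In the Laplace functional of a fixed weight and its mark, the weight may be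
    replaced by an independent one whose parameters are updated by the mark. *)
Lemma fixed_factor (k : 'I_K) (a b : R) : 0 <= a -> 0 <= b ->
  \int[P]_w mix (theta (inl k) w) (expR (- (a * `|theta (inl k) w| + b)))
     (expR (- (a * `|theta (inl k) w|))) =
  \int[P]_w mix (theta (inl k) w) (expR (- b) * fix_laplace k true a) (fix_laplace k false a).
Proof.
move=> a0 b0.
have hx := bp_xi_fix_gt k; have hl := bp_lambda_fix_gt k.
have mY : measurable_fun setT (theta (inl k) : Omega -> R) by exact: measurable_funPT.
have := bp_law_integral hx hl mY (bp_fix_law prior k).
have [p1 [p0 [p1_ge0 p0_ge0 H1 H0]]] := bp_density_mix hx hl.
have x1 : -1 < bp_xi_fix k + 1 := fix_post1 k true.
have l1 : bp_xi_fix k + 1 + 1 < bp_lambda_fix k + 1 := fix_post2 k true.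
have l0 : bp_xi_fix k + 1 < bp_lambda_fix k + 1.
  by have := fix_post2 k false; rewrite addr0.
have I1 := bp_laplace_integral x1 l1 a0; have I0 := bp_laplace_integral hx l0 a0.
have T1 := bp_density_total x1 l1; have T0 := bp_density_total hx l0.
have L1 : 0 <= fix_laplace k true a by case/andP: (fix_laplace01 k true a0) => /ltW.
have L0 : 0 <= fix_laplace k false a by case/andP: (fix_laplace01 k false a0) => /ltW.
have EL0 : fix_laplace k false a = bp_laplace (bp_xi_fix k) (bp_lambda_fix k + 1) a.
  by rewrite /fix_laplace addr0.
have EL1 : fix_laplace k true a = bp_laplace (bp_xi_fix k + 1) (bp_lambda_fix k + 1) a by [].
move: H1 H0 I1 I0 T1 T0 (measurable_bp_density (bp_xi_fix k) (bp_lambda_fix k))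
  (measurable_bp_density (bp_xi_fix k + 1) (bp_lambda_fix k + 1))
  (measurable_bp_density (bp_xi_fix k) (bp_lambda_fix k + 1))
  (bp_density_ge0 hx hl) (bp_density_ge0 x1 l1) (bp_density_ge0 hx l0).
rewrite -EL1 -EL0.
move: (bp_density (bp_xi_fix k) (bp_lambda_fix k)) (bp_density (bp_xi_fix k + 1) (bp_lambda_fix k + 1))
  (bp_density (bp_xi_fix k) (bp_lambda_fix k + 1)) (fix_laplace k true a)
  (fix_laplace k false a) L1 L0.
move=> g g1 g0 l_true l_false L1 L0 H1 H0 I1 I0 T1 T0 mg mg1 mg0 g_ge0 g1_ge0 g0_ge0 law.
have E1 (t : R) : expR (- (a * `|t| + b)) = expR (- b) * expR (- (a * `|t|)).
  by rewrite opprD expRD mulrC.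
have me := @measurable_expM2 R a.
have e0 (t : R) : 0 <= expR (- (a * `|t|)) by exact: expR_ge0.
have eb0 : 0 <= expR (- b) by exact: expR_ge0.
have main (u v : R -> R) : measurable_fun setT u -> measurable_fun setT v ->
    (forall t, 0 <= u t) -> (forall t, 0 <= v t) ->
    \int[P]_w mix (theta (inl k) w) (u (theta (inl k) w)) (v (theta (inl k) w)) =
    fine (p1%:E * (\int[mu]_t (u t * g1 t)%:E) + p0%:E * (\int[mu]_t (v t * g0 t)%:E))%E.
  move=> mu_ mv u0 v0; rewrite /Rintegral; apply: (f_equal fine).
  rewrite -(integral_mix mg1 mg0 g1_ge0 g0_ge0 p1_ge0 p0_ge0 H1 H0)//.
  apply: (law (fun t => mix t (u t) (v t))); first exact: measurable_mix.
  by move=> t; rewrite divr_ge0 ?(ltW (mix_den _))// addr_ge0// mulr_ge0.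
have mE : measurable_fun setT (fun t : R => expR (- (a * `|t| + b))).
  by rewrite (funext E1); exact: measurable_funM.
apply: etrans (main _ _ mE me (fun t => expR_ge0 _) e0) _.
apply: etrans _ (esym (main (fun=> expR (- b) * l_true) (fun=> l_false)
  (measurable_cst _) (measurable_cst _) (fun=> mulr_ge0 eb0 L1) (fun=> L0))).
apply: (f_equal fine); congr (_ * _ + _ * _)%E.
  transitivity (\int[mu]_t (expR (- b) * (expR (- (a * `|t|)) * g1 t))%:E)%E.
    by apply: eq_integral => t _; rewrite E1 mulrA.
  have mE1 : measurable_fun setT (fun t : R => expR (- (a * `|t|)) * g1 t) by exact: measurable_funM.
  rewrite (integral_cstM eb0 mE1 (fun t => mulr_ge0 (e0 t) (g1_ge0 t))).
  by rewrite I1 (integral_cstM (mulr_ge0 eb0 L1) mg1 g1_ge0) T1 mule1.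
by rewrite I0 (integral_cstM L0 mg0 g0_ge0) T0 mule1.
Qed.

(** The observed atoms have rate [obs_mass] times a beta prime law in the weight, so
    that [exp (- a * t)] may be replaced by its mean [ord_laplace a] for each
    location ([F1] and [F2] below); the unobserved atoms ([F3]) split off as a
    second factor. *)
Lemma ordinary_factor (a b : Psi -> R) :
  measurable_fun setT a -> (forall p, 0 <= a p) ->
  measurable_fun setT b -> (forall p, 0 <= b p) ->
  eN (\int[weight_rate h \x bp_G h]_s (1 - mix s.1
    (expR (- (a s.2 * `|s.1| + b s.2))) (expR (- (a s.2 * `|s.1|))))%:E)%E =
  eN (\int[weight_rate h \x bp_G h]_s (1 - mix s.1
    (expR (- b s.2) * ord_laplace (a s.2)) 1)%:E)%E * eN (unobserved_exponent h a).
Proof.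
move=> ma a0 mb b0.
pose r := (weight_rate h \x bp_G h)%E.
pose A (s : R * Psi) := expR (- (a s.2 * `|s.1|)).
pose B (s : R * Psi) := expR (- b s.2).
pose C (s : R * Psi) := ord_laplace (a s.2).
have mA : measurable_fun setT A.
  apply: measurable_expRN; apply: measurable_funM.
    exact: (measurableT_comp ma measurable_snd).
  by apply: measurableT_comp => //; exact: measurable_fst.
have mB : measurable_fun setT B.
  by apply: measurable_expRN; exact: (measurableT_comp mb measurable_snd).
have mC : measurable_fun setT C.
  apply: (measurableT_comp measurable_ord_laplace).
  exact: (measurableT_comp ma measurable_snd).
have A01 s : 0 <= A s <= 1 by rewrite expR_ge0 expR_le1 oppr_le0 mulr_ge0.
have B01 s : 0 <= B s <= 1 by rewrite expR_ge0 expR_le1 oppr_le0 b0.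
have C01 s : 0 <= C s <= 1 by have /andP[/ltW -> ->] := ord_laplace01 (a0 s.2).
pose o (s : R * Psi) := `|s.1| / (1 + `|s.1|).
have mo : measurable_fun setT o.
  have mn : measurable_fun setT (fun s : R * Psi => `|s.1|).
    by apply: measurableT_comp => //; exact: measurable_fst.
  apply: measurable_funM => //; apply: measurable_funinv; exact: measurable_funD.
have o0 s : 0 <= o s by rewrite divr_ge0// ltW// mix_den.
pose F1 s := (1 - B s * A s) * o s.
pose F2 s := (1 - B s * C s) * o s.
pose F3 (s : R * Psi) := (1 - A s) / (1 + `|s.1|).
have mF1 : measurable_fun setT F1.
  by apply: measurable_funM => //; apply: measurable_funB => //; exact: measurable_funM.
have mF2 : measurable_fun setT F2.
  by apply: measurable_funM => //; apply: measurable_funB => //; exact: measurable_funM.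
have mF3 : measurable_fun setT F3.
  apply: measurable_funM; first exact: measurable_funB.
  apply: measurable_funinv; apply: measurable_funD => //.
  by apply: measurableT_comp => //; exact: measurable_fst.
have m01 (u v : R) : 0 <= u <= 1 -> 0 <= v <= 1 -> 0 <= u * v <= 1.
  by move=> /andP[u0 u1] /andP[v0 v1]; rewrite mulr_ge0//= mulr_ile1.
have F1_ge0 s : 0 <= F1 s.
  by rewrite mulr_ge0// subr_ge0; have /andP[] := m01 _ _ (B01 s) (A01 s).
have F2_ge0 s : 0 <= F2 s.
  by rewrite mulr_ge0// subr_ge0; have /andP[] := m01 _ _ (B01 s) (C01 s).
have F3_ge0 s : 0 <= F3 s.
  by rewrite divr_ge0 ?(ltW (mix_den _))// subr_ge0; have /andP[] := A01 s.
have E12 : (\int[r]_s (F1 s)%:E = \int[r]_s (F2 s)%:E)%E.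
  apply: etrans (rate_integral h mF1 F1_ge0) _.
  apply: etrans _ (esym (rate_integral h mF2 F2_ge0)).
  apply: eq_integral => p _.
  have om0 := obs_mass_ge0 h.
  have eb : 0 <= expR (- b p) <= 1 by have := B01 (0, p).
  have lp : 0 <= ord_laplace (a p) <= 1 by have := C01 (0, p).
  have cd : 0 <= obs_mass h * expR (- b p) <= obs_mass h.
    by case/andP: eb => e0 e1; rewrite mulr_ge0//= ler_piMr.
  have cd' : 0 <= obs_mass h * expR (- b p) * ord_laplace (a p) <= obs_mass h.
    case/andP: lp => l0 l1; case/andP: cd => c0 c1.
    by rewrite mulr_ge0//= (le_trans _ c1)// ler_piMr.
  transitivity (\int[mu]_t ((obs_mass h - obs_mass h * expR (- b p) * expR (- (a p * `|t|)))
      * bp_density (bp_xi h + 1) (bp_lambda h + 1) t)%:E)%E.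
    apply: eq_integral => t _; apply: (f_equal EFin).
    transitivity ((1 - expR (- b p) * expR (- (a p * `|t|))) * (`|t| / (1 + `|t|) * rate_density h t)).
      exact: (esym (mulrA (1 - expR (- b p) * expR (- (a p * `|t|))) (`|t| / (1 + `|t|)) (rate_density h t))).
    by rewrite rate_density_observed; ring.
  rewrite (bp_density_integral_lin (ord_post1 h) (ord_post2 h) (a0 p) cd).
  transitivity (\int[mu]_t ((obs_mass h - obs_mass h * expR (- b p) * ord_laplace (a p))
      * bp_density (bp_xi h + 1) (bp_lambda h + 1) t)%:E)%E; last first.
    apply: eq_integral => t _; apply: (f_equal EFin).
    transitivity ((1 - expR (- b p) * ord_laplace (a p)) * (`|t| / (1 + `|t|) * rate_density h t)).
      by rewrite rate_density_observed; ring.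
    exact: (mulrA (1 - expR (- b p) * ord_laplace (a p)) (`|t| / (1 + `|t|)) (rate_density h t)).
  transitivity ((obs_mass h - obs_mass h * expR (- b p) * ord_laplace (a p))%:E *
     \int[mu]_t (bp_density (bp_xi h + 1) (bp_lambda h + 1) t)%:E)%E.
    by rewrite (bp_density_total (ord_post1 h) (ord_post2 h)) mule1.
  rewrite -ge0_integralZl//.
  - by apply/measurable_EFinP; exact: measurable_bp_density.
  - by move=> t _; rewrite lee_fin; apply: bp_density_ge0; [exact: (ord_post1 h)|exact: (ord_post2 h)].
  - by rewrite lee_fin subr_ge0; case/andP: cd'.
have E3 : (\int[r]_s (F3 s)%:E = unobserved_exponent h a)%E.
  apply: etrans (rate_integral h mF3 F3_ge0) _.
  have mA1 : measurable_fun setT (fun s => 1 - A s) by exact: measurable_funB.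
  have A1 s : 0 <= 1 - A s by rewrite subr_ge0; case/andP: (A01 s).
  apply: etrans _ (esym (rate_integral (thinned h) mA1 A1)).
  apply: eq_integral => p _; apply: eq_integral => t _; apply: (f_equal EFin).
  by rewrite rate_density_thinned /F3/= mulrAC mulrA.
have D : (\int[r]_s (F1 s + F3 s)%:E = \int[r]_s (F1 s)%:E + \int[r]_s (F3 s)%:E)%E.
  exact: integral_addEFin.
rewrite -eND; last 2 first.
- apply: integral_ge0 => s _; rewrite lee_fin subr_ge0.
  have i01 : 0 <= (1 : R) <= 1 by rewrite ler01 lexx.
  by have /andP[] := mix_ge01 s.1 (m01 _ _ (B01 s) (C01 s)) i01.
- apply: integral_ge0 => s _; rewrite lee_fin subr_ge0.
  by have /andP[] := A01 s.
apply: (f_equal (@eN R)).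
transitivity (\int[r]_s (F1 s + F3 s)%:E)%E.
  apply: eq_integral => s _; apply: (f_equal EFin).
  rewrite opprD expRD -/(A s) -/(B s) /F1 /F3 /o /mix; field.
  by rewrite gt_eqF// mix_den.
rewrite D E12 E3; congr (_ + _)%E.
apply: eq_integral => s _; apply: (f_equal EFin).
rewrite -/(B s) -/(C s) /F2 /o /mix; field.
by rewrite gt_eqF// mix_den.
Qed.

End joint.

(** * The posterior Laplace functional *)

Section joint_laplace.
Context (R : realType) d (Omega : measurableType d) (P : probability Omega R)
  dPsi (Psi : measurableType dPsi) (h : beta_prime_param R Psi)
  (theta : 'I_(bp_K h) + nat -> {RV P >-> R}) (psi : 'I_(bp_K h) + nat -> {RV P >-> Psi})
  (x : 'I_(bp_K h) + nat -> {RV P >-> bool}) (Theta X : Omega -> measure_space R Psi).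
Hypothesis singletons : forall p : Psi, measurable [set p].
Hypothesis prior : beta_prime_atoms theta psi.
Hypothesis marks : odds_bernoulli_marks theta psi x.
Hypothesis ThetaE : is_atomic_sum theta psi Theta.
Hypothesis XE : is_atomic_sum (fun k omega => (x k omega)%:R%R) psi X.

Local Notation K := (bp_K h).
Local Notation mint a M := (\int[M : {measure set Psi -> \bar R}]_p (a p)%:E)%E.
Local Notation F := (fixed_set h).
Let crm := bp_crm prior.
Let th0 k w : 0 < theta k w := crm_weight_gt0 crm k w.
Let fixl k w : psi (inl k) w = bp_loc k := crm_fix_loc crm k w.

(** Its integral against the observed measure is minus the logarithm of the product
    of the factors of the observed ordinary atoms.  The fixed locations, which have
    factors of their own, are left out. *)
Definition neglog_laplace (a : Psi -> R) (p : Psi) : R := \1_(~` F) p * - ln (ord_laplace h (a p)).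

(** The mark of a fixed atom, read off the observed measure. *)
Definition seen_at (k : 'I_K) (M : measure_space R Psi) : bool :=
  (0 < measure_eval [set bp_loc k] M)%E.

Definition post_laplace (a : Psi -> R) (M : measure_space R Psi) : R :=
  \prod_(k < K) fix_laplace k (seen_at k M) (a (bp_loc k)) *
  eN (mint (neglog_laplace a) M) * eN (unobserved_exponent h a).

Let mF : measurable F := measurable_fixed_set h singletons.

Lemma measurable_neglog_laplace (a : Psi -> R) :
  measurable_fun setT a -> measurable_fun setT (neglog_laplace a).
Proof.
move=> ma; apply: measurable_funM.
  by apply: measurable_indic; exact: measurableC.
apply: measurable_funN; apply: (measurableT_comp (@measurable_ln R)).
exact: (measurableT_comp (measurable_ord_laplace h) ma).
Qed.

Lemma neglog_laplace_ge0 (a : Psi -> R) p : (forall q, 0 <= a q) -> 0 <= neglog_laplace a p.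
Proof.
move=> a0; rewrite mulr_ge0 ?indicE// oppr_ge0 ln_le0//.
by have /andP[] := ord_laplace01 h (a0 p).
Qed.

Lemma measurable_seen_at k : measurable_fun setT (seen_at k : measure_space R Psi -> bool).
Proof.
apply: measurable_fun_lte => //; exact: measurable_measure_eval.
Qed.

Lemma measurable_post_laplace (a : Psi -> R) : measurable_fun setT a -> (forall p, 0 <= a p) ->
  measurable_fun setT (post_laplace a : measure_space R Psi -> R).
Proof.
move=> ma a0; apply: measurable_funM => //; apply: measurable_funM.
  apply: measurable_prod => k _.
  pose g (e : bool) : R := fix_laplace k e (a (bp_loc k)).
  by apply: (@measurableT_comp _ _ _ _ _ _ g) => //; exact: measurable_seen_at.
apply: (@measurableT_comp _ _ _ _ _ _ (@eN R)); first exact: measurable_eN.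
apply: measurable_measure_integral; first exact: measurable_neglog_laplace.
by move=> p; exact: neglog_laplace_ge0.
Qed.

Lemma post_laplace01 (a : Psi -> R) (M : measure_space R Psi) :
  (forall p, 0 <= a p) -> 0 <= post_laplace a M <= 1.
Proof.
have p01 (u v : R) : 0 <= u <= 1 -> 0 <= v <= 1 -> 0 <= u * v <= 1.
  by move=> /andP[u0 u1] /andP[v0 v1]; rewrite mulr_ge0//= mulr_ile1.
move=> a0; have e01 (y : \bar R) : (0 <= y)%E -> 0 <= eN y <= 1 by move=> y0; rewrite eN_ge0 eN_le1.
rewrite /post_laplace; apply: (p01); first apply: (p01).
- by apply: prod01 => k; have /andP[/ltW -> ->] := fix_laplace01 k (seen_at k M) (a0 (bp_loc k)).
- by apply: e01; apply: integral_ge0 => p _; rewrite lee_fin neglog_laplace_ge0.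
- apply: e01; apply: integral_ge0 => s _.
  by rewrite lee_fin subr_ge0 expR_le1 oppr_le0 mulr_ge0.
Qed.

Lemma mintX (a : Psi -> R) w : measurable_fun setT a -> (forall p, 0 <= a p) ->
  mint a (X w) = atom_sum (fun k => ((x k w)%:R * a (psi k w))%:E).
Proof.
move=> ma a0.
apply: (@integral_atomic _ _ _ _ (fun k => (x k w)%:R) (psi ^~ w) (fun k => ler0n _ _) (X w)) => //.
by move=> A mA; exact: XE.
Qed.

Lemma mintTheta (a : Psi -> R) w : measurable_fun setT a -> (forall p, 0 <= a p) ->
  mint a (Theta w) = atom_sum (fun k => (theta k w * a (psi k w))%:E).
Proof.
move=> ma a0.
apply: (@integral_atomic _ _ _ _ (theta ^~ w) (psi ^~ w) (fun k => ltW (th0 k w)) (Theta w)) => //.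
by move=> A mA; exact: ThetaE.
Qed.

Lemma measurable_X : measurable_fun setT X.
Proof.
apply: (measurable_atomic_sum _ _ _ XE) => k //.
apply: (@measurableT_comp _ _ _ _ _ _ (fun b : bool => b%:R : R)) => //.
Qed.

Lemma measurable_Theta : measurable_fun setT Theta.
Proof.
apply: (measurable_atomic_sum _ _ _ ThetaE) => k; try exact: measurable_funPT.
by move=> w; exact: ltW.
Qed.

Lemma seen_at_mark k w : injective (psi ^~ w) -> seen_at k (X w) = x (inl k) w.
Proof.
move=> inj; rewrite /seen_at XE//; case: (boolP (x (inl k) w)) => xk.
  apply: (@lt_le_trans _ _ 1%E); first by rewrite lte_fin.
  apply: esum_ge; exists [set inl k]; first by split => //; exact: finite_set1.
  by rewrite fsbig_set1 xk mul1e diracE mem_set.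
rewrite esum1 ?ltxx// => i _.
have [->|ik] := eqVneq i (inl k); first by rewrite (negbTE xk) mul0e.
rewrite diracE memNset ?mule0//= -(fixl k w) => /inj ik'.
by rewrite ik' eqxx in ik.
Qed.

Lemma avoid_fixed : {ae P, forall w, forall j, ~ F (psi (inr j) w)}.
Proof.
apply: filterS (ord_avoids_family singletons prior (@bp_loc _ _ _ h)) => w H j [i _] E.
exact: (H i j (esym E)).
Qed.

(** The mark of an atom at [p] adds [b p] to the exponent when it is 1; once the
    marks are averaged out, [fixed_factor] and [ordinary_factor] apply. *)
Lemma joint_laplace (a b : Psi -> R) : measurable_fun setT a -> (forall p, 0 <= a p) ->
  measurable_fun setT b -> (forall p, 0 <= b p) ->
  \int[P]_w (eN (mint b (X w)) * eN (mint a (Theta w))) =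
  \prod_(k < K) \int[P]_w mix (theta (inl k) w)
     (expR (- b (bp_loc k)) * fix_laplace k true (a (bp_loc k)))
     (fix_laplace k false (a (bp_loc k))) *
  (eN (\int[weight_rate h \x bp_G h]_s
    (1 - mix s.1 (expR (- b s.2) * ord_laplace h (a s.2)) 1)%:E)%E *
   eN (unobserved_exponent h a)).
Proof.
move=> ma a0 mb b0.
pose f (y : R * Psi) (e : bool) : R := a y.2 * `|y.1| + e%:R * b y.2.
have ma2 : measurable_fun setT (fun y : R * Psi => a y.2 * `|y.1|).
  apply: measurable_funM; first exact: (measurableT_comp ma measurable_snd).
  by apply: measurableT_comp => //; exact: measurable_fst.
have mb2 : measurable_fun setT (fun y : R * Psi => b y.2).
  exact: (measurableT_comp mb measurable_snd).
have mf e : measurable_fun setT (f ^~ e).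
  by apply: measurable_funD => //; exact: measurable_funM.
have f0 y e : 0 <= f y e by rewrite addr_ge0 ?mulr_ge0.
have E := marked_crm_laplace prior marks (f := fun _ => f) (g := f) (fun _ => mf)
  (fun _ => f0) (fun _ => erefl).
transitivity (\int[P]_w eN (atom_sum (fun k => (f (theta k w, psi k w) (x k w))%:E))).
  apply: eq_Rintegral => w _; rewrite mintX// mintTheta// -eND.
  - rewrite /atom_sum; congr eN.
    rewrite addeACA -big_split/= -nneseriesD//; last 2 first.
    + by move=> j _ _; rewrite lee_fin mulr_ge0.
    + by move=> j _ _; rewrite lee_fin mulr_ge0// ltW.
    congr (_ + _)%E; [apply: eq_bigr => k _|apply: eq_eseriesr => j _];
      by rewrite -EFinD /f /= gtr0_norm// addrC [theta _ _ * _]mulrC.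
  - by apply: atom_sum_ge0 => k; rewrite lee_fin mulr_ge0.
  - by apply: atom_sum_ge0 => k; rewrite lee_fin mulr_ge0// ltW.
rewrite E; congr (_ * _).
  apply: eq_bigr => k _; rewrite -(fixed_factor prior k (a0 _) (b0 _)).
  by apply: eq_Rintegral => w _; rewrite /f /= mul1r mul0r addr0.
rewrite -(ordinary_factor h ma a0 mb b0); apply: (f_equal (@eN R)).
by apply: eq_integral => s _; rewrite /f /= mul1r mul0r addr0.
Qed.

(** The logarithms of the factors in [post_laplace] are exponents attached to the
    marked atoms, and only the marks and the locations enter, not the weights.
    Almost surely the locations are distinct, which identifies the marks of the
    fixed atoms with [seen_at]. *)
Lemma joint_post_laplace (a b : Psi -> R) : measurable_fun setT a -> (forall p, 0 <= a p) ->
  measurable_fun setT b -> (forall p, 0 <= b p) ->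
  \int[P]_w (eN (mint b (X w)) * post_laplace a (X w)) =
  \prod_(k < K) \int[P]_w mix (theta (inl k) w)
     (expR (- b (bp_loc k)) * fix_laplace k true (a (bp_loc k)))
     (fix_laplace k false (a (bp_loc k))) *
  (eN (\int[weight_rate h \x bp_G h]_s
    (1 - mix s.1 (expR (- b s.2) * ord_laplace h (a s.2)) 1)%:E)%E *
   eN (unobserved_exponent h a)).
Proof.
move=> ma a0 mb b0.
pose n (k : 'I_K) e := - ln (fix_laplace k e (a (bp_loc k))).
have n0 k e : 0 <= n k e.
  by rewrite oppr_ge0 ln_le0//; have /andP[] := fix_laplace01 k e (a0 (bp_loc k)).
have nE k e : expR (- n k e) = fix_laplace k e (a (bp_loc k)).
  by rewrite opprK lnK// posrE; have /andP[] := fix_laplace01 k e (a0 (bp_loc k)).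
pose l p := - ln (ord_laplace h (a p)).
have l0 p : 0 <= l p.
  by rewrite oppr_ge0 ln_le0//; have /andP[] := ord_laplace01 h (a0 p).
have lE p : expR (- l p) = ord_laplace h (a p).
  by rewrite opprK lnK// posrE; have /andP[] := ord_laplace01 h (a0 p).
have ml : measurable_fun setT l.
  apply: measurable_funN; apply: (measurableT_comp (@measurable_ln R)).
  exact: (measurableT_comp (measurable_ord_laplace h) ma).
pose g (y : R * Psi) (e : bool) : R := e%:R * (b y.2 + l y.2).
pose G (k : 'I_K + nat) (y : R * Psi) (e : bool) : R := match k with
  | inl k => e%:R * b y.2 + n k e | inr _ => g y e end.
have mb2 : measurable_fun setT (fun y : R * Psi => b y.2).
  exact: (measurableT_comp mb measurable_snd).
have ml2 : measurable_fun setT (fun y : R * Psi => l y.2).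
  exact: (measurableT_comp ml measurable_snd).
have mG k e : measurable_fun setT (fun y => G k y e).
  case: k => [k|j].
    change (measurable_fun setT (fun y : R * Psi => e%:R * b y.2 + n k e)).
    by apply: measurable_funD; [apply: measurable_funM|exact: measurable_cst].
  change (measurable_fun setT (fun y : R * Psi => e%:R * (b y.2 + l y.2))).
  by apply: measurable_funM; [exact: measurable_cst|exact: measurable_funD].
have G0 k y e : 0 <= G k y e.
  have e0 : 0 <= e%:R :> R by exact: ler0n.
  case: k => [k|j]; first exact: (addr_ge0 (mulr_ge0 e0 (b0 _)) (n0 k e)).
  exact: (mulr_ge0 e0 (addr_ge0 (b0 _) (l0 _))).
have E := marked_crm_laplace prior marks (f := G) (g := g) mG G0 (fun _ => erefl).
have mtot : measurable_fun setT (fun w => atom_sum (fun k => (G k (theta k w, psi k w) (x k w))%:E)).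
  apply: measurable_atom_sum => [k|k w]; last by rewrite lee_fin.
  apply/measurable_EFinP.
  have -> : (fun w => G k (theta k w, psi k w) (x k w)) =
      (fun w => if x k w then G k (theta k w, psi k w) true else G k (theta k w, psi k w) false).
    by apply/funext => w; case: (x k w).
  apply: measurable_fun_ifT; first exact: (measurable_funPT (x k)).
    by apply: (measurableT_comp (mG k true)); exact: measurable_fun_pair.
  by apply: (measurableT_comp (mG k false)); exact: measurable_fun_pair.
transitivity (\int[P]_w (eN (atom_sum (fun k => (G k (theta k w, psi k w) (x k w))%:E)) *
   eN (unobserved_exponent h a))).
  have mX := measurable_X.
  have bpl : bmeas (fun w => post_laplace a (X w)).
    apply: bmeas01; last by move=> w; exact: post_laplace01.
    exact: (measurableT_comp (measurable_post_laplace ma a0) mX).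
  have beX : bmeas (fun w => eN (mint b (X w))).
    apply: bmeas_eN.
      exact: (measurableT_comp (measurable_measure_integral mb b0) mX).
    by move=> w; apply: integral_ge0 => p _; rewrite lee_fin.
  apply: E_ae.
  - exact: bmeasM.
  - apply: bmeasM; last exact: bmeas_cst.
    by apply: bmeas_eN => // w; apply: atom_sum_ge0 => k; rewrite lee_fin.
  apply: filterS2 (crm_distinct crm) avoid_fixed => w inj av.
  rewrite /post_laplace !mulrA; congr (_ * _).
  have mn := measurable_neglog_laplace ma; have nl0 p := neglog_laplace_ge0 p a0.
  rewrite (mintX _ mb b0) (mintX _ mn nl0) !eN_atom_sum; last 3 first.
  - by move=> k; rewrite lee_fin.
  - by move=> k; rewrite lee_fin mulr_ge0.
  - by move=> k; rewrite lee_fin mulr_ge0.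
  set p1 := \prod_(k < K) _; set p2 := \prod_(k < K) _; set p3 := \prod_(k < K) _.
  transitivity (p1 * p2 * p3 *
    (eN (\sum_(j <oo) ((x (inr j) w)%:R * b (psi (inr j) w))%:E)%E *
     eN (\sum_(j <oo) ((x (inr j) w)%:R * neglog_laplace a (psi (inr j) w))%:E)%E)); first by ring.
  congr (_ * _).
    rewrite /p1 /p2 /p3 -!big_split/=; apply: eq_bigr => k _.
    rewrite /neglog_laplace fixl indicE memNset; last by move=> /=; apply; exists k.
    rewrite mul0r mulr0 eN0 mulr1 seen_at_mark// -nE /G /eN /=.
    by rewrite opprD expRD.
  rewrite -eND; last 2 first.
  - by apply: nneseries_ge0 => j _ _; rewrite lee_fin mulr_ge0.
  - by apply: nneseries_ge0 => j _ _; rewrite lee_fin mulr_ge0.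
  rewrite -nneseriesD//; last 2 first.
  - by move=> j _ _; rewrite lee_fin mulr_ge0.
  - by move=> j _ _; rewrite lee_fin mulr_ge0.
  congr eN; apply: eq_eseriesr => j _; rewrite -EFinD /G /g /= -mulrDr.
  congr (_ * (_ + _))%:E; rewrite /neglog_laplace indicE mem_set ?mul1r//; exact: av.
transitivity (\int[P]_w (eN (unobserved_exponent h a) *
   eN (atom_sum (fun k => (G k (theta k w, psi k w) (x k w))%:E)) + 0)).
  by apply: eq_Rintegral => w _; rewrite addr0 mulrC.
have bT : bmeas (fun w => eN (atom_sum (fun k => (G k (theta k w, psi k w) (x k w))%:E))).
  by apply: bmeas_eN => // w; apply: atom_sum_ge0 => k; rewrite lee_fin.
apply: (etrans (E_lin P _ bT (bmeas_cst _ 0))).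
rewrite E_cst addr0.
rewrite E.
apply: (etrans (mulrC _ _)); apply: (etrans (esym (mulrA _ _ _))).
apply: (f_equal2 *%R); last apply: (f_equal2 *%R) => //.
  apply: eq_bigr => k _; apply: eq_Rintegral => w _; apply: f_equal2.
    change (expR (- (1 * b (bp_loc k) + n k true)) =
      expR (- b (bp_loc k)) * fix_laplace k true (a (bp_loc k))).
    by rewrite -(nE k true) mul1r opprD expRD.
  change (expR (- (0 * b (bp_loc k) + n k false)) = fix_laplace k false (a (bp_loc k))).
  by rewrite -(nE k false) mul0r add0r.
apply: (f_equal (@eN R)); apply: eq_integral => s _; rewrite /g /=.
by rewrite mul1r mul0r oppr0 expR0 opprD expRD lE.
Qed.

End joint_laplace.

(** * Disintegration from joint Laplace functionals *)

Section laplace_functionals.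
Context (R : realType) dPsi (Psi : measurableType dPsi).
Local Notation MS := (measure_space R Psi).
Local Notation mint a M := (\int[M : {measure set Psi -> \bar R}]_p (a p)%:E)%E.

Definition linear_functionals : set (MS -> \bar R) :=
  [set phi | exists2 a : Psi -> R, measurable_fun setT a /\ (forall p, 0 <= a p) &
    phi = (fun M => mint a M)].

Lemma linear_functionals_ge0 phi : linear_functionals phi ->
  measurable_fun setT phi /\ forall M, (0 <= phi M)%E.
Proof.
move=> [a [ma a0] ->]; split; first exact: measurable_measure_integral.
by move=> M; apply: integral_ge0 => p _; rewrite lee_fin.
Qed.

Lemma linear_functionals0 : linear_functionals (cst 0%E).
Proof. by exists (fun=> 0) => //; apply/funext => M; rewrite /= integral0. Qed.

Lemma linear_functionalsD phi phi' : linear_functionals phi -> linear_functionals phi' ->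
  linear_functionals (fun M => phi M + phi' M)%E.
Proof.
move=> [a [ma a0] ->] [b [mb b0] ->]; exists (fun p => a p + b p).
  by split => [|p]; [exact: measurable_funD|exact: addr_ge0].
by apply/funext => M; rewrite integral_addEFin.
Qed.

(** The evaluation at [A] is the functional of the indicator of [A]. *)
Lemma linear_functionals_generate (E : set MS) : measurable E ->
  <<s \bigcup_(phi in linear_functionals) preimage_set_system setT phi measurable >> E.
Proof.
move: E; apply: smallest_sub; first exact: smallest_sigma_algebra.
move=> _ [A mA [V mV <-]]; apply: sub_sigma_algebra.
exists (fun M : MS => mint (\1_A : Psi -> R) M).
  exists (\1_A : Psi -> R); last by [].
  by split; [exact: measurable_indic|move=> p; rewrite indicE ler0n].
exists V => //; rewrite !setTI; congr (_ @^-1` V); apply/funext => M.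
by rewrite integral_indic// setIT.
Qed.

End laplace_functionals.

Section disintegration.
Context (R : realType) d (Omega : measurableType d) (P : probability Omega R)
  dPsi (Psi : measurableType dPsi).
Local Notation MS := (measure_space R Psi).
Local Notation mint a M := (\int[M : {measure set Psi -> \bar R}]_p (a p)%:E)%E.
Variables (X Theta : Omega -> MS) (kappa : Omega -> probability MS R).
Hypothesis mX : measurable_fun setT X.
Hypothesis mTheta : measurable_fun setT Theta.

Let sX : set (set Omega) := preimage_set_system [set: Omega] X measurable.
Let TX := g_sigma_algebraType sX.

Hypothesis kappa_measurable : forall a : Psi -> R, measurable_fun setT a ->
  (forall p, 0 <= a p) ->
  measurable_fun setT (fun w : TX => \int[kappa w]_M eN (mint a M)).
Hypothesis kappa_joint : forall a b : Psi -> R, measurable_fun setT a ->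
  (forall p, 0 <= a p) -> measurable_fun setT b -> (forall p, 0 <= b p) ->
  \int[P]_w (eN (mint b (X w)) * eN (mint a (Theta w))) =
  \int[P]_w (eN (mint b (X w)) * \int[kappa w]_M eN (mint a M)).

Let sXE : <<s sX >> `<=` sX.
Proof.
apply: smallest_sub => //.
by apply: sigma_algebra_preimage; exact: sigma_algebra_measurable.
Qed.

Let sXm : <<s sX >> `<=` measurable.
Proof. by move=> A /sXE [C mC <-]; exact: mX. Qed.

Let mid : measurable_fun setT (id : Omega -> TX).
Proof. by move=> _ A mA; rewrite setTI; exact: sXm. Qed.

Let H : set (MS -> R) :=
  [set f | bmeas f /\ measurable_fun setT (fun w : TX => \int[kappa w]_M f M)].

Let bcH : bounded_class H.
Proof.
split.
- move=> c f g [bf mf] [bg mg]; split; first exact: bmeas_lin.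
  rewrite (_ : (fun w : TX => _) =
    (fun w : TX => c * \int[kappa w]_M f M + \int[kappa w]_M g M)); last first.
    by apply/funext => w; rewrite E_lin.
  by apply: measurable_funD => //; exact: measurable_funM.
- move=> f g M Hf fM fg; split; first by apply: (bmeas_lim _ fM fg) => n; have [] := Hf n.
  apply: (measurable_fun_cvg (h := fun n (w : TX) => \int[kappa w]_M f n M)).
    by move=> n; have [] := Hf n.
  by move=> w _; apply: (E_lim (M := M)) => // n; have [] := Hf n.
Qed.

Let Hindic E : measurable E -> H (\1_E).
Proof.
move=> mE; apply: (multiplicative_system (Phi := @linear_functionals R _ Psi) bcH).
- by move=> phi /linear_functionals_ge0[].
- exact: linear_functionals0.
- exact: linear_functionalsD.
- move=> phi Pphi; have [mphi phi0] := linear_functionals_ge0 Pphi.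
  split; first exact: bmeas_eN.
  by case: Pphi => a [ma a0] ->; exact: kappa_measurable.
- exact: linear_functionals_generate.
Qed.

Let Hbmeas f : bmeas f -> H f.
Proof.
move=> [mf [M fM]].
have HfM : H (fun y => f y + M).
  apply: (bounded_class_measurable bcH _ (M := M + M)) => //.
    by apply: measurable_funD.
  by move=> y; have := fM y; rewrite ler_norml => /andP[]; lra.
have H1 : H (\1_setT) := Hindic measurableT.
apply: (bc_ext (bc_lin bcH (- M) H1 HfM)) => y.
by rewrite indicT mulr1 addrC addrK.
Qed.

Let kbm f : bmeas f -> bmeas (fun w : Omega => \int[kappa w]_M f M).
Proof.
move=> bf; split; first exact: (measurableT_comp (Hbmeas bf).2 mid).
by have [_ [N fN]] := bf; exists N => w; exact: E_norm_le.
Qed.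

Let bfun_kappa Z : bmeas Z ->
  bfun (fun f : MS -> R => \int[P]_w ((\int[kappa w]_M f M) * Z w)).
Proof.
move=> bZ; split.
- move=> c f g bf bg.
  rewrite -E_lin; [|by apply: bmeasM => //; exact: kbm..].
  by apply: eq_Rintegral => w _; rewrite E_lin// mulrDl mulrA.
- move=> f g M bf fM fg; have [_ [N ZN]] := bZ.
  apply: (E_lim (M := M * N)).
  + by move=> n; apply: bmeasM => //; exact: kbm.
  + move=> n w; rewrite normrM ler_pM//; exact: E_norm_le (bf n) (fM n).
  + by move=> w; apply: cvgMl; apply: (E_lim (M := M)).
Qed.

Let joint_indic B C : measurable B -> measurable C ->
  \int[P]_w (\1_B (Theta w) * \1_C (X w)) =
  \int[P]_w ((\int[kappa w]_M \1_B M) * \1_C (X w)).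
Proof.
move=> mB mC.
have bCX : bmeas (fun w => \1_C (X w) : R) by apply: bmeas_compT => //; exact: bmeas_indic.
apply: (bfun_ext_laplace (bfun_E P mTheta bCX) (bfun_kappa bCX)
  (@linear_functionals_ge0 R _ Psi) (@linear_functionals0 R _ Psi)
  (@linear_functionalsD R _ Psi) _ (linear_functionals_generate mB)).
move=> phi Pphi; have [mphi phi0] := linear_functionals_ge0 Pphi.
have bphi : bmeas (fun M => eN (phi M)) by exact: bmeas_eN.
have b1 : bmeas (fun w => eN (phi (Theta w))).
  exact: (@bmeas_compT _ _ _ _ _ Theta (fun M => eN (phi M))).
have b2 := kbm bphi.
transitivity (\int[P]_w (\1_C (X w) * eN (phi (Theta w)))).
  by apply: eq_Rintegral => w _; rewrite mulrC.
transitivity (\int[P]_w (\1_C (X w) * \int[kappa w]_M eN (phi M))); last first.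
  by apply: eq_Rintegral => w _; rewrite mulrC.
apply: (bfun_ext_laplace (bfun_E P mX b1) (bfun_E P mX b2)
  (@linear_functionals_ge0 R _ Psi) (@linear_functionals0 R _ Psi)
  (@linear_functionalsD R _ Psi) _ (linear_functionals_generate mC)).
move=> _ [b [mb b0] ->]; case: Pphi => a [ma a0] ->.
exact: kappa_joint.
Qed.

(** The identity of the joint Laplace functionals extends to events first in [X], with
    the exponential in [Theta] fixed, then in [Theta], with an event of [X] fixed.
    The measurability of [kappa ^~ B] extends from exponentials in the same way. *)
Theorem laplace_disintegration : conditional_distribution P X Theta kappa.
Proof.
rewrite /conditional_distribution => B mB.
have kB w : kappa w B = (\int[kappa w]_M \1_B M)%:E.
  by rewrite E_indic// fineK// fin_num_measure.
have bB := bmeas_indic R mB.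
split.
- move=> V mV; apply: sXE.
  have mk : measurable_fun setT (fun w : TX => kappa w B).
    by under eq_fun do rewrite kB; apply/measurable_EFinP; exact: (Hbmeas bB).2.
  by have := mk measurableT V mV; rewrite setTI.
- move=> _ [C mC <-]; rewrite setTI.
  have mXC : measurable (X @^-1` C) by rewrite -[X in measurable X]setTI; exact: mX.
  have mTB : measurable (Theta @^-1` B) by rewrite -[X in measurable X]setTI; exact: mTheta.
  have bCX : bmeas (fun w => \1_C (X w) : R) by apply: bmeas_compT => //; exact: bmeas_indic.
  transitivity (\int[P]_w (\1_B (Theta w) * \1_C (X w)))%:E.
    rewrite -[LHS]fineK ?fin_num_measure//; last exact: measurableI.
    rewrite -E_indic; last exact: measurableI.
    by congr EFin; apply: eq_Rintegral => w _; rewrite indicI mulrC.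
  rewrite joint_indic// -E_EFin; last by apply: bmeasM => //; exact: kbm.
  rewrite [RHS]integral_mkcond; apply: eq_integral => w _.
  rewrite patchE kB indicE; case: ifPn => XC.
    by rewrite mem_set ?mulr1//; move: XC; rewrite inE.
  by rewrite memNset ?mulr0//; move/negP: XC; rewrite inE.
Qed.

End disintegration.

(** * The posterior kernel *)

Section posterior_kernel.
Context (R : realType) d (Omega : measurableType d) (P : probability Omega R)
  dPsi (Psi : measurableType dPsi) (h : beta_prime_param R Psi)
  (theta : 'I_(bp_K h) + nat -> {RV P >-> R}) (psi : 'I_(bp_K h) + nat -> {RV P >-> Psi})
  (x : 'I_(bp_K h) + nat -> {RV P >-> bool}) (X : Omega -> measure_space R Psi).
Hypothesis singletons : forall p : Psi, measurable [set p].
Hypothesis prior : beta_prime_atoms theta psi.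
Hypothesis marks : odds_bernoulli_marks theta psi x.
Hypothesis XE : is_atomic_sum (fun k omega => (x k omega)%:R%R) psi X.

Local Notation K := (bp_K h).
Local Notation mint a M := (\int[M : {measure set Psi -> \bar R}]_p (a p)%:E)%E.
Local Notation F := (fixed_set h).

(** The almost sure finiteness of the number of observed atoms, in a form that
    depends on the observed measure only. *)
Definition finite_new (M : measure_space R Psi) : bool :=
  (measure_eval (~` F) M < +oo)%E.

Lemma measurable_finite_new :
  measurable_fun setT (finite_new : measure_space R Psi -> bool).
Proof.
apply: measurable_fun_lte => //; apply: measurable_measure_eval.
by apply: measurableC; exact: measurable_fixed_set.
Qed.

Let new w j : bool := x (inr j) w && (psi (inr j) w \notin F).

Let sum_new w (f : Psi -> R) : (forall p, 0 <= f p) ->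
  atom_sum (fun k => ((x k w)%:R * (\1_(~` F) (psi k w) * f (psi k w)))%:E) =
  (\sum_(j <oo) (if new w j then (f (psi (inr j) w))%:E else 0))%E.
Proof.
move=> f0; rewrite /atom_sum big1 ?add0e.
  apply: eq_eseriesr => j _; rewrite /new indicE in_setC.
  by case: (x (inr j) w); case: (_ \notin _); rewrite /= ?mul1r ?mul0r.
move=> k _; rewrite indicE memNset ?mul0r ?mulr0//= (crm_fix_loc (bp_crm prior)).
by apply; exists k.
Qed.

Let new_sum w : measure_eval (~` F) (X w) = (\sum_(j <oo) ((new w j)%:R : R)%:E)%E.
Proof.
have mFc : measurable (~` F) by apply: measurableC; exact: measurable_fixed_set.
rewrite XE// esum_atom_sum; last by move=> k; rewrite mule_ge0// lee_fin.
rewrite -[LHS](_ : atom_sum (fun k => ((x k w)%:R * (\1_(~` F) (psi k w) * 1))%:E) = _); last first.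
  by apply: eq_atom_sum => k; rewrite mulr1 EFinM.
rewrite (@sum_new w (fun=> 1))//; apply: eq_eseriesr => j _.
by case: ifP.
Qed.

Let finite_newP w : finite_new (X w) <-> finite_set [set j | new w j].
Proof.
rewrite /finite_new new_sum; split; first exact: finite_of_sum.
move=> fin; rewrite (_ : (\sum_(j <oo) _)%E = (\sum_(j <oo) (if new w j then (1 : R)%:E else 0))%E).
  by rewrite series_finite_support// sumEFin ltry.
by apply: eq_eseriesr => j _; case: ifP.
Qed.

(** The fixed atoms of the posterior are those of the prior, with parameters updated
    by [seen_at], followed by the finitely many new ones. *)
Lemma posterior_given_X w : finite_new (X w) ->
  exists Q : probability (measure_space R Psi) R,
  (forall a : Psi -> R, measurable_fun setT a -> (forall p, 0 <= a p) ->
    \int[Q]_M eN (mint a M) = post_laplace h a (X w)) /\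
  (injective (psi ^~ w) -> beta_prime_law Q).
Proof.
move=> /finite_newP fin.
pose s := finmap.enum_fset (fset_set [set j | new w j]).
pose n := size s.
have new_s j : j \in s -> new w j by rewrite in_fset_set// inE.
have us : uniq s by exact: finmap.fset_uniq.
pose loc (i : 'I_(K + n)) : Psi := match fintype.split i with
  | inl k => bp_loc k | inr j => psi (inr (nth 0%N s j)) w end.
pose xi (i : 'I_(K + n)) : R := match fintype.split i with
  | inl k => bp_xi_fix k + (seen_at k (X w))%:R | inr _ => bp_xi h + 1 end.
pose lam (i : 'I_(K + n)) : R := match fintype.split i with
  | inl k => bp_lambda_fix k + 1 | inr _ => bp_lambda h + 1 end.
have hx i : -1 < xi i.
  by rewrite /xi; case: (fintype.split i) => [k|_]; [exact: fix_post1|exact: (ord_post1 h)].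
have hl i : xi i + 1 < lam i.
  by rewrite /xi /lam; case: (fintype.split i) => [k|_]; [exact: fix_post2|exact: (ord_post2 h)].
have [Q [QL Qlaw]] := posterior_law singletons prior marks loc hx hl.
exists Q; split.
- move=> a ma a0; apply: (etrans (QL a ma a0)).
  apply: (f_equal2 *%R) => //; rewrite big_split_ord/=; apply: (f_equal2 *%R).
    apply: eq_bigr => k _; rewrite /xi /lam /loc.
    by rewrite (unsplitK (inl k : 'I_K + 'I_n)).
  pose l p := - ln (ord_laplace h (a p)).
  have l0 p : 0 <= l p.
    by rewrite oppr_ge0 ln_le0//; have /andP[] := ord_laplace01 h (a0 p).
  have lE p : eN (l p)%:E = ord_laplace h (a p).
    by rewrite /eN/= opprK lnK// posrE; have /andP[] := ord_laplace01 h (a0 p).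
  transitivity (\prod_(j <- s) ord_laplace h (a (psi (inr j) w))).
    rewrite (big_nth 0%N) big_mkord; apply: eq_bigr => j _; rewrite /xi /lam /loc.
    by rewrite (unsplitK (inr j : 'I_K + 'I_n)).
  have mn := measurable_neglog_laplace h singletons ma; have n0 p := neglog_laplace_ge0 h p a0.
  rewrite (mintX XE w mn n0).
  rewrite (sum_new w l0) (series_finite_support fin (F := fun j => (l (psi (inr j) w))%:E)); last first.
    by move=> j; rewrite lee_fin.
  rewrite eN_sum; last by move=> j; rewrite lee_fin.
  by apply: eq_bigr => j _; rewrite lE.
- move=> inj; apply: Qlaw => i i'; rewrite /loc => E.
  apply: (can_inj (@splitK K n)); move: E.
  have avoid (k : 'I_K) (j : 'I_n) : bp_loc k <> psi (inr (nth 0%N s j)) w.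
    move=> E; have /andP[_] := new_s _ (mem_nth 0%N (ltn_ord j)).
    by rewrite -E => /negP; apply; rewrite inE; exists k.
  case: (fintype.split i) => [k|j]; case: (fintype.split i') => [k'|j'].
  + by move=> /bp_loc_inj ->.
  + by move=> /avoid.
  + by move=> /esym /avoid.
  + move=> /inj [] /eqP; rewrite nth_uniq// => /eqP jj.
    by congr inr; exact: val_inj.
Qed.

Lemma finite_new_ae : {ae P, forall w, finite_new (X w)}.
Proof.
apply: filterS (observed_finite prior marks) => w fin; apply/finite_newP.
by apply: sub_finite_set fin => j /= /andP[].
Qed.

End posterior_kernel.

Local Open Scope ereal_scope.

Theorem corollary4p6 (R : realType)
    (dPsi : measure_display) (Psi : measurableType dPsi)
    (measurable_singleton : forall p : Psi, measurable [set p])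
    (d : measure_display) (Omega : measurableType d) (P : probability Omega R)
    (h : beta_prime_param R Psi)
    (theta : 'I_(bp_K h) + nat -> {RV P >-> R})
    (psi : 'I_(bp_K h) + nat -> {RV P >-> Psi})
    (x : 'I_(bp_K h) + nat -> {RV P >-> bool})
    (Theta X : Omega -> measure_space R Psi)
    (prior_atoms : beta_prime_atoms theta psi)
    (ThetaE : is_atomic_sum theta psi Theta)
    (likelihood_marks : odds_bernoulli_marks theta psi x)
    (XE : is_atomic_sum (fun k omega => (x k omega)%:R%R) psi X) :
  exists kappa : Omega -> probability (measure_space R Psi) R,
    conditional_distribution P X Theta kappa /\
    {ae P, forall omega, beta_prime_law (kappa omega)}.
Proof.
have mX := measurable_X XE; have mTheta := measurable_Theta prior_atoms ThetaE.
pose Q0 : probability (measure_space R Psi) R := distribution P (rv_of P mTheta).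
have : forall w, exists Q : probability (measure_space R Psi) R,
    if finite_new h (X w) then
      (forall a : Psi -> R, measurable_fun setT a -> (forall p, 0 <= a p)%R ->
        (\int[Q]_M eN (\int[M : {measure set Psi -> \bar R}]_p (a p)%:E)%E
          = post_laplace h a (X w))%R) /\
      (injective (psi ^~ w) -> beta_prime_law Q)
    else Q = Q0.
  (* The event [finite_new] belongs to the sigma-algebra of [X], so a constant law
     off this event keeps [kappa] measurable. *)
  move=> w; case fin : (finite_new h (X w)); last by exists Q0.
  exact: (posterior_given_X measurable_singleton prior_atoms likelihood_marks XE fin).
move=> /choice[kappa kappaE]; exists kappa; split; last first.
  have fin := finite_new_ae measurable_singleton prior_atoms likelihood_marks XE.
  apply: filterS2 (crm_distinct (bp_crm prior_atoms)) fin => w inj fw.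
  by have := kappaE w; rewrite fw => -[_]; apply.
pose c a : R := (\int[Q0]_M eN (\int[M : {measure set Psi -> \bar R}]_p (a p)%:E)%E)%R.
have kappa_laplace (a : Psi -> R) : measurable_fun setT a -> (forall p, 0 <= a p)%R ->
    (fun w => \int[kappa w]_M eN (\int[M : {measure set Psi -> \bar R}]_p (a p)%:E)%E)%R =
    (fun w => if finite_new h (X w) then post_laplace h a (X w) else c a).
  move=> ma a0; apply/funext => w; have := kappaE w.
  by case: (finite_new h (X w)) => [[E _]|->] //; exact: E.
have measurable_Z (T : measurableType _) (Y : T -> measure_space R Psi) (a : Psi -> R) :
    measurable_fun setT Y -> measurable_fun setT a -> (forall p, 0 <= a p)%R ->
    measurable_fun setT
      (fun w => if finite_new h (Y w) then post_laplace h a (Y w) else c a).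
  move=> mY ma a0; apply: measurable_fun_ifT.
  + by apply: (measurableT_comp _ mY); exact: measurable_finite_new.
  + by apply: (measurableT_comp _ mY); exact: measurable_post_laplace.
  + exact: measurable_cst.
apply: laplace_disintegration => //.
- move=> a ma a0; rewrite kappa_laplace//; apply: measurable_Z => //.
  by move=> _ V mV; apply: sub_sigma_algebra; exists V.
- move=> a b ma a0 mb b0.
  rewrite (joint_laplace prior_atoms likelihood_marks ThetaE XE ma a0 mb b0).
  rewrite -(joint_post_laplace measurable_singleton prior_atoms likelihood_marks XE ma a0 mb b0).
  have bX : bmeas (fun w => eN (\int[X w : {measure set Psi -> \bar R}]_p (b p)%:E)).
    apply: bmeas_eN.
      exact: (measurableT_comp (measurable_measure_integral mb b0) mX).
    by move=> w; apply: integral_ge0 => p _; rewrite lee_fin.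
  have bpl : bmeas (fun w => post_laplace h a (X w)).
    apply: bmeas01; last by move=> w; exact: post_laplace01.
    apply: (@measurableT_comp _ _ _ _ _ _ (post_laplace h a) _ X) => //.
    exact: measurable_post_laplace.
  have bZ : bmeas (fun w => if finite_new h (X w) then post_laplace h a (X w) else c a).
    split; first exact: measurable_Z.
    have [_ [N plN]] := bpl; exists (Num.max N `|c a|)%R => w.
    by case: ifP => _; rewrite le_max ?plN// lexx orbT.
  under [RHS]eq_Rintegral do rewrite (congr1 (@^~ _) (kappa_laplace a ma a0)).
  apply: E_ae.
  + exact: bmeasM.
  + exact: bmeasM.
  + have fin := finite_new_ae measurable_singleton prior_atoms likelihood_marks XE.
    by apply: filterS fin => w ->.
Qed.
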